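(* Let the Hamiltonian $H$ and the boundary functional $\sigma$ satisfy assumptions (B.1), (B.2), (B.3) stated in the context. Then a minimax solution of the Cauchy problem $$\partial_t\varphi(t,x(\cdot))+H\big(t,x(\cdot),\nabla\varphi(t,x(\cdot))\big)=0,\quad (t,x(\cdot))\in[0,T)\times C([-h,T],\mathbb{R}^n),\qquad \varphi(T,x(\cdot))=\sigma(x(\cdot)),\ x(\cdot)\in C([-h,T],\mathbb{R}^n),$$ exists and is unique.
   Context: Fix $n\in\mathbb{N}$, $h>0$, $T>0$. $\langle\cdot,\cdot\rangle$ and $\|\cdot\|$ are the Euclidean inner product and norm on $\mathbb{R}^n$. $C([-h,T],\mathbb{R}^n)$ is the space of continuous $x:[-h,T]\to\mathbb{R}^n$ with norm $\|x(\cdot)\|_{[-h,T]}=\max_{t\in[-h,T]}\|x(t)\|$. The set $[0,T]\times C([-h,T],\mathbb{R}^n)$ carries the metric $\mathrm{dist}((t,x(\cdot)),(\tau,y(\cdot)))=|t-\tau|+\|x(\cdot)-y(\cdot)\|_{[-h,T]}$; continuity/semicontinuity of functionals is with respect to it. A functional $\varphi:[0,T]\times C([-h,T],\mathbb{R}^n)\to\mathbb{R}$ is non-anticipative if for all $t\in[0,T)$ and $x(\cdot),y(\cdot)$ with $x(\tau)=y(\tau)$ for all $\tau\in[-h,t]$ one has $\varphi(t,x(\cdot))=\varphi(t,y(\cdot))$. For $(t,x(\cdot))$, $\mathrm{Lip}(t,x(\cdot))$ is the set of $y(\cdot)\in C([-h,T],\mathbb{R}^n)$ with $y=x$ on $[-h,t]$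 and $y$ Lipschitz on $[t,T]$. Assumptions on $H:[0,T]\times C([-h,T],\mathbb{R}^n)\times\mathbb{R}^n\to\mathbb{R}$ and $\sigma:C([-h,T],\mathbb{R}^n)\to\mathbb{R}$: (B.1) $H$ and $\sigma$ are continuous. (B.2) There is $c>0$ with $|H(t,x(\cdot),s)-H(t,x(\cdot),r)|\le c(1+\max_{\tau\in[-h,t]}\|x(\tau)\|)\|s-r\|$ for all $t\in[0,T]$, $x(\cdot)$, $s,r\in\mathbb{R}^n$. (B.3) For every compact $D\subset C([-h,T],\mathbb{R}^n)$ there is $\lambda>0$ with $|H(t,x(\cdot),s)-H(t,y(\cdot),s)|\le\lambda(1+\|s\|)\max_{\tau\in[-h,t]}\|x(\tau)-y(\tau)\|$ for all $t\in[0,T]$, $x(\cdot),y(\cdot)\in D$, $s\in\mathbb{R}^n$. With $c$ from (B.2), $Y(t,x(\cdot))$ is the set of $y(\cdot)\in\mathrm{Lip}(t,x(\cdot))$ with $\|\dot y(\tau)\|\le c(1+\max_{\xi\in[-h,\tau]}\|y(\xi)\|)$ for a.e. $\tau\in[t,T]$. A minimax solution is a functional $\varphi:[0,T]\times C([-h,T],\mathbb{R}^n)\to\mathbb{R}$ that is non-anticipative, continuous, satisfies $\varphi(T,x(\cdot))=\sigma(x(\cdot))$ for all $x(\cdot)$, and has property (M): for every $(t,x(\cdot))\in[0,T)\times C([-h,T],\mathbb{R}^n)$ and $s\in\mathbb{R}^n$ there exists $y(\cdot)\in Y(t,x(\cdot))$ with $\varphi(\tau,y(\cdot))-\varphi(t,x(\cdot))=\langle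 s,y(\tau)-x(t)\rangle-\int_t^\tau H(\xi,y(\cdot),s)\,d\xi$ for all $\tau\in[t,T]$. *)

(* Defs.v *)
From HB Require Import structures.
From mathcomp Require Import all_boot all_order all_algebra.
From mathcomp Require Import all_classical all_reals all_analysis.
Set Implicit Arguments. Unset Strict Implicit. Unset Printing Implicit Defensive.
Import Order.TTheory GRing.Theory Num.Theory.
Import numFieldNormedType.Exports.
Local Open Scope classical_set_scope.
Local Open Scope ring_scope.

Section Defs.
Variables (R : realType) (n : nat) (h T : R).

Definition dotv (u v : 'rV[R]_n) : R := \sum_(i < n) u ord0 i * v ord0 i.
Definition enorm (u : 'rV[R]_n) : R := Num.sqrt (dotv u u).

(* C([-h,T], R^n): continuous functions on [-h,T], represented canonically
   as functions on R that are constant outside [-h,T]. *)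
Record Cfun := MkCfun {
  cf :> R -> 'rV[R]_n;
  cf_cont : {within `[-h, T], continuous cf};
  cf_left : forall t, t < - h -> cf t = cf (- h);
  cf_right : forall t, T < t -> cf t = cf T }.

(* max_{tau in [a,b]} ||f tau|| (a max for continuous f, written as a sup) *)
Definition supn (f : R -> 'rV[R]_n) (a b : R) : R :=
  sup [set enorm (f tau) | tau in `[a, b]].

Definition cdist (x y : Cfun) : R := supn (fun tau => x tau - y tau) (- h) T.

Definition tdist (t : R) (x : Cfun) (tau : R) (y : Cfun) : R :=
  `|t - tau| + cdist x y.

Definition ccompact (D : set Cfun) : Prop :=
  forall u : nat -> Cfun, (forall k, D (u k)) ->
  exists (phi : nat -> nat) (l : Cfun), D l /\
    (forall i j, (i < j)%N -> (phi i < phi j)%N) /\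
    forall e : R, 0 < e -> exists N : nat, forall k, (N <= k)%N ->
      cdist (u (phi k)) l < e.

Definition H_continuous (H : R -> Cfun -> 'rV[R]_n -> R) : Prop :=
  forall t x s, t \in `[0, T] -> forall e : R, 0 < e -> exists2 d : R, 0 < d &
    forall tau y r, tau \in `[0, T] -> tdist t x tau y + enorm (s - r) < d ->
      `|H t x s - H tau y r| < e.

Definition sigma_continuous (sigma : Cfun -> R) : Prop :=
  forall x e, 0 < e -> exists2 d : R, 0 < d &
    forall y, cdist x y < d -> `|sigma x - sigma y| < e.

Definition B2 (H : R -> Cfun -> 'rV[R]_n -> R) (c : R) : Prop :=
  forall t (x : Cfun) s r, t \in `[0, T] ->
    `|H t x s - H t x r| <= c * (1 + supn x (- h) t) * enorm (s - r).

Definition B3 (H : R -> Cfun -> 'rV[R]_n -> R) : Prop :=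
  forall D : set Cfun, ccompact D -> exists2 lam : R, 0 < lam &
    forall t (x y : Cfun) s, t \in `[0, T] -> D x -> D y ->
      `|H t x s - H t y s| <= lam * (1 + enorm s) * supn (fun tau => x tau - y tau) (- h) t.

Definition Lip (t : R) (x y : Cfun) : Prop :=
  (forall tau, tau \in `[- h, t] -> y tau = x tau) /\
  exists L : R, forall a b, a \in `[t, T] -> b \in `[t, T] ->
    enorm (y a - y b) <= L * `|a - b|.

Definition Yset (c : R) (t : R) (x y : Cfun) : Prop :=
  Lip t x y /\
  exists N : set R, (@lebesgue_measure R).-negligible N /\
    forall tau, tau \in `[t, T] -> ~ N tau ->
      derivable (cf y) tau 1 /\
      enorm (derive (cf y) tau 1) <= c * (1 + supn y (- h) tau).

Definition non_anticipative (phi : R -> Cfun -> R) : Prop :=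
  forall t (x y : Cfun), t \in `[0, T[ ->
    (forall tau, tau \in `[- h, t] -> x tau = y tau) -> phi t x = phi t y.

Definition phi_continuous (phi : R -> Cfun -> R) : Prop :=
  forall t x, t \in `[0, T] -> forall e : R, 0 < e -> exists2 d : R, 0 < d &
    forall tau y, tau \in `[0, T] -> tdist t x tau y < d ->
      `|phi t x - phi tau y| < e.

Definition property_M (H : R -> Cfun -> 'rV[R]_n -> R) (c : R)
    (phi : R -> Cfun -> R) : Prop :=
  forall t (x : Cfun) (s : 'rV[R]_n), t \in `[0, T[ ->
    exists y : Cfun, Yset c t x y /\
      forall tau, tau \in `[t, T] ->
        phi tau y - phi t x =
          dotv s (y tau - x t)
          - \int[@lebesgue_measure R]_(xi in `[t, tau]) H xi y s.

Definition minimax_solution (H : R -> Cfun -> 'rV[R]_n -> R) (sigma : Cfun -> R)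
    (c : R) (phi : R -> Cfun -> R) : Prop :=
  [/\ non_anticipative phi, phi_continuous phi,
      (forall x, phi T x = sigma x) & property_M H c phi].

End Defs.

(* Main.v *)
(** A minimax solution is compared with any other functional along a time grid:
    property (M) gives, for a chosen vector [s], one characteristic for each of
    them, and [s] is taken to be the gradient of a Lyapunov functional
    [A(t) G(t, x - y)].  Here [G = (a - b)^2 + b^2] with [a] the squared running
    maximum of [|x - y|] and [b] the squared current value of [|x - y|].  As [a]
    only grows at times when [a = b], where [dG/da = 0], the functional [G] is
    differentiable along paths although the running maximum is not; it is
    comparable with [a^2], so it absorbs the Lipschitz bound (B.3) once [A(t)]
    decreases exponentially.  This gives uniqueness.

    For existence, on each dyadic grid one solves backwards the game
    [sup_s inf_f] with linear motions of velocity [|f| <= c (1 + max|x|)]; by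
    Isaacs' condition its value has both one-step inequalities for every [s].
    The comparison argument shows that these values are Cauchy and equicontinuous
    on compact sets of paths.  The limit has both one-sided inequalities between
    any two times; moving along stopped paths, the intermediate value theorem
    yields equality, first at the points of a grid and then, by compactness, at
    all times. *)

Require Import Defs.
From HB Require Import structures.
From mathcomp Require Import all_boot all_order all_algebra.
From mathcomp Require Import all_classical all_reals all_analysis.
From mathcomp Require Import ring lra.
Import Order.TTheory GRing.Theory Num.Theory.
Import numFieldNormedType.Exports.
Local Open Scope classical_set_scope.
Local Open Scope ring_scope.
Set Implicit Arguments.
Unset Strict Implicit.
Unset Printing Implicit Defensive.

(** * Almost everywhere differentiability of Lipschitz functions *)

(** The obstacle is that (B.3) bounds the difference of two Hamiltonians by [lam * (1 + |s|) * m],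
    with [m] the running maximum of [|x - y|]. Since [|s|] is at most a multiple of [A * m ^ 3], the
    part with [|s|] has degree four like [G], and the decrease of [A(t)] absorbs it. The bare term
    [lam * m] has degree one, and no multiple of [G] bounds it near zero. So every comparison has
    the form [A * G + eta] with [A] depending on [eta]. That is enough: for equal paths [G = 0] and
    [eta] is arbitrary, and for different paths the estimate is a modulus of continuity.

    Comparison runs in finite steps because each step needs its own [s]; the remainder of the gauge
    is quadratic in the step and disappears with the mesh. The recursion carries only boundedness of
    the discrete values on compact sets; their equicontinuity comes from comparing a scheme with
    itself.

    Differentiability of Lipschitz functions enters because the almost everywhere condition in
    [Y(t, x)] has to be exchanged for a bound on increments. *)

Section LipschitzAE.
Variable R : realType.
Notation mu := (@lebesgue_measure R).

(* The Stieltjes measures of [f] and of [id - f] add up to the Lebesgue measure, so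
   the first one has a density. *)
Lemma nondecreasing_lip1_density (f : R -> R) (a b : R) :
  (forall x y, x <= y -> 0 <= f y - f x <= y - x) ->
  exists d : R -> R, [/\ mu.-integrable setT (EFin \o d), forall x, 0 <= d x &
    forall x, a <= x <= b -> f x - f a = \int[mu]_(t in `]a, x]) d t].
Proof.
move=> fP.
have lipc (g : R -> R) : (forall x y, x <= y -> 0 <= g y - g x <= y - x) ->
    right_continuous g.
  move=> gP; apply: right_continuousW => x.
  apply/cvgrPdist_le => e e0; apply/nbhs_ballP; exists e => //= y.
  rewrite /ball/= => /ltW; rewrite !ler_norml => /andP[xy yx].
  by case: (leP x y) => [/gP|/ltW/gP]; lra.
have fnd : {homo f : x y / x <= y} by move=> x y /fP; lra.
pose g x := x - f x.
have gP x y : x <= y -> 0 <= g y - g x <= y - x by move=> /fP; rewrite /g; lra.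
have gnd : {homo g : x y / x <= y} by move=> x y /gP; lra.
pose F : cumulative R R := HB.pack f (isCumulative.Build R _ R f fnd (lipc f fP)).
pose G : cumulative R R := HB.pack g (isCumulative.Build R _ R g gnd (lipc g gP)).
pose nF := lebesgue_stieltjes_measure F.
pose nG := lebesgue_stieltjes_measure G.
have nE (H : cumulative R R) (x y : R) : x <= y ->
    lebesgue_stieltjes_measure H `]x, y]%classic = (H y - H x)%:E.
  move=> xy; rewrite /lebesgue_stieltjes_measure/= /measure_extension/=.
  by rewrite measurable_mu_extE/= ?wlength_itv_bnd//; exact: is_ocitv.
have sumE A : measurable A -> mu A = (nF A + nG A)%E.
  move=> mA; rewrite -(measure_addE nF nG).
  apply: lebesgue_measure_unique => //.
  move=> _ [[x y] _ <-] /=; rewrite -[RHS]/(measure_add nF nG _) measure_addE.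
  have [xy|yx] := leP x y; last first.
    by rewrite set_itv_ge ?bnd_simp -?leNgt ?(ltW yx)// !measure0 adde0.
  transitivity ((f y - f x)%:E + (g y - g x)%:E)%E; last first.
    by congr (_ + _)%E; apply/esym; [exact: (nE F)|exact: (nE G)].
  rewrite -[LHS]/(mu _) lebesgue_measure_itv/= lte_fin /g.
  rewrite -EFinD; case: ifPn => [_|]; first by congr EFin; lra.
  rewrite -leNgt => yx; have -> : x = y by lra.
  by congr EFin; lra.
(* The Stieltjes measure of [f] can have infinite mass. Cut down to []a, b]] it is finite, so its
   density is integrable over the whole line. *)
have mab : measurable (`]a, b]%classic : set R) by [].
pose nu0 : {measure set (measurableTypeR R) -> \bar R} := mrestr nF mab.
have nufin : fin_num_fun nu0.
  move=> A mA; rewrite /nu0/= /mrestr ge0_fin_numE ?measure_ge0//.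
  apply: (@le_lt_trans _ _ (nF `]a, b]%classic)).
    by apply: le_measure; rewrite ?inE//; apply: measurableI.
  have [ab|ba] := leP a b; first by rewrite /nF nE// ltry.
  rewrite set_itv_ge ?bnd_simp -?leNgt ?(ltW ba)//.
  by rewrite (_ : nF set0 = 0%E) ?ltry//; exact: (measure0 nF).
pose nu : {finite_measure set (measurableTypeR R) -> \bar R} :=
  HB.pack (mrestr nF mab) (Measure.on nu0)
    (Measure_isFinite.Build _ _ _ nu0 nufin).
have dom : nu `<< mu.
  move=> A muA B mB BA; have := sumE B mB; rewrite (muA B mB BA) => /esym/eqP.
  rewrite padde_eq0 ?measure_ge0// => /andP[/eqP nFB _].
  apply/eqP; rewrite eq_le measure_ge0 andbT -nFB.
  by apply: le_measure; rewrite ?inE//; apply: measurableI.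
have [d [d0 dfin dint dE]] := radon_nikodym_sigma_finite dom.
exists (fine \o d); split.
  by apply: eq_integrable dint => //= x _; rewrite fineK.
  by move=> x; rewrite fine_ge0.
move=> x /andP[ax xb]; rewrite /Rintegral.
under eq_integral => t _ do rewrite /= fineK//.
rewrite -dE// /nu/= /mrestr.
rewrite setIidl; last by apply: subset_itvl; rewrite bnd_simp.
by rewrite [X in fine X](_ : _ = (f x - f a)%:E)//; exact: (nE F).
Qed.

(** Lebesgue differentiation of the density: between [a] and [b] the function [f] is the indefinite
    integral up to the constant [f a]. *)
Lemma nondecreasing_lip1_ae_derivable (f : R -> R) (a b : R) :
  (forall x y, x <= y -> 0 <= f y - f x <= y - x) ->
  exists d : R -> R, [/\ mu.-integrable setT (EFin \o d), forall x, 0 <= d x,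
    forall x, a <= x <= b -> f x - f a = \int[mu]_(t in `]a, x]) d t &
    {ae mu, forall x, a < x < b -> is_derive x 1 f (d x)}].
Proof.
move=> fP; have [d [dint d0 dE]] := nondecreasing_lip1_density a b fP.
exists d; split => //.
have locd : locally_integrable setT d.
  by apply: open_integrable_locally => //; exact: openT.
have intd y : mu.-integrable [set` Interval (BRight a) (BRight y)] (EFin \o d).
  exact: integrableS dint.
have := FTC1 intd locd.
apply: filterS; first exact: (ae_filter_ringOfSetsType mu).
move=> x /= xP /andP[ax xb].
have [//|dF F'] := xP.
apply: (@near_eq_is_derive _ _ _
  (fun y => (\int[mu]_(t in [set` Interval (BRight a) (BRight y)]) d t) + f a)).
  near=> y; rewrite -dE ?subrK//.
  apply/andP; split; apply: ltW; near: y.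
    exact: lt_nbhsr.
  exact: lt_nbhsl.
rewrite -[d x]addr0; apply: is_deriveD; first by split; rewrite -?derive1E.
Unshelve. all: by end_near. Qed.

(** Division by [|L| + 1] makes [f] 1-Lipschitz, and averaging with the identity moves the slopes
    from [[-1, 1]] to [[0, 1]]. The added [1] keeps the divisor positive. *)
Lemma lipschitz_reduction (f : R -> R) (L : R) :
  (forall x y, `|f x - f y| <= L * `|x - y|) ->
  exists2 k : R, 0 < k & exists2 g : R -> R,
    forall x y, x <= y -> 0 <= g y - g x <= y - x &
    f = fun x => k * (2 * g x - x).
Proof.
move=> fL; exists (`|L| + 1); first by rewrite ltr_wpDl.
have k0 : 0 < `|L| + 1 by rewrite ltr_wpDl.
exists (fun x => (f x / (`|L| + 1) + x) / 2); last first.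
  by apply/funext => x; field; rewrite gt_eqF.
move=> x y xy.
have : `|(f y - f x) / (`|L| + 1)| <= y - x.
  rewrite normrM normfV (gtr0_norm k0) ler_pdivrMr//.
  apply: (le_trans (fL _ _)); rewrite [`|y - x|]ger0_norm ?subr_ge0// mulrC.
  by rewrite ler_wpM2l ?subr_ge0//; have := ler_norm L; lra.
by rewrite mulrBl ler_norml; lra.
Qed.

Lemma lipschitz_ae_derivable (f : R -> R) (L a b : R) :
  (forall x y, `|f x - f y| <= L * `|x - y|) ->
  {ae mu, forall x, a < x < b -> derivable f x 1}.
Proof.
move=> /lipschitz_reduction[k k0 [g gP ->]].
have [d [_ _ _]] := nondecreasing_lip1_ae_derivable a b gP.
apply: filterS; first exact: (ae_filter_ringOfSetsType mu).
move=> x /= xP /xP ?.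
by apply: ex_derive.
Qed.

(** A mean value inequality that tolerates a null set, because a Lipschitz function is the integral
    of its derivative. It turns the almost everywhere velocity bound of [Yset] into a bound on
    increments. *)
Lemma lipschitz_le_slope (f : R -> R) (L K a b : R) (N : set R) :
  a <= b -> 0 <= K ->
  (forall x y, `|f x - f y| <= L * `|x - y|) ->
  mu.-negligible N ->
  (forall x, a < x < b -> ~ N x -> derivable f x 1 -> 'D_1 f x <= K) ->
  f b - f a <= K * (b - a).
Proof.
rewrite le_eqVlt => /predU1P[->|ab] K0; first by rewrite !subrr mulr0.
move=> /lipschitz_reduction[k k0 [g gP ->]] NN fK.
have [d [dint d0 dE dae]] := nondecreasing_lip1_ae_derivable a b gP.
(* The slope of [g] that corresponds to the slope [K] of [k * (2 * g - id)]. *)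
pose C := (K / k + 1) / 2.
have C0 : 0 <= C by rewrite divr_ge0// addr_ge0// divr_ge0// ltW.
have le_dC : {ae mu, forall x, `]a, b]%classic x -> (d x)%:E <= C%:E}%E.
  have Nae : {ae mu, forall x, ~ N x}.
    case: NN => [N0 [mN0 N00 NN0]]; exists N0; split => // x /=.
    by rewrite not_notE; exact: NN0.
  (* The half-open interval of integration contains [b], where nothing is assumed about the
     derivative. *)
  have bae : {ae mu, forall x, x != b}.
    exists [set b]; split => //; first exact: lebesgue_measure_set1.
    by move=> x /= /negP; rewrite negbK => /eqP.
  move: dae Nae bae; apply: filterS3; first exact: (ae_filter_ringOfSetsType mu).
  move=> x /= xd xN xb; rewrite in_itv/= => /andP[ax xlb].
  have axb : a < x < b by rewrite ax lt_neqAle xb.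
  have dx := xd axb.
  have fx : is_derive x 1 (fun x => k * (2 * g x - x)) (k * (2 * d x - 1)).
    by apply: is_deriveZ.
  have := fK x axb xN (@ex_derive _ _ _ _ _ _ _ fx).
  rewrite (@derive_val _ _ _ _ _ _ _ fx) lee_fin => H.
  rewrite ler_pdivlMr// -lerBlDr ler_pdivlMr//; lra.
have dC : \int[mu]_(t in `]a, b]) d t <= C * (b - a).
  have mI : measurable (`]a, b]%classic : set R) by [].
  have intI : mu.-integrable `]a, b] (EFin \o d) by exact: integrableS dint.
  rewrite -lee_fin /Rintegral fineK; last exact: integrable_fin_num.
  apply: (@le_trans _ _ (\int[mu]_(t in `]a, b]) C%:E)%E).
    apply: ae_ge0_le_integral => //.
    - by move=> x _; rewrite lee_fin.
    - by case/integrableP: intI.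
  rewrite integral_cst// -[X in (_ * X)%E]/(mu _).
  by rewrite lebesgue_measure_itv/= lte_fin ab -EFinB -EFinM.
have := dE b; rewrite lexx ltW// => /(_ isT) gE.
have : g b - g a <= C * (b - a) by rewrite gE.
rewrite -(ler_pM2l k0).
rewrite /C; have -> : k * ((K / k + 1) / 2 * (b - a)) = (K + k) / 2 * (b - a).
  by field; rewrite gt_eqF.
lra.
Qed.
End LipschitzAE.

(** * Euclidean norm *)

Section Euclid.
Variables (R : realType) (n : nat).
Implicit Types (u v w : 'rV[R]_n) (a : R).

Lemma dotvC u v : dotv u v = dotv v u.
Proof. by apply: eq_bigr => i _; rewrite mulrC. Qed.

Lemma dotvDl u v w : dotv (u + v) w = dotv u w + dotv v w.
Proof. by rewrite /dotv -big_split; apply: eq_bigr => i _; rewrite mxE mulrDl. Qed.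

Lemma dotvZl a u w : dotv (a *: u) w = a * dotv u w.
Proof. by rewrite /dotv mulr_sumr; apply: eq_bigr => i _; rewrite mxE mulrA. Qed.

Lemma dotvNl u w : dotv (- u) w = - dotv u w.
Proof. by rewrite -scaleN1r dotvZl mulN1r. Qed.

Lemma dotvBl u v w : dotv (u - v) w = dotv u w - dotv v w.
Proof. by rewrite dotvDl dotvNl. Qed.

Lemma dotvDr u v w : dotv w (u + v) = dotv w u + dotv w v.
Proof. by rewrite dotvC dotvDl !(dotvC w). Qed.

Lemma dotvZr a u w : dotv w (a *: u) = a * dotv w u.
Proof. by rewrite dotvC dotvZl (dotvC w). Qed.

Lemma dotvNr u w : dotv w (- u) = - dotv w u.
Proof. by rewrite dotvC dotvNl (dotvC w). Qed.

Lemma dotvBr u v w : dotv w (u - v) = dotv w u - dotv w v.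
Proof. by rewrite dotvDr dotvNr. Qed.

Lemma dotv0 u : dotv u 0 = 0.
Proof. by rewrite -[X in dotv _ X](scale0r u) dotvZr mul0r. Qed.

Lemma dotv_ge0 u : 0 <= dotv u u.
Proof. by apply: sumr_ge0 => i _; rewrite -expr2 sqr_ge0. Qed.

Lemma enorm_ge0 u : 0 <= enorm u.
Proof. exact: sqrtr_ge0. Qed.
Hint Resolve enorm_ge0 : core.

Lemma enorm_sqr u : enorm u ^+ 2 = dotv u u.
Proof. by rewrite sqr_sqrtr ?dotv_ge0. Qed.

Lemma ler_coord_enorm u i : `|u ord0 i| <= enorm u.
Proof.
rewrite -(ler_pXn2r (n := 2)) ?nnegrE ?normr_ge0 ?enorm_ge0//.
rewrite enorm_sqr real_normK ?num_real// /dotv (bigD1 i)//= -expr2 lerDl.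
by apply: sumr_ge0 => j _; rewrite -expr2 sqr_ge0.
Qed.

Lemma enorm0_eq0 u : enorm u = 0 -> u = 0.
Proof.
move=> u0; apply/rowP => i; apply/eqP; rewrite mxE -normr_le0 -u0.
exact: ler_coord_enorm.
Qed.

Lemma enorm0 : enorm (0 : 'rV[R]_n) = 0.
Proof. by rewrite /enorm dotv0 sqrtr0. Qed.

Lemma enormZ a u : enorm (a *: u) = `|a| * enorm u.
Proof. by rewrite /enorm dotvZl dotvZr mulrA -expr2 sqrtrM ?sqr_ge0// sqrtr_sqr. Qed.

Lemma enormN u : enorm (- u) = enorm u.
Proof. by rewrite -scaleN1r enormZ normrN1 mul1r. Qed.

Lemma enormBC u v : enorm (u - v) = enorm (v - u).
Proof. by rewrite -enormN opprB. Qed.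

Lemma cauchy_schwarz u v : `|dotv u v| <= enorm u * enorm v.
Proof.
have [/eqP v0|v0] := boolP (enorm v == 0).
  by rewrite v0 mulr0 (enorm0_eq0 v0) dotv0 normr0.
have vpos : 0 < enorm v by rewrite lt_neqAle eq_sym v0 enorm_ge0.
rewrite -(ler_pXn2r (n := 2)) ?nnegrE ?normr_ge0 ?mulr_ge0//.
rewrite exprMn !enorm_sqr real_normK ?num_real//.
have vv0 : 0 < dotv v v by rewrite -enorm_sqr exprn_gt0.
have := dotv_ge0 (u - (dotv u v / dotv v v) *: v).
rewrite dotvBl !dotvBr !dotvZl !dotvZr (dotvC v u).
rewrite -(pmulr_lge0 _ vv0).
set a := dotv u v; set b := dotv v v in vv0 *; set c := dotv u u.
have -> : (c - a / b * a - (a / b * a - a / b * (a / b * b))) * b = c * b - a ^+ 2.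
  by field; rewrite gt_eqF.
by rewrite subr_ge0.
Qed.

Lemma dotv_le u v : dotv u v <= enorm u * enorm v.
Proof. exact: le_trans (ler_norm _) (cauchy_schwarz _ _). Qed.

Lemma enormD u v : enorm (u + v) <= enorm u + enorm v.
Proof.
rewrite -(ler_pXn2r (n := 2)) ?nnegrE ?addr_ge0//.
rewrite sqrrD !enorm_sqr dotvDl !dotvDr (dotvC v u).
by have := dotv_le u v; lra.
Qed.

Lemma enormB_tri w u v : enorm (u - v) <= enorm (u - w) + enorm (w - v).
Proof. by have := enormD (u - w) (w - v); rewrite addrA subrK. Qed.

Lemma enorm_lip u v : `|enorm u - enorm v| <= enorm (u - v).
Proof.
rewrite ler_norml; have := enormD (u - v) v; have := enormD (v - u) u.
by rewrite !subrK (enormBC v); lra.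
Qed.

Lemma mx_norm_le_enorm u : `|u| <= enorm u.
Proof.
rewrite /Num.Def.normr/= mx_normrE; apply: bigmax_le => // -[i j] _ /=.
by rewrite ord1; exact: ler_coord_enorm.
Qed.

Lemma enorm_le_mx_norm u : enorm u <= n%:R * `|u|.
Proof.
have ui i : `|u ord0 i| <= `|u|.
  rewrite [leRHS]/Num.Def.normr/= mx_normrE.
  by apply: (le_trans _ (le_bigmax _ _ (ord0, i))).
case: (posnP n) => [n0|n0].
  rewrite /enorm /dotv big1 ?sqrtr0 ?mulr_ge0 ?ler0n// => i _.
  by have := ltn_ord i; rewrite [X in (_ < X)%N]n0.
rewrite -(ler_pXn2r (n := 2)) ?nnegrE ?mulr_ge0 ?ler0n//.
rewrite enorm_sqr exprMn.
apply: (@le_trans _ _ (\sum_(i < n) `|u| ^+ 2)).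
  apply: ler_sum => i _; rewrite -expr2 -[u _ _ ^+ 2]real_normK ?num_real//.
  by rewrite ler_pXn2r ?nnegrE.
rewrite sumr_const card_ord -[leLHS]mulr_natl ler_wpM2r ?sqr_ge0//.
by rewrite -natrX ler_nat -mulnn leq_pmull.
Qed.

(** Stated with the Euclidean norm, whereas the topology on rows comes from the maximum norm; later
    estimates then stay in one norm. *)
Definition econt (f : R -> 'rV[R]_n) := forall t e, 0 < e ->
  exists2 d, 0 < d & forall t', `|t - t'| < d -> enorm (f t - f t') < e.

Lemma econtP f : econt f <-> continuous f.
Proof.
split=> fc t.
  apply/cvgrPdist_lt => e e0; have [d d0 dP] := fc t e e0.
  apply/nbhs_ballP; exists d => //= t' tt'.
  by apply: le_lt_trans (mx_norm_le_enorm _) _; exact: dP.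
move=> e e0; have e1 : 0 < e / (n%:R + 1) by rewrite divr_gt0// ltr_wpDl.
move/cvgrPdist_lt: (fc t) => /(_ _ e1)/nbhs_ballP[d /= d0 dP].
exists d => // t' tt'; have /= H := dP t' tt'.
apply: le_lt_trans (enorm_le_mx_norm _) _.
rewrite ltr_pdivlMr ?ltr_wpDl// in H; rewrite mulrC.
by apply: le_lt_trans H; rewrite ler_wpM2l// lerDl.
Qed.

End Euclid.
#[export] Hint Resolve enorm_ge0 : core.

(** * Sequential compactness *)

Section SequentialCompactness.
Variable R : realType.

Definition increasing_nat (phi : nat -> nat) :=
  forall i j, (i < j)%N -> (phi i < phi j)%N.

Lemma increasing_nat_ge phi : increasing_nat phi -> forall k, (k <= phi k)%N.
Proof.
by move=> phiI; elim=> // k IH; apply: leq_ltn_trans IH _; exact: phiI.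
Qed.

Lemma invS_small (e : R) : 0 < e ->
  exists N : nat, forall k, (N <= k)%N -> k.+1%:R^-1 < e.
Proof.
move=> e0; exists (Num.bound e^-1) => k Nk.
rewrite invf_plt ?posrE//; apply: lt_le_trans (archi_boundP _) _.
  by rewrite invr_ge0 ltW.
by rewrite ler_nat ltnW.
Qed.

(** [ccompact] is the instance for [cdist]. A bare function [dist] spares the paths a topology and
    also covers times, vectors and products. *)
Definition seq_compact (X : Type) (dist : X -> X -> R) (K : set X) :=
  forall u : nat -> X, (forall k, K (u k)) ->
  exists (phi : nat -> nat) (l : X), K l /\ increasing_nat phi /\
    forall e : R, 0 < e -> exists N : nat, forall k, (N <= k)%N ->
      dist (u (phi k)) l < e.

Lemma cluster_subseq (X : topologicalType) (u : nat -> X) (l : X)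
    (B : nat -> set X) :
  cluster (u @ \oo) l -> (forall j, nbhs l (B j)) ->
  exists phi, increasing_nat phi /\ forall j, B j (u (phi j)).
Proof.
move=> ul lB.
have ex j N : exists k, (N < k)%N /\ B j (u k).
  have /= := ul (u @` [set k | (N < k)%N]) (B j).
  case=> [|//|y [[k /= Nk <-] Bk]]; last by exists k.
  by exists N.+1 => // k /= Nk; exists k.
have /choice[g gP] : forall p : nat * nat, exists k, (p.2 < k)%N /\ B p.1 (u k).
  by move=> [j N]; exact: ex.
pose phi := fix phi j := if j is i.+1 then g (i.+1, phi i) else g (0%N, 0%N).
exists phi; split.
  have phiS k : (phi k < phi k.+1)%N by have [] := gP (k.+1, phi k).
  move=> i; elim=> // j IH; rewrite ltnS leq_eqVlt => /predU1P[->//|/IH].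
  by move=> ij; apply: ltn_trans ij (phiS j).
by case=> [|j]; [have [] := gP (0%N, 0%N) | have [] := gP (j.+1, phi j)].
Qed.

Lemma seq_compact_segment (a b : R) :
  seq_compact (fun s t => `|s - t|) [set t : R | a <= t <= b].
Proof.
move=> u uab.
have uF : (u @ \oo) `[a, b]%classic.
  by exists 0%N => // k _ /=; rewrite in_itv/=; exact: uab.
have [l [lab lc]] := @segment_compact R a b (u @ \oo) _ uF.
have nb j : nbhs l [set s : R | `|s - l| < j.+1%:R^-1].
  apply/nbhs_ballP; exists (j.+1%:R^-1) => //=.
  by move=> s /=; rewrite distrC.
have [phi [phiI phiB]] := cluster_subseq lc nb.
exists phi, l; split; first by move: lab; rewrite /= in_itv.
split => // e /invS_small[N NP]; exists N => k Nk.
exact: lt_trans (phiB k) (NP k Nk).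
Qed.

Section Consequences.
Variables (X : Type) (dist : X -> X -> R) (K : set X).
Hypothesis distC : forall x y, dist x y = dist y x.
Hypothesis dist_tri : forall x y z, dist x z <= dist x y + dist y z.
Hypothesis Kc : seq_compact dist K.

(** Heine-Cantor, by contradiction along a subsequence. The pseudo-distance [D] stands for
    [|g x - g y|] or for the norm of a difference, so the lemma serves functionals and paths
    alike. *)
Lemma seq_compact_unif (D : X -> X -> R) :
  (forall x y, D x y = D y x) -> (forall x y z, D x z <= D x y + D y z) ->
  (forall x, K x -> forall e, 0 < e -> exists2 d, 0 < d &
    forall y, K y -> dist x y < d -> D x y < e) ->
  forall e, 0 < e -> exists2 d, 0 < d &
    forall x y, K x -> K y -> dist x y < d -> D x y < e.
Proof.
move=> DC Dtri Dc e e0; apply: contrapT => /forall2NP nex.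
have /choice[p pP] : forall k : nat, exists p : X * X,
    [/\ K p.1, K p.2, dist p.1 p.2 < k.+1%:R^-1 & e <= D p.1 p.2].
  move=> k; have [] := nex k.+1%:R^-1.
    by rewrite invr_gt0 ltr0n.
  move=> /existsNP[x] /existsNP[y] /not_implyP[Kx] /not_implyP[Ky].
  by move=> /not_implyP[xy] /negP; rewrite -leNgt => ?; exists (x, y).
have [|phi [l [Kl [phiI phil]]]] := Kc (u := fun k => (p k).1).
  by move=> k; have [] := pP k.
have e2 : 0 < e / 2 by rewrite divr_gt0.
have [d d0 dP] := Dc l Kl _ e2.
have d2 : 0 < d / 2 by rewrite divr_gt0.
have [N1 N1P] := phil _ d2.
have [N2 N2P] := invS_small d2.
pose k := maxn N1 N2.
have [K1 K2 pd pD] := pP (phi k).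
have := N1P k (leq_maxl _ _).
have := N2P (phi k) (leq_trans (leq_maxr _ _) (increasing_nat_ge phiI k)).
move=> H1 /= H2.
have D1 : D l (p (phi k)).1 < e / 2 by apply: dP => //; rewrite distC; lra.
have D2 : D l (p (phi k)).2 < e / 2.
  apply: dP => //; have := dist_tri l (p (phi k)).1 (p (phi k)).2.
  rewrite (distC l (p (phi k)).1) => H3; apply: le_lt_trans H3 _.
  by rewrite (splitr d) ltrD// (lt_trans pd).
have := Dtri (p (phi k)).1 l (p (phi k)).2.
by rewrite (DC _ l); lra.
Qed.

Lemma seq_compact_bounded (g : X -> R) :
  (forall x, K x -> forall e, 0 < e -> exists2 d, 0 < d &
    forall y, K y -> dist x y < d -> `|g x - g y| < e) ->
  exists B, forall x, K x -> `|g x| <= B.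
Proof.
move=> gc; apply: contrapT => /forallNP nex.
have /choice[u uP] : forall k : nat, exists x, K x /\ k%:R < `|g x|.
  move=> k; have /existsNP[x] := nex k%:R.
  by move=> /not_implyP[Kx] /negP; rewrite -ltNge => ?; exists x.
have [|phi [l [Kl [phiI phil]]]] := Kc (u := u).
  by move=> k; have [] := uP k.
have [d d0 dP] := gc l Kl _ ltr01.
have [N NP] := phil d d0.
pose k := maxn N (Num.bound (`|g l| + 1)).
have [Kk gk] := uP (phi k).
have := dP _ Kk; rewrite distC => /(_ (NP k (leq_maxl _ _))).
have : `|g l| + 1 < (phi k)%:R.
  apply: lt_le_trans (archi_boundP _) _; first by rewrite addr_ge0.
  by rewrite ler_nat (leq_trans (leq_maxr _ _) (increasing_nat_ge phiI k)).

have : `|g (u (phi k))| <= `|g l| + `|g l - g (u (phi k))|.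
  rewrite -[X in `|X| <= _](subrK (g l)) addrC (distrC (g l)).
  exact: ler_normD.
lra.
Qed.
End Consequences.

Lemma seq_compact_prod (X Y : Type) dX dY (K : set X) (L : set Y) :
  seq_compact dX K -> seq_compact dY L ->
  seq_compact (fun p q : X * Y => dX p.1 q.1 + dY p.2 q.2)
    [set p | K p.1 /\ L p.2].
Proof.
move=> Kc Lc u uKL.
have [|phi [l [Kl [phiI phil]]]] := Kc (fun k => (u k).1).
  by move=> k; have [] := uKL k.
have [|psi [m [Lm [psiI psim]]]] := Lc (fun k => (u (phi k)).2).
  by move=> k; have [] := uKL (phi k).
exists (phi \o psi), (l, m); split => //; split.
  by move=> i j ij /=; apply/phiI/psiI.
move=> e e0; have e2 : 0 < e / 2 by rewrite divr_gt0.
have [N1 N1P] := phil _ e2; have [N2 N2P] := psim _ e2.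
exists (maxn N1 N2) => k Nk /=.
have := N1P (psi k) (leq_trans (leq_trans (leq_maxl _ _) Nk) (increasing_nat_ge psiI k)).
have := N2P k (leq_trans (leq_maxr _ _) Nk).
by move=> H2 /= H1; rewrite (splitr e) ltrD.
Qed.
End SequentialCompactness.

(** * Paths as functions on the whole line *)

Section Paths.
Variables (R : realType) (n : nat) (h T : R).
Hypotheses (hpos : 0 < h) (Tpos : 0 < T).
Notation Cf := (Cfun n h T).
Implicit Types (x y z : Cf) (t : R).

(** The retraction onto [[-h, T]]. A path equals its composite with it, so continuity on the
    interval becomes continuity on the line, and conversely every continuous function on the line
    yields a path ([mkC]). *)
Definition clamp t := Num.max (- h) (Num.min T t).

Lemma clampE t :
  [/\ t <= - h & clamp t = - h] \/ [/\ - h <= t <= T & clamp t = t] \/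
  [/\ T <= t & clamp t = T].
Proof.
rewrite /clamp; have hT : - h <= T by rewrite (@le_trans _ _ 0) ?oppr_le0 ?ltW.
have [tT|Tt] := leP T t; first by right; right; rewrite max_r.
have [th|ht] := leP t (- h); first by left.
by right; left; split => //; rewrite (ltW ht) ltW.
Qed.

Lemma clamp_itv t : - h <= clamp t <= T.
Proof.
have hp := hpos; have Tp := Tpos.
by case: (clampE t) => [|[]] [] ? ->; lra.
Qed.

Lemma clamp_id t : - h <= t <= T -> clamp t = t.
Proof. by case: (clampE t) => [|[]] [] ? ->; lra. Qed.

Lemma clamp_lip s t : `|clamp s - clamp t| <= `|s - t|.
Proof.
have hp := hpos; have Tp := Tpos.
by have := ler_norm (s - t); have := ler_norm (t - s); rewrite (distrC t) ler_norml;
  case: (clampE t) => [|[]] [] ? ->; case: (clampE s) => [|[]] [] ? ->; lra.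
Qed.

Lemma Cfun_clamp x t : x t = x (clamp t).
Proof.
case: (clampE t) => [[th ->]|[[_ ->]//|[tT ->]]].
  by have [->//|tN] := eqVneq t (- h); apply: cf_left; rewrite lt_neqAle tN.
by have [->//|tN] := eqVneq t T; apply: cf_right; rewrite lt_neqAle eq_sym tN.
Qed.

Lemma Cfun_econt x : econt x.
Proof.
move=> t e e0.
have e1 : 0 < e / (n%:R + 1) by rewrite divr_gt0// ltr_wpDl.
have := @cf_cont _ _ _ _ x; move=> /subspace_continuousP /(_ (clamp t)).
rewrite /= in_itv/= clamp_itv => /(_ isT)/cvgrPdist_lt/(_ _ e1).
rewrite near_withinE => /nbhs_ballP[d /= d0 dP].
exists d => // t' tt'.
have /= H : `|x (clamp t) - x (clamp t')| < e / (n%:R + 1).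
  apply: dP; last by rewrite /= in_itv/= clamp_itv.
  by apply: le_lt_trans (clamp_lip _ _) tt'.
rewrite (Cfun_clamp x t) (Cfun_clamp x t').
apply: le_lt_trans (enorm_le_mx_norm _) _.
rewrite ltr_pdivlMr ?ltr_wpDl// in H; rewrite mulrC.
by apply: le_lt_trans H; rewrite ler_wpM2l// lerDl.
Qed.

Section MkC.
Variables (f : R -> 'rV[R]_n) (fc : econt f).

Lemma mkC_cont : {within `[- h, T], continuous (f \o clamp)}.
Proof.
apply/continuous_subspaceT/econtP => t e e0.
have [d d0 dP] := fc (clamp t) e0; exists d => // t' tt'.
by apply: dP; apply: le_lt_trans (clamp_lip _ _) tt'.
Qed.

Lemma mkC_left t : t < - h -> (f \o clamp) t = (f \o clamp) (- h).
Proof.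
move=> th /=; rewrite (clamp_id (t := - h)); last first.
  by rewrite lexx (le_trans _ (ltW Tpos))// oppr_le0 ltW.
have hp := hpos; have Tp := Tpos.
by congr f; case: (clampE t) => [|[]] [] ? ->; lra.
Qed.

Lemma mkC_right t : T < t -> (f \o clamp) t = (f \o clamp) T.
Proof.
move=> th /=; rewrite (clamp_id (t := T)); last first.
  by rewrite lexx (le_trans _ (ltW Tpos))// oppr_le0 ltW.
have hp := hpos; have Tp := Tpos.
by congr f; case: (clampE t) => [|[]] [] ? ->; lra.
Qed.

Definition mkC : Cf := MkCfun mkC_cont mkC_left mkC_right.
Lemma mkCE t : - h <= t <= T -> mkC t = f t.
Proof. by move=> tT; rewrite /= clamp_id. Qed.
End MkC.

Lemma Cfun_unif x e : 0 < e -> exists2 d, 0 < d &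
  forall s t, `|s - t| < d -> enorm (x s - x t) < e.
Proof.
move=> e0.
have [|||||d d0 dP] := @seq_compact_unif R R (fun s t => `|s - t|)
    [set t | - h <= t <= T] _ _ (@seq_compact_segment R (- h) T)
    (fun s t => enorm (x s - x t)) _ _ _ e e0.
- by move=> s t; rewrite distrC.
- by move=> s t r; rewrite ler_distD.
- by move=> s t; rewrite enormBC.
- by move=> s t r; rewrite enormB_tri.
- move=> t _ e' e'0; have [d d0 dP] := @Cfun_econt x t e' e'0.
  by exists d => // t' _; exact: dP.
exists d => // s t st; rewrite (Cfun_clamp x s) (Cfun_clamp x t).
apply: dP; rewrite /= ?clamp_itv//.
exact: le_lt_trans (clamp_lip _ _) st.
Qed.

End Paths.

(** * Running maxima *)

Section Sup.
Variables (R : realType) (n : nat).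
Implicit Types (f g : R -> 'rV[R]_n) (a b t M : R).

Lemma econtB f g : econt f -> econt g -> econt (fun t => f t - g t).
Proof.
move=> fc gc t e e0; have e2 : 0 < e / 2 by rewrite divr_gt0.
have [d1 d10 d1P] := fc t _ e2; have [d2 d20 d2P] := gc t _ e2.
exists (Num.min d1 d2); first by rewrite lt_min d10.
move=> t'; rewrite lt_min => /andP[/d1P H1 /d2P H2].
have -> : f t - g t - (f t' - g t') = (f t - f t') + (g t' - g t).
  by rewrite opprB addrACA [RHS]addrACA (addrC (- g t)).
by apply: le_lt_trans (enormD _ _) _; rewrite (enormBC (g t')); lra.
Qed.

Lemma econt_comp f (k : R -> R) L :
  econt f -> (forall s t, `|k s - k t| <= L * `|s - t|) -> econt (f \o k).
Proof.
move=> fc kL t e e0; have [d d0 dP] := fc (k t) e e0.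
have L0 : 0 < `|L| + 1 by rewrite ltr_wpDl.
exists (d / (`|L| + 1)); first by rewrite divr_gt0.
move=> t' tt' /=; apply: dP; apply: le_lt_trans (kL _ _) _.
rewrite ltr_pdivlMr// in tt'; apply: le_lt_trans tt'.
by rewrite mulrC ler_wpM2l//; have := ler_norm L; lra.
Qed.

Lemma nbhs_enorm (v : 'rV[R]_n) (e : R) : 0 < e ->
  nbhs v [set w | enorm (w - v) < e].
Proof.
move=> e0.
have e1 : 0 < e / (n%:R + 1) by rewrite divr_gt0// ltr_wpDl.
have : (w @[w --> v] --> v) by exact: cvg_id.
move=> /cvgrPdist_lt/(_ _ e1); apply: filterS => w H.
  apply: le_lt_trans (enorm_le_mx_norm _) _.
  rewrite distrC ltr_pdivlMr ?ltr_wpDl// in H; rewrite mulrC.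
  by apply: le_lt_trans H; rewrite ler_wpM2l// lerDl.
Qed.

(** On an unbounded set [sup] is only a default value; compactness of the segment excludes this, and
    [supn_ub] rests on it. *)
Lemma supn_bounded f a b : econt f ->
  exists M, forall t, a <= t <= b -> enorm (f t) <= M.
Proof.
move=> fc; have [||M MP] := @seq_compact_bounded R R (fun s t => `|s - t|)
    [set t | a <= t <= b] _ (@seq_compact_segment R a b) (fun t => enorm (f t)).
- by move=> s t; rewrite distrC.
- move=> t _ e e0; have [d d0 dP] := fc t e e0; exists d => // t' _ /dP.
  exact: le_lt_trans (enorm_lip _ _).
by exists M => t tab; have := MP t tab; rewrite ger0_norm ?enorm_ge0.
Qed.

Lemma supn_ub f a b t : econt f -> a <= t <= b -> enorm (f t) <= supn f a b.
Proof.
move=> fc tab; apply: sup_ubound; last by exists t => //=; rewrite in_itv.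
have [M MP] := supn_bounded a b fc.
by exists M => _ [s /= + <-]; rewrite in_itv/=; exact: MP.
Qed.

Lemma supn_lub f a b M : a <= b ->
  (forall t, a <= t <= b -> enorm (f t) <= M) -> supn f a b <= M.
Proof.
move=> ab MP; apply: ge_sup.
  by exists (enorm (f a)), a => //=; rewrite in_itv/= lexx.
by move=> _ [s /= + <-]; rewrite in_itv/=; exact: MP.
Qed.

Lemma supn_ge0 f a b : econt f -> a <= b -> 0 <= supn f a b.
Proof.
by move=> fc ab; apply: le_trans (supn_ub (t := a) fc _); rewrite ?enorm_ge0 ?lexx.
Qed.

Lemma eq_supn f g a b : (forall t, a <= t <= b -> f t = g t) ->
  supn f a b = supn g a b.
Proof.
move=> fg; congr sup; apply/seteqP; split=> _ [t /= + <-]; rewrite in_itv/= => tab;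
  by exists t; rewrite /= ?in_itv ?fg.
Qed.

Lemma supn_mono f a b b' : econt f -> a <= b -> b <= b' -> supn f a b <= supn f a b'.
Proof.
move=> fc ab bb'; apply: supn_lub => // t /andP[ta tb].
by apply: supn_ub => //; rewrite ta (le_trans tb).
Qed.
End Sup.

(** * The space of paths and the Arzela-Ascoli theorem *)

Section PathSpace.
Variables (R : realType) (n : nat) (h T : R).
Hypotheses (hpos : 0 < h) (Tpos : 0 < T).
Notation Cf := (Cfun n h T).
Implicit Types (x y z : Cf) (t : R).

Let hT : - h <= T.
Proof. by rewrite (le_trans _ (ltW Tpos))// oppr_le0 ltW. Qed.

Lemma CfunB_econt x y : econt (fun t => x t - y t).
Proof. by apply: econtB; exact: Cfun_econt. Qed.

Lemma cdist_ub x y t : enorm (x t - y t) <= cdist x y.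
Proof.
rewrite (Cfun_clamp hpos Tpos x t) (Cfun_clamp hpos Tpos y t).
by apply: (supn_ub (CfunB_econt x y)); exact: clamp_itv.
Qed.

Lemma cdist_lub x y M : (forall t, - h <= t <= T -> enorm (x t - y t) <= M) ->
  cdist x y <= M.
Proof. exact: supn_lub. Qed.

Lemma cdistC x y : cdist x y = cdist y x.
Proof.
by apply/eqP; rewrite eq_le; apply/andP; split; apply: cdist_lub => t _;
  rewrite enormBC cdist_ub.
Qed.

Lemma cdist_tri x y z : cdist x z <= cdist x y + cdist y z.
Proof.
apply: cdist_lub => t _; apply: le_trans (enormB_tri (y t) _ _) _.
by rewrite lerD// cdist_ub.
Qed.

Lemma cdist_ge0 x y : 0 <= cdist x y.
Proof. exact: le_trans (enorm_ge0 _) (cdist_ub x y 0). Qed.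

Lemma cdist_xx x : cdist x x = 0.
Proof.
apply/eqP; rewrite eq_le cdist_ge0 andbT; apply: cdist_lub => t _.
by rewrite subrr enorm0.
Qed.

(** The sets of Arzela-Ascoli: a common bound and a common modulus of continuity [d]. The non-strict
    inequalities make them closed under pointwise limits. *)
Definition Dset (M : R) (d : R -> R) : set Cf :=
  [set z | (forall t, enorm (z t) <= M) /\
    forall e, 0 < e -> forall a b, `|a - b| < d e -> enorm (z a - z b) <= e].

(** Tychonoff's theorem in a product of boxes. A neighbourhood in the product topology controls
    finitely many times at once, and a cluster point is approached by arbitrarily late terms. *)
Lemma pointwise_cluster (M : R) (u : nat -> Cf) :
  (forall k t, enorm (u k t) <= M) ->
  exists l : R -> 'rV[R]_n, forall (m : nat) (p : 'I_m -> R) (e : R) (N : nat),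
    0 < e -> exists k, (N < k)%N /\ forall i, enorm (u k (p i) - l (p i)) < e.
Proof.
move=> uM.
pose A (_ : R) : set 'rV[R]_n := [set v | forall i, `[- M, M]%classic (v ord0 i)].
have Ac : @compact (prod_topology (fun _ : R => 'rV[R]_n))
    [set f | forall t, A t (f t)].
  apply: (@tychonoff R (fun _ => 'rV[R]_n)) => t.
  by apply: (@rV_compact R n (fun _ => `[- M, M]%classic)) => i; exact: segment_compact.
pose v (k : nat) : prod_topology (fun _ : R => 'rV[R]_n) := fun t => u k t.
have vA : (v @ \oo) [set f | forall t, A t (f t)].
  exists 0%N => // k _ t i /=; rewrite in_itv/= -ler_norml.
  exact: le_trans (ler_coord_enorm _ _) (uM k t).
have [l [_ lc]] := Ac (v @ \oo) _ vA.
exists l => m p e N e0.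
pose near_l := [set f : prod_topology (fun _ : R => 'rV[R]_n) |
  forall i : 'I_m, enorm (f (p i) - l (p i)) < e].
have lB : nbhs (l : prod_topology (fun _ : R => 'rV[R]_n)) near_l.
  apply: (@filter_forall _ 'I_m
    (fun i => [set f : prod_topology (fun _ : R => 'rV[R]_n) |
      enorm (f (p i) - l (p i)) < e])
    (nbhs (l : prod_topology (fun _ : R => 'rV[R]_n)))) => i.
  exact: (@proj_continuous R (fun _ => 'rV[R]_n) (p i) l _ (nbhs_enorm (l (p i)) e0)).
have [] := lc (v @` [set k | (N < k)%N]) near_l _ lB.
  by exists N.+1 => // k /= Nk; exists k.
by move=> _ [[k /= Nk <-] kP]; exists k.
Qed.

(** The pointwise cluster function inherits the bound and the modulus, since these involve only one
    or two times. Equicontinuity then upgrades closeness on a finite net of times to uniform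
    closeness. *)
Lemma Dset_compact (M : R) (d : R -> R) : (forall e, 0 < e -> 0 < d e) ->
  ccompact (Dset M d).
Proof.
move=> d0 u uD.
have [|l lP] := @pointwise_cluster M u; first by move=> k; have [] := uD k.
have lM t : enorm (l t) <= M.
  apply/ler_addgt0Pr => e e0; have [k [_ /(_ ord0) kt]] := lP 1%N (fun=> t) e 0%N e0.
  have := enormB_tri (u k t) (l t) 0; rewrite !subr0 enormBC.
  by have [/(_ t)] := uD k; lra.
have ld e : 0 < e -> forall a b, `|a - b| < d e -> enorm (l a - l b) <= e.
  move=> e0 a b ab; apply/ler_addgt0Pr => e' e'0.
  have e2 : 0 < e' / 2 by rewrite divr_gt0.
  have [k [_ kP]] := lP 2%N (fun i => if i == ord0 then a else b) _ 0%N e2.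
  have /= H1 := kP ord0; have /= H2 := kP (Ordinal (isT : (1 < 2)%N)).
  have [_ /(_ e e0 a b ab) H3] := uD k.
  have := enormB_tri (u k a) (l a) (l b); have := enormB_tri (u k b) (u k a) (l b).
  by rewrite (enormBC (l a) (u k a)); lra.
have lc : econt l.
  move=> t e e0; have e2 : 0 < e / 2 by rewrite divr_gt0.
  exists (d (e / 2)); first exact: d0.
  by move=> t' /(ld _ e2); lra.
pose L : Cf := mkC hpos Tpos lc.
have LD : Dset M d L.
  split; first by move=> t; exact: lM.
  move=> e e0 a b ab; apply: ld => //.
  exact: le_lt_trans (clamp_lip hpos Tpos _ _) ab.
(* The net has mesh [d (e / 4)]: moving to a net point costs [e / 4] for the term and again for the
   limit, and at the net point they differ by less than [e / 4]. *)
have net j N : exists k, (N < k)%N /\ cdist (u k) L < j.+1%:R^-1.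
  set e := j.+1%:R^-1; have e0 : 0 < e by rewrite invr_gt0.
  have e4 : 0 < e / 4 by rewrite divr_gt0.
  have r0 := d0 _ e4; set r := d (e / 4) in r0.
  pose m := (Num.bound ((T + h) / r)).+1.
  have [k [Nk kP]] := lP m (fun i => - h + i%:R * r) _ N e4.
  exists k; split => //.
  suff : cdist (u k) L <= e / 4 + e / 4 + e / 4 by lra.
  apply: cdist_lub => t thT; rewrite (mkCE hpos Tpos)//.
  have q0 : 0 <= (t + h) / r by rewrite divr_ge0 ?(ltW r0)//; move: thT; lra.
  pose i := Num.truncn ((t + h) / r).
  have /andP[i1 i2] : i%:R <= (t + h) / r < i.+1%:R by exact: truncn_itv.
  have im : (i < m)%N.
    rewrite ltnS -(ler_nat R); apply: (le_trans i1); apply: ltW.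
    have q1 : (t + h) / r <= (T + h) / r.
      by rewrite ler_wpM2r ?invr_ge0 ?(ltW r0)// lerD2r; case/andP: thT.
    exact: le_lt_trans q1 (archi_boundP (le_trans q0 q1)).
  have ti : `|t - (- h + i%:R * r)| < r.
    rewrite ler_pdivlMr// in i1; rewrite ltr_pdivrMr// -natr1 in i2.
    by rewrite ger0_norm; lra.
  have [_ uDk] := uD k.
  have H1 := uDk _ e4 _ _ ti; have H2 := ld _ e4 _ _ ti.
  have H3 := kP (Ordinal im); rewrite /= in H3.
  set s := - h + i%:R * r in H1 H2 H3 *.
  have := enormB_tri (u k s) (u k t) (l t); have := enormB_tri (l s) (u k s) (l t).
  by rewrite (enormBC (l s)); lra.
have /choice[g gP] : forall p : nat * nat,
    exists k, (p.2 < k)%N /\ cdist (u k) L < p.1.+1%:R^-1.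
  by move=> [j N]; exact: net.
pose phi := fix phi j := if j is i.+1 then g (i.+1, phi i) else g (0%N, 0%N).
have phiP j : cdist (u (phi j)) L < j.+1%:R^-1.
  by case: j => [|j]; [have [] := gP (0%N, 0%N) | have [] := gP (j.+1, phi j)].
exists phi, L; split => //; split.
  have phiS k : (phi k < phi k.+1)%N by have [] := gP (k.+1, phi k).
  move=> i; elim=> // j IH; rewrite ltnS leq_eqVlt => /predU1P[->//|/IH].
  by move=> ij; apply: ltn_trans ij (phiS j).
move=> e /invS_small[N NP]; exists N => k Nk.
exact: lt_trans (phiP k) (NP k Nk).
Qed.

End PathSpace.

(** * Admissible extensions of a path *)

Section Velocity.
Variables (R : realType) (n : nat).
Notation mu := (@lebesgue_measure R).
Implicit Types (y : R -> 'rV[R]_n) (e : 'rV[R]_n) (s : R).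

Lemma derive_dotv y e s : derivable y s 1 ->
  'D_1 (fun r => dotv e (y r)) s = dotv e ('D_1 y s).
Proof.
move=> ys; have yi := (derivable_mxP y s 1).1 ys.
have -> : (fun r => dotv e (y r)) =
    \sum_(i < n) (e ord0 i \*: (fun r : R => y r ord0 i)).
  by apply/funext => r; rewrite fct_sumE.
rewrite derive_sum => [|i]; last exact: derivableZ.
rewrite (derive_mx ys); apply: eq_bigr => i _.
by rewrite deriveZ// mxE.
Qed.

(** Only left difference quotients are used: in [Yi] the running maximum is taken at the right end
    of the interval, so a left quotient at [s] is bounded by the maximum up to [s] itself. *)
Lemma enorm_derive_le y s (B : R) : derivable y s 1 ->
  (exists2 d, 0 < d & forall a, s - d < a -> a < s ->
     enorm (y s - y a) <= B * (s - a)) ->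
  enorm ('D_1 y s) <= B.
Proof.
move=> ys [d d0 dP]; apply/ler_addgt0Pr => e e0.
have H : (fun h => h^-1 *: ((y \o shift s) (h *: (1 : R)) - y s)) @ 0^' --> 'D_1 y s := ys.
have := H _ (nbhs_enorm ('D_1 y s) e0).
move=> /= /nbhs_ballP[r /= r0 rP].
pose k := Num.min (r / 2) (d / 2).
have k0 : 0 < k by rewrite lt_min !divr_gt0.
have kr : k < r by apply: (@le_lt_trans _ _ (r / 2)); [rewrite ge_min lexx|lra].
have kd : k < d by apply: (@le_lt_trans _ _ (d / 2)); [rewrite ge_min lexx orbT|lra].
have kn0 : - k != 0 by rewrite oppr_eq0 gt_eqF.
have := rP (- k); rewrite /ball/= sub0r opprK gtr0_norm// => /(_ kr kn0).
rewrite [(- k) *: 1]mulr1 => H1.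
have H2 : enorm ((- k)^-1 *: (y (- k + s) - y s)) <= B.
  rewrite enormZ normfV normrN gtr0_norm// enormBC ler_pdivrMl// mulrC.
  have := dP (- k + s).
  have -> : s - (- k + s) = k by lra.
  by apply; lra.
set q := (- k)^-1 *: _ in H1 H2 *.
have := enormB_tri q ('D_1 y s) 0.
by rewrite !subr0 (enormBC _ q); move: H1 H2; lra.
Qed.

End Velocity.

Section Reach.
Variables (R : realType) (n : nat) (h T : R).
Hypotheses (hpos : 0 < h) (Tpos : 0 < T).
Notation Cf := (Cfun n h T).
Notation mu := (@lebesgue_measure R).
Implicit Types (x y z : Cf) (t a b c : R).

(* The integral form of [Yset]; unlike the derivative bound, it visibly passes to
   uniform limits. *)
Definition Yi c t x y :=
  (forall s, s <= t -> y s = x s) /\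
  forall a b, t <= a -> a <= b -> b <= T ->
    enorm (y b - y a) <= c * (1 + supn y (- h) b) * (b - a).

Lemma supn_cf_ge0 x t : - h <= t -> 0 <= supn x (- h) t.
Proof. by move=> ht; apply: supn_ge0 => //; exact: Cfun_econt. Qed.

Lemma supn_cf_ub x t s : - h <= t -> s <= t -> enorm (x s) <= supn x (- h) t.
Proof.
move=> ht st; have [hs|sh] := leP (- h) s.
  by apply: supn_ub; [exact: Cfun_econt|rewrite hs].
by rewrite cf_left//; apply: supn_ub; [exact: Cfun_econt|rewrite lexx].
Qed.

Lemma supn_cf_mono x s t : - h <= s -> s <= t -> supn x (- h) s <= supn x (- h) t.
Proof. by move=> hs st; apply: supn_mono => //; exact: Cfun_econt. Qed.

Lemma eq_supn_cf x y t : (forall s, s <= t -> x s = y s) ->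
  supn x (- h) t = supn y (- h) t.
Proof. by move=> xy; apply: eq_supn => s /andP[_ /xy]. Qed.

Section YsetYi.
Variables (c t : R) (x y : Cf).
Hypotheses (cpos : 0 < c) (t0T : 0 <= t <= T).

(** The retraction onto [[t, T]]: [y] is known to be Lipschitz only there, while the almost
    everywhere lemmas want functions that are Lipschitz on the line. *)
Let k s := Num.max t (Num.min T s).
Let kE s : [/\ s <= t & k s = t] \/ [/\ t <= s <= T & k s = s] \/
  [/\ T <= s & k s = T].
Proof.
case/andP: t0T => t0 tT.
rewrite /k; have [sT|Ts] := leP T s; first by right; right; rewrite max_r.
have [th|ht] := leP s t; first by left.
by right; left; split => //; rewrite (ltW ht) ltW.
Qed.
Let k_lip s r : `|k s - k r| <= `|s - r|.
Proof.
case/andP: t0T => t0 tT.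
have := ler_norm (s - r); have := ler_norm (r - s); rewrite (distrC r) ler_norml.
by case: (kE s) => [|[]] [] ? ->; case: (kE r) => [|[]] [] ? ->; lra.
Qed.
Let k_itv s : t <= k s <= T.
Proof. by case/andP: t0T => t0 tT; case: (kE s) => [|[]] [] ? ->; lra. Qed.
Let k_id s : t <= s <= T -> k s = s.
Proof. by case/andP: t0T => t0 tT; case: (kE s) => [|[]] [] ? ->; lra. Qed.

Let ht : - h <= t.
Proof. by have := hpos; case/andP: t0T; lra. Qed.

(** The increment [e] is tested against itself: [dotv e y] is a scalar Lipschitz function with slope
    at most [enorm e * B], which yields [enorm e ^ 2 <= enorm e * B * (b - a)]. *)
Lemma Yset_Yi : Yset c t x y -> Yi c t x y.
Proof.
case=> -[xy [L yL]] [N [NN NP]]; split.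
  move=> s st; have [hs|sh] := leP (- h) s.
    by apply: xy; rewrite in_itv/= hs.
  by rewrite !cf_left// xy// in_itv/= lexx.
move=> a b ta ab bT; pose e : 'rV[R]_n := y b - y a; rewrite -/e.
set B := c * (1 + supn y (- h) b).
have hb : - h <= b by move: ht; lra.
have B0 : 0 <= B by rewrite mulr_ge0 ?ltW// ltr_wpDr// supn_cf_ge0.
have [->|e0] := eqVneq (enorm e) 0; first by rewrite mulr_ge0// subr_ge0.
have epos : 0 < enorm e by rewrite lt_neqAle eq_sym e0 enorm_ge0.
pose f s := dotv e (y (k s)).
have fL s r : `|f s - f r| <= (enorm e * `|L|) * `|s - r|.
  rewrite /f -dotvBr; apply: le_trans (cauchy_schwarz _ _) _.
  rewrite -mulrA ler_wpM2l ?enorm_ge0//.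
  have H : enorm (y (k s) - y (k r)) <= L * `|k s - k r|.
    by apply: yL; rewrite in_itv/= k_itv.
  apply: le_trans H _; apply: (@le_trans _ _ (`|L| * `|k s - k r|)).
    by rewrite ler_wpM2r// ler_norm.
  by rewrite ler_wpM2l.
have fD s : a < s < b -> ~ N s -> derivable f s 1 -> 'D_1 f s <= enorm e * B.
  move=> /andP[sa sb] Ns _.
  have st : s \in `[t, T] by rewrite in_itv/=; lra.
  have [ds dB] := NP s st Ns.
  rewrite (near_eq_derive (g := fun r => dotv e (y r))); last first.
    have ts : t < s by lra.
    have sT : s < T by lra.
    near=> r; rewrite /f k_id//.
    by apply/andP; split; apply: ltW; near: r; [exact: lt_nbhsr|exact: lt_nbhsl].
  rewrite derive_dotv//; apply: le_trans (dotv_le _ _) _.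
  rewrite ler_wpM2l ?enorm_ge0//; apply: le_trans dB _.
  rewrite ler_wpM2l ?(ltW cpos)// lerD2l supn_cf_mono//; last exact: ltW.
  by move: ht; lra.
have := lipschitz_le_slope ab (mulr_ge0 (enorm_ge0 e) B0) fL NN fD.
rewrite /f !k_id; [|lra..].
by rewrite -dotvBr -/e -enorm_sqr expr2 -mulrA ler_pM2l.
Unshelve. all: by end_near. Qed.

(** Each coordinate is differentiable almost everywhere, and finitely many null sets have a null
    union. *)
Lemma Yi_Yset : Yi c t x y -> Yset c t x y.
Proof.
case=> xy yL; have hT : - h <= T by move: ht; case/andP: t0T; lra.
set L := c * (1 + supn y (- h) T).
have L0 : 0 <= L by rewrite mulr_ge0 ?ltW// ltr_wpDr// supn_cf_ge0.
have yLip a b : t <= a <= T -> t <= b <= T -> enorm (y a - y b) <= L * `|a - b|.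
  wlog ab : a b / b <= a.
    move=> H; have [|/ltW] := leP b a; first exact: H.
    by move=> ab at_ bt; rewrite enormBC distrC; exact: H.
  move=> /andP[ta aT] /andP[tb bT]; rewrite ger0_norm ?subr_ge0//.
  apply: le_trans (yL _ _ tb ab aT) _.
  rewrite ler_wpM2r ?subr_ge0// ler_wpM2l ?(ltW cpos)// lerD2l supn_cf_mono//.
  by move: ht; lra.
split.
  split; first by move=> s; rewrite in_itv/= => /andP[_]; exact: xy.
  by exists L => a b; rewrite !in_itv/=; exact: yLip.
have ae_i (i : 'I_n) : {ae mu, forall s, t < s < T ->
    derivable (fun r => y (k r) ord0 i) s 1}.
  apply: (@lipschitz_ae_derivable _ _ L) => s r.
  apply: (@le_trans _ _ (enorm (y (k s) - y (k r)))).
    by have := ler_coord_enorm (y (k s) - y (k r)) i; rewrite !mxE.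
  by apply: le_trans (yLip _ _ (k_itv s) (k_itv r)) _; rewrite ler_wpM2l.
have {}ae_i : {ae mu, forall s, forall i : 'I_n, t < s < T ->
    derivable (fun r => y (k r) ord0 i) s 1}.
  apply: (@filter_forall _ 'I_n (fun i s => t < s < T ->
    derivable (fun r => y (k r) ord0 i) s 1) (almost_everywhere mu)) => //.
  exact: (ae_filter_ringOfSetsType mu).
have [N [mN N0 NP]] := ae_i.
(* The endpoints join the null set because [y] may have a corner where it leaves [x] and where it
   becomes constant. *)
exists (N `|` [set t; T]); split.
  apply: negligibleU; first by exists N; split.
  apply: negligibleU; [exists [set t]|exists [set T]]; split => //;
  exact: lebesgue_measure_set1.
move=> s; rewrite in_itv/= => /andP[ts sT] /not_orP[Ns /not_orP[st sT']].
have {}ts : t < s by rewrite lt_neqAle ts andbT; apply/eqP => E; apply: st.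
have {}sT : s < T by rewrite lt_neqAle sT andbT; apply/eqP => E; apply: sT'.
have ds : derivable y s 1.
  apply/derivable_mxP => i j; rewrite ord1.
  apply: (near_eq_derivable (f := fun r => y (k r) ord0 j)).
    near=> r; rewrite k_id//.
    by apply/andP; split; apply: ltW; near: r; [exact: lt_nbhsr|exact: lt_nbhsl].
  have := contrapT (fun H => Ns (NP s H)).
  by move=> /(_ j); apply; rewrite ts.
split=> //; apply: enorm_derive_le => //.
exists (s - t); first by rewrite subr_gt0.
by move=> a ? ?; apply: yL; lra.
Unshelve. all: by end_near. Qed.

End YsetYi.
End Reach.

(** * Concatenated, stopped and linear motions; invariant compact sets *)

Section Tube.
Variables (R : realType) (n : nat) (h T c : R).
Hypotheses (hpos : 0 < h) (Tpos : 0 < T) (cpos : 0 < c).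
Notation Cf := (Cfun n h T).
Implicit Types (x y z : Cf) (t a b : R).

Lemma Yi_trans t t' x y z : 0 <= t -> t <= t' -> t' <= T ->
  Yi c t x y -> Yi c t' y z -> Yi c t x z.
Proof.
have hp := hpos.
move=> t0 tt' t'T [yx yL] [zy zL]; split.
  by move=> s st; rewrite zy ?yx// (le_trans st).
move=> a b ta ab bT; have [bt'|t'b] := leP b t'.
  rewrite !zy ?(le_trans ab)// (eq_supn_cf (y := y)); first exact: yL.
  by move=> s sb; rewrite zy// (le_trans sb).
have [t'a|at'] := leP t' a; first exact: zL.
apply: le_trans (enormB_tri (z t') _ _) _.
have H1 := zL t' b (lexx _) (ltW t'b) bT.
have H2 := yL a t' ta (ltW at') t'T.
rewrite (zy a (ltW at')) (zy t')//.
rewrite -(zy t')//.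
have H3 : supn y (- h) t' <= supn z (- h) b.
  rewrite -(@eq_supn_cf _ _ _ _ z); last by move=> s; exact: zy.
  by apply: supn_cf_mono => //; [move: hp t0; lra|exact: ltW].
have -> : c * (1 + supn z (- h) b) * (b - a) =
  c * (1 + supn z (- h) b) * (b - t') + c * (1 + supn z (- h) b) * (t' - a) by ring.
apply: lerD => //; rewrite zy//; apply: le_trans H2 _.
by rewrite ler_wpM2r ?subr_ge0 ?(ltW at')// ler_wpM2l ?(ltW cpos)// lerD2l.
Qed.

Lemma Yi_eq t x x' y : (forall s, s <= t -> x s = x' s) -> Yi c t x y -> Yi c t x' y.
Proof. by move=> xx' [yx yL]; split => // s st; rewrite yx ?xx'. Qed.

Lemma stop_lip (t s r : R) : `|Num.min t s - Num.min t r| <= 1 * `|s - r|.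
Proof.
rewrite mul1r; have := ler_norm (s - r); have := ler_norm (r - s).
rewrite (distrC r) ler_norml.
by have [] := leP t s; have [] := leP t r; lra.
Qed.

Definition stop t x : Cf :=
  mkC hpos Tpos (econt_comp (@Cfun_econt _ _ _ _ hpos Tpos x) (stop_lip t)).

Lemma stopE t x s : - h <= t <= T -> stop t x s = x (Num.min t s).
Proof.
move=> ht; rewrite /= [RHS](Cfun_clamp hpos Tpos); congr (cf x _).
have hp := hpos; have Tp := Tpos.
have [ts|st] := leP t s.
  have tc : t <= clamp h T s.
    by case: (clampE hpos Tpos s) => [|[]] [] H ->; move: H; lra.
  by rewrite (min_l tc) (clamp_id hpos Tpos ht).
have ct : clamp h T s <= t.
  by case: (clampE hpos Tpos s) => [|[]] [] H ->; move: H; lra.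
by rewrite (min_r ct).
Qed.

Lemma stop_le t x s : - h <= t <= T -> s <= t -> stop t x s = x s.
Proof. by move=> ht st; rewrite stopE// min_r. Qed.

Lemma stop_ge t x s : - h <= t <= T -> t <= s -> stop t x s = x t.
Proof. by move=> ht st; rewrite stopE// min_l. Qed.

Lemma Yi_stop t t' x y : 0 <= t -> t <= t' -> t' <= T ->
  Yi c t x y -> Yi c t x (stop t' y).
Proof.
have hp := hpos; move=> t0 tt' t'T [yx yL].
have ht' : - h <= t' <= T by move: t0 tt' hp; lra.
split; first by move=> s st; rewrite stop_le ?yx// (le_trans st).
move=> a b ta ab bT; have [t'a|at'] := leP t' a.
  rewrite !stop_ge// ?(le_trans t'a)// subrr enorm0.
  rewrite mulr_ge0 ?subr_ge0// mulr_ge0 ?(ltW cpos)// addr_ge0// supn_cf_ge0//.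
  by move: ta ab t0; lra.
have mE : forall s, s <= Num.min t' b -> stop t' y s = y s.
  by move=> s; rewrite le_min => /andP[st' _]; rewrite stop_le.
have [bt'|t'b] := leP b t'.
  rewrite !stop_le ?(ltW at')// (eq_supn_cf (y := y)); first exact: yL.
  by move=> s sb; rewrite stop_le// (le_trans sb).
rewrite (stop_le _ ht' (ltW at')) (stop_ge _ ht' (ltW t'b)).
apply: le_trans (yL a t' ta (ltW at') t'T) _.
have -> : supn y (- h) t' = supn (stop t' y) (- h) t'.
  by apply: eq_supn_cf => s st; rewrite stop_le.
have S0 : 0 <= 1 + supn (stop t' y) (- h) t'.
  by rewrite addr_ge0// supn_cf_ge0//; case/andP: ht'.
have S1 : supn (stop t' y) (- h) t' <= supn (stop t' y) (- h) b.
  by apply: supn_cf_mono => //; [case/andP: ht'|exact: ltW].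
apply: (@le_trans _ _ (c * (1 + supn (stop t' y) (- h) t') * (b - a))).
  by rewrite ler_wpM2l ?mulr_ge0 ?(ltW cpos)// lerD2r (ltW t'b).
by rewrite ler_wpM2r ?subr_ge0// ler_wpM2l ?(ltW cpos)// lerD2l.
Qed.

Lemma Yi_T x : Yi c T x x.
Proof.
split=> // a b Ta ab bT; have -> : b = a by lra.
by rewrite !subrr enorm0 mulr0.
Qed.

(** Multiplied by a velocity, this is the displacement of a motion that starts at [t] and rests from
    [t'] on. *)
Definition ramp t t' s : R := Num.max t (Num.min t' s) - t.

Lemma rampE t t' s : t <= t' ->
  [/\ s <= t & ramp t t' s = 0] \/ [/\ t <= s <= t' & ramp t t' s = s - t] \/
  [/\ t' <= s & ramp t t' s = t' - t].
Proof.
move=> tt'; rewrite /ramp; have [sT|Ts] := leP t' s; first by right; right; rewrite max_r.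
have [th|ht] := leP s t; first by left; rewrite subrr.
by right; left; split => //; rewrite (ltW ht) ltW.
Qed.

Lemma extend_econt t t' x (f : 'rV[R]_n) : t <= t' ->
  econt (fun s => x (Num.min t s) + ramp t t' s *: f).
Proof.
move=> tt'.
have -> : (fun s => x (Num.min t s) + ramp t t' s *: f) =
  (fun s => (x \o Num.min t) s - ramp t t' s *: (- f)).
  by apply/funext => s; rewrite scalerN opprK.
apply: econtB.
  exact: econt_comp (@Cfun_econt _ _ _ _ hpos Tpos x) (stop_lip t).
move=> s e e0; have f0 : 0 < enorm f + 1 by rewrite ltr_wpDl ?enorm_ge0.
exists (e / (enorm f + 1)); first by rewrite divr_gt0.
move=> s' ss'; rewrite -scalerBl enormZ enormN.
have rl : `|ramp t t' s - ramp t t' s'| <= `|s - s'|.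
  have := ler_norm (s - s'); have := ler_norm (s' - s).
  rewrite (distrC s') ler_norml.
  by case: (rampE s tt') => [|[]] [] ? ->; case: (rampE s' tt') => [|[]] [] ? ->; lra.
rewrite ltr_pdivlMr// in ss'; apply: le_lt_trans ss'.
apply: le_trans (ler_wpM2r (enorm_ge0 f) rl) _.
by rewrite ler_wpM2l// lerDl.
Qed.

Definition extend t t' x f (tt' : t <= t') : Cf :=
  mkC hpos Tpos (extend_econt x f tt').

Lemma extend_le t t' x f (tt' : t <= t') s : 0 <= t -> t <= T -> s <= t ->
  extend x f tt' s = x s.
Proof.
have hp := hpos; have Tp := Tpos.
move=> t0 tT st; rewrite (Cfun_clamp hpos Tpos x s) /extend /=.
have ct : clamp h T s <= t.
  by case: (clampE hpos Tpos s) => [|[]] [] ? ->; lra.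
rewrite min_r//; case: (rampE (clamp h T s) tt') => [|[]] [] H ->.
- by rewrite scale0r addr0.
- by have -> : clamp h T s - t = 0; [move: H; lra|rewrite scale0r addr0].
- by have -> : t' - t = 0; [move: H; lra|rewrite scale0r addr0].
Qed.

Lemma extend_mid t t' x f (tt' : t <= t') s : 0 <= t -> t' <= T -> t <= s <= t' ->
  extend x f tt' s = x t + (s - t) *: f.
Proof.
have hp := hpos; have Tp := Tpos.
move=> t0 tT st; rewrite mkCE//; last by move: st; lra.
rewrite min_l; last by case/andP: st.
by case: (rampE s tt') => [|[]] [] H ->; congr (_ + _ *: _); move: H; lra.
Qed.

Lemma Yi_extend t t' x f (tt' : t <= t') : 0 <= t -> t' <= T ->
  enorm f <= c * (1 + supn x (- h) t) -> Yi c t x (extend x f tt').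
Proof.
have hp := hpos; have Tp := Tpos.
move=> t0 t'T fL.
set y := extend x f tt'.
have tT : t <= T by exact: le_trans t'T.
have yE s : t <= s <= T -> y s = x t + ramp t t' s *: f.
  by move=> /andP[ts sT]; rewrite /y mkCE ?min_l//; move: ts t0 hp; lra.
split; first by move=> s st; rewrite /y extend_le.
move=> a b ta ab bT; rewrite !yE; [|lra..].
rewrite opprD addrACA subrr add0r -scalerBl enormZ.
have rl : `|ramp t t' b - ramp t t' a| <= b - a.
  rewrite ler_norml.
  by case: (rampE a tt') => [|[]] [] ? ->; case: (rampE b tt') => [|[]] [] ? ->; lra.
have S1 : supn x (- h) t <= supn y (- h) b.
  rewrite -(@eq_supn_cf _ _ _ _ y); last by move=> s st; rewrite /y extend_le.
  by apply: supn_cf_mono => //; move: hp t0 ta ab; lra.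
rewrite mulrC; apply: ler_pM => //; rewrite ?enorm_ge0//.
by apply: le_trans fL _; rewrite ler_wpM2l ?(ltW cpos)// lerD2l.
Qed.

(** Gronwall's inequality in discrete form. Over a time at most [d], where [c * d <= 1 / 2], the
    running maximum satisfies [S b <= S a + (1 + S b) / 2], so [1 + S] at most doubles; [N] such
    steps cover [[0, T]]. *)
Lemma Yi_growth M : 0 <= M -> exists2 M', 0 <= M' & forall t x y, 0 <= t <= T ->
  (forall s, enorm (x s) <= M) -> Yi c t x y -> forall s, enorm (y s) <= M'.
Proof.
have hp := hpos; have Tp := Tpos; have cp := cpos.
move=> M0; pose N := (Num.bound (2 * c * T)).+1.
pose d := T / N%:R.
have N0 : 0 < N%:R :> R by rewrite ltr0n.
have d0 : 0 < d by rewrite divr_gt0.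
have cd : c * d <= 1 / 2.
  rewrite /d mulrA ler_pdivrMr//.
  have : 2 * c * T < N%:R.
    apply: lt_trans (archi_boundP _) _; last by rewrite ltr_nat.
    by rewrite !mulr_ge0// ltW.
  lra.
exists (2 ^+ N * (1 + M)); first by rewrite mulr_ge0 ?exprn_ge0// addr_ge0.
move=> t x y /andP[t0 tT] xM [yx yL].
have main k b : t <= b -> b <= T -> b <= t + k%:R * d ->
    1 + supn y (- h) b <= 2 ^+ k * (1 + M).
  elim: k b => [|k IH] b tb bT.
    rewrite mul0r addr0 => bt; rewrite expr0 mul1r lerD2l.
    apply: supn_lub; first by move: hp t0 tb; lra.
    by move=> s /andP[_ sb]; rewrite yx ?xM// (le_trans sb).
  move=> btk; have [bk|kb] := leP b (t + k%:R * d).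
    apply: le_trans (IH b tb bT bk) _.
    by rewrite ler_wpM2r ?addr_ge0// exprS ler_peMl ?exprn_ge0// ler1n.
  set a := t + k%:R * d in kb.
  have ta : t <= a by rewrite lerDl mulr_ge0// ltW.
  have aT : a <= T by move: kb bT; lra.
  have qa := IH a ta aT (lexx _).
  have hb : - h <= b by move: hp t0 tb; lra.
  have ha : - h <= a by move: hp t0 ta; lra.
  have ba : b - a <= d by move: btk; rewrite -natr1 /a; lra.
  have Sb0 := supn_cf_ge0 hpos Tpos y hb.
  have : supn y (- h) b <= supn y (- h) a + (1 + supn y (- h) b) / 2.
    apply: supn_lub => // s /andP[hs sb].
    have [sa|as_] := leP s a.
      apply: (le_trans (supn_cf_ub hpos Tpos y ha sa)).
      by rewrite lerDl divr_ge0// addr_ge0.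
    have := enormB_tri (y a) (y s) 0; rewrite !subr0 => H.
    apply: le_trans H _; rewrite addrC; apply: lerD; first exact: supn_cf_ub.
    have hs' : supn y (- h) s <= supn y (- h) b.
      by apply: supn_cf_mono => //; move: ha as_; lra.
    apply: le_trans (yL a s ta (ltW as_) (le_trans sb bT)) _.
    apply: (@le_trans _ _ (c * (1 + supn y (- h) b) * d)).
      apply: ler_pM.
      - by rewrite mulr_ge0 ?(ltW cp)// addr_ge0// supn_cf_ge0//; move: hs; lra.
      - by rewrite subr_ge0 ltW.
      - by rewrite ler_wpM2l ?(ltW cp)// lerD2l.
      - by move: sb ba; lra.
    rewrite mulrAC mulrC ler_wpM2l ?addr_ge0//.
    by move: cd; lra.
  rewrite exprS -mulrA; lra.
have NT : t + N%:R * d >= T.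
  by rewrite /d mulrCA divff ?mulr1 ?gt_eqF//; lra.
move=> s; have hT : - h <= T by lra.
have := main N T tT (lexx _) NT.
have : enorm (y s) <= supn y (- h) T.
  have [sT|Ts] := leP s T; first exact: supn_cf_ub.
  by rewrite cf_right//; exact: supn_cf_ub.
lra.
Qed.

(* (B.3) gives a constant on one compact set of paths, which must therefore contain
   every path that an argument produces: hence the invariance. *)
Record tube (W : set Cf) (M : R) (d : R -> R) : Prop := MkTube {
  tube_M : 0 <= M;
  tube_d : forall e, 0 < e -> 0 < d e;
  tube_sub : W `<=` Dset M d;
  tube_inv : forall x y t, W x -> 0 <= t <= T -> Yi c t x y -> W y }.

(** [W] collects the admissible extensions of the paths in [K] from all departure times. It is
    invariant because a further extension either is concatenated or, when it departs earlier, is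
    itself an extension of the original path. *)
Lemma tube_exists (K : set Cf) M d : 0 <= M -> (forall e, 0 < e -> 0 < d e) ->
  K `<=` Dset M d -> exists W M' d', tube W M' d' /\ K `<=` W.
Proof.
have hp := hpos; have Tp := Tpos; have cp := cpos.
move=> M0 d0 KD; have [M' M'0 M'P] := Yi_growth M0.
pose W : set Cf := [set z | exists x t, [/\ K x, 0 <= t <= T & Yi c t x z]].
pose L := c * (1 + M').
have L0 : 0 < L by rewrite mulr_gt0// ltr_wpDr.
pose d' e := Num.min (d (e / 2)) (e / 2 / L).
exists W, M', d'; split; last first.
  by move=> x Kx; exists x, T; split; [|rewrite lexx ltW|exact: Yi_T].
split => //.
- by move=> e e0; rewrite /d' lt_min d0 ?divr_gt0.
- move=> z [x [t [Kx tT xz]]].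
  have [xM xd] := KD x Kx.
  have zM := M'P t x z tT xM xz; split => // e e0.
  have e2 : 0 < e / 2 by rewrite divr_gt0.
  case: xz => zx zL.
  (* An increment across the departure time splits there: half of [e] is left to the modulus of [x],
     half to the Lipschitz constant [L] afterwards. *)
  have main a b : a <= b -> - h <= a -> b <= T -> `|a - b| < d' e ->
      enorm (z a - z b) <= e.
    move=> ab ha bT; rewrite lt_min => /andP[dab Lab].
    have abn : `|a - b| = b - a by rewrite distrC ger0_norm ?subr_ge0.
    have zLip s r : t <= s -> s <= r -> r <= T -> r - s <= b - a ->
        enorm (z s - z r) <= e / 2.
      move=> ts sr rT rs; rewrite enormBC; apply: le_trans (zL s r ts sr rT) _.
      rewrite abn in Lab.
      apply: (@le_trans _ _ (L * (b - a))); last first.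
        by move: Lab; rewrite ltr_pdivlMr// mulrC => /ltW.
      apply: ler_pM; rewrite ?subr_ge0//.
        rewrite mulr_ge0 ?(ltW cp)// addr_ge0// supn_cf_ge0//.
        by move: tT ts sr hp; lra.
      rewrite ler_wpM2l ?(ltW cp)// lerD2l; apply: supn_lub => //.
      by move: tT ts sr hp; lra.
    have [ta|at_] := leP t a.
      by have := zLip a b ta ab bT (lexx _); lra.
    have [bt|tb] := leP b t.
      by rewrite !zx ?(ltW at_)//; have := xd _ e2 a b dab; lra.
    apply: le_trans (enormB_tri (z t) _ _) _.
    rewrite (splitr e); apply: lerD; last first.
      by apply: zLip => //; [exact: ltW|lra].
    rewrite !zx ?(ltW at_)//; apply: xd => //; apply: le_lt_trans dab.
    by rewrite abn distrC ger0_norm; lra.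
  move=> a b ab; rewrite (Cfun_clamp hpos Tpos z a) (Cfun_clamp hpos Tpos z b).
  have := le_lt_trans (clamp_lip hpos Tpos a b) ab.
  have /andP[] := clamp_itv hpos Tpos a; have /andP[] := clamp_itv hpos Tpos b.
  set a' := clamp h T a; set b' := clamp h T b => hb bT ha aT ab'.
  have [le_ab|/ltW le_ba] := leP a' b'; first exact: main.
  by rewrite enormBC; apply: main => //; rewrite distrC.
- move=> z z' t [x [r [Kx rT xz]]] tT zz'.
  have [rt|/ltW tr] := leP r t.
    exists x, r; split => //; apply: Yi_trans xz zz' => //; first by case/andP: rT.
    by case/andP: tT.
  exists x, t; split => //; apply: Yi_eq zz' => s st.
  by case: xz => zx _; rewrite zx// (le_trans st).
Qed.

Lemma Cfun_Dset x : exists M d, [/\ 0 <= M, forall e, 0 < e -> 0 < d e & Dset M d x].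
Proof.
have hp := hpos; have Tp := Tpos.
have /choice[d dP] : forall e : R, exists r, 0 < e -> 0 < r /\
    forall s t, `|s - t| < r -> enorm (x s - x t) < e.
  move=> e; have [e0|] := ltP 0 e; last by exists 0; lra.
  have [r r0 rP] := Cfun_unif hpos Tpos x e0.
  by exists r.
have hT : - h <= T by lra.
exists (supn x (- h) T), d; split.
- exact: supn_cf_ge0.
- by move=> e /dP[].
- split.
    move=> s; rewrite (Cfun_clamp hpos Tpos).
    by apply: supn_cf_ub => //; case/andP: (clamp_itv hpos Tpos s).
  by move=> e /dP[_ H] a b /H/ltW.
Qed.

Lemma Dset_mono M M' (d d' : R -> R) : M <= M' -> (forall e, d' e <= d e) ->
  Dset (n := n) (h := h) (T := T) M d `<=` Dset M' d'.
Proof.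
move=> MM' dd' x [xM xd]; split; first by move=> s; exact: le_trans (xM s) MM'.
by move=> e e0 a b ab; apply: xd => //; exact: lt_le_trans ab (dd' e).
Qed.

Lemma tube_pair x y : exists W M d, [/\ tube W M d, W x & W y].
Proof.
have [M1 [d1 [M10 d10 xD]]] := Cfun_Dset x.
have [M2 [d2 [M20 d20 yD]]] := Cfun_Dset y.
have [|||W [M [d [tW KW]]]] := @tube_exists [set z | z = x \/ z = y]
    (Num.max M1 M2) (fun e => Num.min (d1 e) (d2 e)).
- by rewrite le_max M10.
- by move=> e e0; rewrite lt_min d10 ?d20.
- move=> z [->|->].
    by apply: Dset_mono xD => [|e]; rewrite ?le_max ?ge_min lexx.
  by apply: Dset_mono yD => [|e]; rewrite ?le_max ?ge_min lexx orbT.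
by exists W, M, d; split => //; apply: KW; [left|right].
Qed.

End Tube.

(** * A differentiable gauge for the running maximum *)

Section Gauge.
Variables (R : realType) (n : nat) (h : R).
Implicit Types (z : R -> 'rV[R]_n) (t : R).

Definition gauge z t : R :=
  (supn z (- h) t ^+ 2 - enorm (z t) ^+ 2) ^+ 2 + enorm (z t) ^+ 4.

(** The gradient of [gauge] in the current value [z t], with the running maximum held fixed. *)
Definition gauge_grad z t : 'rV[R]_n :=
  (8 * enorm (z t) ^+ 2 - 4 * supn z (- h) t ^+ 2) *: z t.

(** A Taylor estimate with explicit remainder. Here [m], [w] are the maximum and the current norm
    before the step, [m'], [w'] those after it, [p] the scalar product of the value with its
    increment and [q] the squared increment. The constant is [26 = 2 + 2 * 4 + 16], from [S1], [S2]
    and [S3]. *)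
Lemma gauge_step_real (m m' w w' p q D M : R) :
  0 <= w -> 0 <= w' -> 0 <= D -> w <= m -> m <= m' -> m' <= M -> w' <= m' ->
  w' <= w + D -> w <= w' + D -> (m' = m \/ m' <= w + D) -> 0 <= q -> q <= D ^+ 2 ->
  w' ^+ 2 = w ^+ 2 + 2 * p + q ->
  (m' ^+ 2 - w' ^+ 2) ^+ 2 + w' ^+ 4 <=
  (m ^+ 2 - w ^+ 2) ^+ 2 + w ^+ 4 + (8 * w ^+ 2 - 4 * m ^+ 2) * p +
    26 * M ^+ 2 * D ^+ 2.
Proof.
move=> w0 w'0 D0 wm mm' m'M w'm' w'D wD m'P q0 qD pE.
have m0 : 0 <= m by lra.
have M0 : 0 <= M by lra.
have S1 : q * (4 * w ^+ 2 - 2 * m ^+ 2) <= 2 * M ^+ 2 * D ^+ 2.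
  have H1 : 4 * w ^+ 2 - 2 * m ^+ 2 <= 2 * M ^+ 2.
    have : w ^+ 2 <= m ^+ 2 by rewrite ler_pXn2r ?nnegrE.
    have : m ^+ 2 <= M ^+ 2 by rewrite ler_pXn2r ?nnegrE//; lra.
    lra.
  apply: (@le_trans _ _ (q * (2 * M ^+ 2))); first by rewrite ler_wpM2l.
  by rewrite mulrC ler_wpM2l// mulr_ge0// exprn_ge0.
have S2 : (w' ^+ 2 - w ^+ 2) ^+ 2 <= 4 * M ^+ 2 * D ^+ 2.
  have -> : (w' ^+ 2 - w ^+ 2) ^+ 2 = (w' - w) ^+ 2 * (w' + w) ^+ 2 by ring.
  have -> : 4 * M ^+ 2 * D ^+ 2 = D ^+ 2 * (2 * M) ^+ 2 by ring.
  apply: ler_pM; rewrite ?sqr_ge0//.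
    rewrite -real_normK ?num_real// ler_pXn2r ?nnegrE// ler_norml; lra.
  by rewrite ler_pXn2r ?nnegrE//; lra.
(* If the maximum has grown, then [m' - m <= D] and [m' - w' <= 2 * D]. Both factors are thus of
   order [D] whenever they are positive, so the growth of the maximum contributes only at second
   order. *)
have S3 : (m' ^+ 2 - m ^+ 2) * (m' ^+ 2 + m ^+ 2 - 2 * w' ^+ 2) <=
    16 * M ^+ 2 * D ^+ 2.
  have R0 : 0 <= 16 * M ^+ 2 * D ^+ 2 by rewrite !mulr_ge0// exprn_ge0.
  case: m'P => [->|m'D]; first by rewrite subrr mul0r.
  have a'a : 0 <= m' ^+ 2 - m ^+ 2 by rewrite subr_ge0 ler_pXn2r ?nnegrE//; lra.
  have [neg|pos] := leP (m' ^+ 2 + m ^+ 2 - 2 * w' ^+ 2) 0.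
    by apply: le_trans R0; rewrite mulr_ge0_le0.
  have -> : 16 * M ^+ 2 * D ^+ 2 = (D * (2 * M)) * (2 * ((2 * D) * (2 * M))) by ring.
  apply: ler_pM => //; first exact: ltW.
    rewrite subr_sqr; apply: ler_pM; lra.
  apply: (@le_trans _ _ (2 * (m' ^+ 2 - w' ^+ 2))); first by lra.
  by rewrite ler_wpM2l// subr_sqr; apply: ler_pM; lra.
have -> : w' ^+ 4 = (w' ^+ 2) ^+ 2 by ring.
have -> : w ^+ 4 = (w ^+ 2) ^+ 2 by ring.
have E1 : (m' ^+ 2 - w' ^+ 2) ^+ 2 + (w' ^+ 2) ^+ 2 =
  (m ^+ 2 - w ^+ 2) ^+ 2 + (w ^+ 2) ^+ 2
  + (m' ^+ 2 - m ^+ 2) * (m' ^+ 2 + m ^+ 2 - 2 * w' ^+ 2)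
  + (w' ^+ 2 - w ^+ 2) * (4 * w ^+ 2 - 2 * m ^+ 2) + 2 * (w' ^+ 2 - w ^+ 2) ^+ 2.
  by ring.
have E2 : (w' ^+ 2 - w ^+ 2) * (4 * w ^+ 2 - 2 * m ^+ 2) =
  (8 * w ^+ 2 - 4 * m ^+ 2) * p + q * (4 * w ^+ 2 - 2 * m ^+ 2).
  by rewrite pE; ring.
rewrite E1 E2; lra.
Qed.

Lemma gauge_step z t t' (D M : R) : econt z -> - h <= t -> t <= t' -> 0 <= D ->
  (forall s, t <= s <= t' -> enorm (z s - z t) <= D) ->
  (forall s, - h <= s <= t' -> enorm (z s) <= M) ->
  gauge z t' <= gauge z t + dotv (gauge_grad z t) (z t' - z t) +
    26 * M ^+ 2 * D ^+ 2.
Proof.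
move=> zc ht tt' D0 zD zM.
have ht' : - h <= t' by exact: le_trans tt'.
have D1 : enorm (z t' - z t) <= D by apply: zD; rewrite tt' lexx.
have D2 := enorm_lip (z t') (z t).
rewrite /gauge /gauge_grad dotvZl.
apply: (@gauge_step_real _ _ _ _ _ (enorm (z t' - z t) ^+ 2)); rewrite ?enorm_ge0//.
- by apply: supn_ub; rewrite // ht lexx.
- exact: supn_mono.
- exact: supn_lub.
- by apply: supn_ub; rewrite // ht' lexx.
- by move: D2; rewrite ler_norml; lra.
- by move: D2; rewrite ler_norml; lra.
(* A maximum that has grown was attained after [t], hence within [D] of the value at [t]. *)
- have : supn z (- h) t' <= Num.max (supn z (- h) t) (enorm (z t) + D).
    apply: supn_lub => // s /andP[hs st']; rewrite le_max.
    have [st|ts] := leP s t; first by rewrite supn_ub ?hs.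
    apply/orP; right.
    have := zD s; rewrite (ltW ts) st' => /(_ isT).
    by have := enorm_lip (z s) (z t); rewrite ler_norml; lra.
  rewrite le_max => /orP[H|]; last by right.
  by left; apply/eqP; rewrite eq_le H supn_mono.
- by rewrite exprn_ge0// enorm_ge0.
- by rewrite ler_pXn2r ?nnegrE ?enorm_ge0.
- have : z t' = z t + (z t' - z t) by rewrite addrC subrK.
  move: (z t' - z t) => e ->.
  by rewrite !enorm_sqr dotvDl !dotvDr (dotvC e (z t)); ring.
Qed.

Lemma gauge_ub z t : econt z -> - h <= t -> gauge z t <= supn z (- h) t ^+ 4.
Proof.
move=> zc ht; rewrite /gauge; set m := supn _ _ _; set w := enorm _.
have wm : w ^+ 2 <= m ^+ 2.
  rewrite ler_pXn2r ?nnegrE ?enorm_ge0 ?supn_ge0//.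
  by apply: supn_ub; rewrite // ht lexx.
have : 0 <= w ^+ 2 * (m ^+ 2 - w ^+ 2) by rewrite mulr_ge0 ?sqr_ge0 ?subr_ge0.
have -> : (m ^+ 2 - w ^+ 2) ^+ 2 + w ^+ 4 = m ^+ 4 - 2 * (w ^+ 2 * (m ^+ 2 - w ^+ 2)).
  by ring.
lra.
Qed.

Lemma gauge_lb z t : supn z (- h) t ^+ 4 <= 2 * gauge z t.
Proof.
rewrite /gauge; set m := supn _ _ _; set w := enorm _.
rewrite -subr_ge0.
have -> : 2 * ((m ^+ 2 - w ^+ 2) ^+ 2 + w ^+ 4) - m ^+ 4 = (m ^+ 2 - 2 * w ^+ 2) ^+ 2.
  by ring.
exact: sqr_ge0.
Qed.

Lemma gauge_ge0 z t : 0 <= gauge z t.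
Proof. by rewrite /gauge addr_ge0 ?sqr_ge0// exprn_ge0// enorm_ge0. Qed.

Lemma gauge_grad_le z t : econt z -> - h <= t ->
  enorm (gauge_grad z t) <= 4 * supn z (- h) t ^+ 3.
Proof.
move=> zc ht; rewrite /gauge_grad enormZ; set m := supn _ _ _; set w := enorm _.
have w0 : 0 <= w by exact: enorm_ge0.
have w_m : w <= m by apply: supn_ub; rewrite // ht lexx.
have wm : w ^+ 2 <= m ^+ 2 by rewrite ler_pXn2r ?nnegrE//; lra.
have -> : 4 * m ^+ 3 = (4 * m ^+ 2) * m by ring.
have w20 : 0 <= w ^+ 2 by rewrite sqr_ge0.
by apply: ler_pM => //; rewrite ler_norml; lra.
Qed.

Lemma gauge0 z t : - h <= t -> (forall s, - h <= s <= t -> z s = 0) -> gauge z t = 0.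
Proof.
move=> ht z0; rewrite /gauge z0 ?lexx ?ht// enorm0.
have -> : supn z (- h) t = supn (fun=> 0 : 'rV[R]_n) (- h) t by exact: eq_supn.
have -> : supn (fun=> 0 : 'rV[R]_n) (- h) t = 0.
  apply/eqP; rewrite eq_le supn_lub//=; last by move=> s _; rewrite enorm0.
  apply: supn_ge0 => // s e e0; exists 1 => // s' _.
  by rewrite subrr enorm0.
by rewrite expr0n/= expr0n/= subrr expr0n addr0.
Qed.

Lemma eq_gauge z z' t : - h <= t -> (forall s, - h <= s <= t -> z s = z' s) ->
  gauge z t = gauge z' t.
Proof.
move=> ht zz'; rewrite /gauge (eq_supn (g := z'))//.
by rewrite zz'// ht lexx.
Qed.

Lemma eq_gauge_grad z z' t : - h <= t -> (forall s, - h <= s <= t -> z s = z' s) ->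
  gauge_grad z t = gauge_grad z' t.
Proof.
move=> ht zz'; rewrite /gauge_grad (eq_supn (g := z'))//.
by rewrite zz'// ht lexx.
Qed.

Lemma gaugeN z t : gauge (fun s => - z s) t = gauge z t.
Proof.
rewrite /gauge enormN; congr ((_ ^+ 2 - _) ^+ 2 + _).
by congr sup; apply/seteqP; split=> _ [q qt <-]; exists q => //; rewrite enormN.
Qed.

Lemma lyapunov_absorb (m g G A lam e : R) : 0 <= m -> g <= 4 * m ^+ 3 ->
  m ^+ 4 <= 2 * G -> 0 < e -> 0 < lam -> 2 / e ^+ 3 <= A ->
  lam * (1 + A * g) * m <= lam * e + 9 * lam * (A * G).
Proof.
move=> m0 gm mG e0 lam0 eA.
have e3 : 0 < e ^+ 3 by rewrite exprn_gt0.
have A0 : 0 <= A by apply: le_trans eA; rewrite divr_ge0// ltW.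
have G0 : 0 <= G by have := exprn_ge0 4 m0; lra.
have H1 : m <= e + A * G.
  have [me|em] := leP m e; first by have := mulr_ge0 A0 G0; lra.
  have : 2 / e ^+ 3 * G <= A * G by rewrite ler_wpM2r.
  have : m <= 2 / e ^+ 3 * G; last by lra.
  rewrite mulrAC ler_pdivlMr//; apply: le_trans mG.
  by rewrite (exprS m 3) ler_wpM2l// ler_pXn2r ?nnegrE// ltW.
have H2 : A * g * m <= 8 * (A * G).
  have : A * (g * m) <= A * (4 * m ^+ 4).
    by rewrite ler_wpM2l// (exprSr m 3) mulrA ler_wpM2r.
  by have := ler_wpM2l A0 mG; lra.
have := ler_wpM2l (ltW lam0) (lerD H1 H2).
lra.
Qed.

End Gauge.

(** * Compactness estimates for the Hamiltonian *)

Section Hamiltonian.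
Variables (R : realType) (n : nat) (h T c : R).
Hypotheses (hpos : 0 < h) (Tpos : 0 < T) (cpos : 0 < c).
Notation Cf := (Cfun n h T).
Notation mu := (@lebesgue_measure R).
Implicit Types (x y z : Cf) (t a b : R) (s r : 'rV[R]_n).

(** A vector is a constant path, so this is read off from [Dset_compact]. *)
Lemma ball_compact (S : R) :
  seq_compact (fun s r => enorm (s - r)) [set s : 'rV[R]_n | enorm s <= S].
Proof.
have cc s : econt (fun _ : R => s : 'rV[R]_n).
  by move=> t e e0; exists 1 => // t' _; rewrite subrr enorm0.
move=> u uS.
have [||phi [l [lD [phiI phil]]]] := @Dset_compact R n h T hpos Tpos S (fun=> 1) _
    (fun k => mkC hpos Tpos (cc (u k))).
- by [].
- move=> k; split; first by move=> t; exact: uS.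
  by move=> e e0 a b _ /=; rewrite subrr enorm0 ltW.
exists phi, (l 0); split; first by have [lS _] := lD; exact: (lS 0).
split => // e /phil[N NP]; exists N => k /NP.
by apply: le_lt_trans; exact: (cdist_ub hpos Tpos (mkC hpos Tpos (cc (u (phi k)))) l 0).
Qed.

Variable (H : R -> Cf -> 'rV[R]_n -> R).
Hypotheses (B1H : H_continuous H) (B2H : B2 H c) (B3H : B3 H).

Lemma timepath_compact M d : (forall e, 0 < e -> 0 < d e) ->
  seq_compact (fun p q : R * Cf => `|p.1 - q.1| + cdist p.2 q.2)
    [set p | 0 <= p.1 <= T /\ Dset M d p.2].
Proof.
move=> d0; apply: (@seq_compact_prod R R Cf (fun t t' => `|t - t'|) (@cdist R n h T)
  [set t | 0 <= t <= T] (Dset M d)); first exact: seq_compact_segment.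
exact: Dset_compact.
Qed.

Section PhiCompact.
Variables (phi : R -> Cf -> R) (M : R) (d : R -> R).
Hypotheses (phic : phi_continuous phi) (d0 : forall e, 0 < e -> 0 < d e).

Lemma phi_unif e : 0 < e -> exists2 k, 0 < k & forall t t' x y,
  0 <= t <= T -> 0 <= t' <= T -> Dset M d x -> Dset M d y ->
  `|t - t'| + cdist x y < k -> `|phi t x - phi t' y| < e.
Proof.
move=> e0; have [|||||k k0 kP] := @seq_compact_unif R (R * Cf)%type _ _ _ _
  (timepath_compact (M := M) d0) (fun p q => `|phi p.1 p.2 - phi q.1 q.2|) _ _ _ e e0.
- by move=> p q /=; rewrite distrC (cdistC hpos Tpos).
- move=> p q r; rewrite addrACA; apply: lerD; first exact: ler_distD.
  exact: (cdist_tri hpos Tpos).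
- by move=> p q; rewrite distrC.
- by move=> p q r; exact: ler_distD.
- move=> [t x] [tT xD] e' e'0.
  have [|k k0 kP] := phic (t := t) x _ e'0; first by rewrite in_itv.
  by exists k => // -[t' y] [t'T yD] /= ?; apply: kP => //; rewrite in_itv.
by exists k => // t t' x y tT t'T xD yD ?; apply: (kP (t, x) (t', y)).
Qed.

End PhiCompact.

Section HCompact.
Variables (M S : R) (d : R -> R).
Hypotheses (d0 : forall e, 0 < e -> 0 < d e).

Let Kc := seq_compact_prod (timepath_compact (M := M) d0) (ball_compact (S := S)).

Let Hc (p : R * Cf * 'rV[R]_n) :
  (0 <= p.1.1 <= T /\ Dset M d p.1.2) /\ enorm p.2 <= S ->
  forall e, 0 < e -> exists2 k, 0 < k & forall q,
    (0 <= q.1.1 <= T /\ Dset M d q.1.2) /\ enorm q.2 <= S ->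
    `|p.1.1 - q.1.1| + cdist p.1.2 q.1.2 + enorm (p.2 - q.2) < k ->
    `|H p.1.1 p.1.2 p.2 - H q.1.1 q.1.2 q.2| < e.
Proof.
case: p => -[t x] s /= [[tT xD] sS] e e0.
have [|k k0 kP] := B1H (t := t) x s _ e0; first by rewrite in_itv.
by exists k => // -[[t' y] r] /= [[t'T _] _] ?; apply: kP => //; rewrite in_itv.
Qed.

Lemma H_unif e : 0 < e -> exists2 k, 0 < k & forall t t' x y s r,
  0 <= t <= T -> 0 <= t' <= T -> Dset M d x -> Dset M d y ->
  enorm s <= S -> enorm r <= S ->
  `|t - t'| + cdist x y + enorm (s - r) < k -> `|H t x s - H t' y r| < e.
Proof.
move=> e0; have [|||||k k0 kP] := @seq_compact_unif R (R * Cf * 'rV[R]_n)%type _ _ _ _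
  Kc (fun p q => `|H p.1.1 p.1.2 p.2 - H q.1.1 q.1.2 q.2|) _ _ _ e e0.
- by move=> p q /=; rewrite distrC (cdistC hpos Tpos) enormBC.
- move=> p q r; rewrite addrACA; apply: lerD; last exact: enormB_tri.
  rewrite addrACA; apply: lerD; first exact: ler_distD.
  exact: (cdist_tri hpos Tpos).
- by move=> p q; rewrite distrC.
- by move=> p q r; exact: ler_distD.
- by move=> p pK e' e'0; have [k k0 kP] := Hc pK e'0; exists k.
by exists k => // t t' x y s r tT t'T xD yD sS rS ?; apply: (kP (t, x, s) (t', y, r)).
Qed.

Lemma H_bounded : exists2 B, 0 <= B & forall t x s,
  0 <= t <= T -> Dset M d x -> enorm s <= S -> `|H t x s| <= B.
Proof.
have [||B BP] := @seq_compact_bounded R (R * Cf * 'rV[R]_n)%type _ _ _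
  Kc (fun p => H p.1.1 p.1.2 p.2).
- by move=> p q /=; rewrite distrC (cdistC hpos Tpos) enormBC.
- by move=> p pK e' e'0; have [k k0 kP] := Hc pK e'0; exists k.
exists (Num.max B 0); first by rewrite le_max lexx orbT.
by move=> t x s tT xD sS; rewrite le_max; apply/orP; left; apply: (BP (t, x, s)).
Qed.

Lemma H_lipschitz : exists2 lam, 0 < lam & forall t x y s, 0 <= t <= T ->
  Dset M d x -> Dset M d y ->
  `|H t x s - H t y s| <= lam * (1 + enorm s) * supn (fun tau => x tau - y tau) (- h) t.
Proof.
have [lam lam0 lamP] := B3H (Dset_compact hpos Tpos (M := M) d0).
by exists lam => // t x y s tT xD yD; apply: lamP; rewrite // in_itv.
Qed.
End HCompact.

(** The right side of (B.3) sees only [[-h, t]]; on a compact set containing both paths it vanishes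
    as soon as they agree there. *)
Lemma H_nonant t x y s : 0 <= t <= T -> (forall u, u <= t -> x u = y u) ->
  H t x s = H t y s.
Proof.
move=> tT xy; have hp := hpos.
have [W [M [d [tW Wx Wy]]]] := tube_pair hpos Tpos cpos x y.
have [lam lam0 lamP] := H_lipschitz M (tube_d tW).
have := lamP t x y s tT (tube_sub tW Wx) (tube_sub tW Wy).
have -> : supn (fun tau => x tau - y tau) (- h) t = 0.
  apply/eqP; rewrite eq_le supn_lub//=.
  - by apply: supn_ge0; [exact: CfunB_econt|move: tT hp; lra].
  - by move: tT hp; lra.
  - by move=> u /andP[_ /xy ->]; rewrite subrr enorm0.
by rewrite mulr0 normr_le0 subr_eq0 => /eqP.
Qed.

Lemma H_within y s a b : 0 <= a -> b <= T ->
  {within `[a, b], continuous (fun t => H t y s)}.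
Proof.
move=> a0 bT; apply/subspace_continuousP => t; rewrite /= in_itv/= => tab.
have tT : 0 <= t <= T by move: tab; lra.
apply/cvgrPdist_lt => e e0.
have [|k k0 kP] := B1H (t := t) y s _ e0; first by rewrite in_itv.
rewrite near_withinE; apply/nbhs_ballP; exists k => //= t' tt'.
rewrite /= in_itv/= => t'ab; apply: kP; first by rewrite in_itv/=; move: t'ab; lra.
by rewrite /tdist cdist_xx// subrr enorm0 !addr0.
Qed.

Definition Hintegral a b y s : R := \int[mu]_(xi in `[a, b]) H xi y s.

Lemma H_integrable y s a b : 0 <= a -> b <= T ->
  mu.-integrable `[a, b] (EFin \o (fun t => H t y s)).
Proof.
move=> a0 bT; apply: continuous_compact_integrable; first exact: segment_compact.
exact: H_within.
Qed.

Lemma Hintegral_cat y s a b b' : 0 <= a -> a <= b -> b <= b' -> b' <= T ->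
  Hintegral a b' y s = Hintegral a b y s + Hintegral b b' y s.
Proof.
move=> a0 ab bb' b'T; rewrite /Hintegral.
have ab' : a <= b' := le_trans ab bb'.
have := @Rintegral_itvB R (fun t => H t y s) (BLeft a) (BRight b') b
  (H_integrable y s a0 b'T).
rewrite !bnd_simp => /(_ ab bb').
rewrite Rintegral_itv_obnd_cbnd; last first.
  apply: integrableS (H_integrable y s (le_trans a0 ab) b'T) => //.
  exact: subset_itv_oc_cc.
by move=> <-; rewrite addrC subrK.
Qed.

Lemma cst_integrable a b (k : R) : mu.-integrable `[a, b] (EFin \o (fun=> k)).
Proof.
apply: continuous_compact_integrable; first exact: segment_compact.
by apply: continuous_subspaceT => t; exact: cvg_cst.
Qed.

Lemma Rintegral_cst_itv a b (k : R) : a <= b ->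
  \int[mu]_(t in `[a, b]) k = (b - a) * k.
Proof.
move=> ab.
have -> : \int[mu]_(t in `[a, b]) k = k * fine (mu `[a, b]) by exact: Rintegral_cst.
rewrite lebesgue_measure_itv/= lte_fin mulrC.
case: ifPn => [_//|]; rewrite -leNgt => ba.
have -> : b = a by apply/eqP; rewrite eq_le ba.
by rewrite subrr.
Qed.

Lemma Rintegral_close (f g : R -> R) a b (e : R) : a <= b ->
  mu.-integrable `[a, b] (EFin \o f) -> mu.-integrable `[a, b] (EFin \o g) ->
  (forall t, a <= t <= b -> `|f t - g t| <= e) ->
  `|\int[mu]_(t in `[a, b]) f t - \int[mu]_(t in `[a, b]) g t| <= (b - a) * e.
Proof.
move=> ab fi gi fg; rewrite -RintegralB// -(Rintegral_cst_itv e ab).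
have fgi : mu.-integrable `[a, b] (EFin \o (fun t => f t - g t)).
  by rewrite (_ : _ \o _ = ((EFin \o f) \- (EFin \o g))%E)//; exact: integrableB.
apply: le_trans (le_normr_Rintegral _ fgi) _ => //.
have fgn := integrable_norm fgi.
apply: (le_Rintegral _ fgn (cst_integrable a b e)) => // t.
Qed.

Lemma Hintegral_approx y s a b (k e : R) : 0 <= a -> a <= b -> b <= T ->
  (forall t, a <= t <= b -> `|H t y s - k| <= e) ->
  `|Hintegral a b y s - (b - a) * k| <= (b - a) * e.
Proof.
move=> a0 ab bT He; rewrite -(Rintegral_cst_itv k ab).
by apply: Rintegral_close => //; [exact: H_integrable|exact: cst_integrable].
Qed.

Lemma Hintegral_close y z s r a b (e : R) : 0 <= a -> a <= b -> b <= T ->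
  (forall t, a <= t <= b -> `|H t y s - H t z r| <= e) ->
  `|Hintegral a b y s - Hintegral a b z r| <= (b - a) * e.
Proof.
by move=> a0 ab bT He; apply: Rintegral_close => //; exact: H_integrable.
Qed.

Lemma eq_Hintegral y z s a b : 0 <= a -> b <= T -> (forall u, u <= b -> y u = z u) ->
  Hintegral a b y s = Hintegral a b z s.
Proof.
move=> a0 bT yz; apply: eq_Rintegral => t; rewrite inE/= in_itv/= => /andP[ta tb].
apply: H_nonant; first by rewrite (le_trans a0 ta) (le_trans tb bT).
by move=> u ut; apply: yz; exact: le_trans ut tb.
Qed.

End Hamiltonian.

(** * Comparison *)

Section Comparison.
Variables (R : realType) (n : nat) (h T c : R).
Hypotheses (hpos : 0 < h) (Tpos : 0 < T) (cpos : 0 < c).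
Notation Cf := (Cfun n h T).
Implicit Types (x y z : Cf) (t a b : R) (s r : 'rV[R]_n).
Variable (H : R -> Cf -> 'rV[R]_n -> R).
Hypotheses (B1H : H_continuous H) (B3H : B3 H).
Variable (sigma : Cf -> R).
Hypothesis (B1s : sigma_continuous sigma).

(* [th = 1] and [th = - 1] give the two one-sided forms of property (M). *)
Definition char_step (th : R) (u : R -> Cf -> R) (W : set Cf) t t' (S e : R) :=
  forall x s, W x -> enorm s <= S -> exists2 y, Yi c t x y &
    th * (u t x - u t' y + dotv s (y t' - x t) - Hintegral H t t' y s) <= (t' - t) * e.

(** The time grid is seen only through its successor map [p]; the rank [rk] drives the backward
    induction from [T]. *)
Definition chain (p : R -> R) (rk : R -> nat) (k : R) :=
  forall t, 0 <= t < T -> [/\ t < p t, p t <= T, p t - t <= k & (rk (p t) < rk t)%N].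

Lemma tube_bound W M d x t : tube c W M d -> W x -> enorm (x t) <= M.
Proof. by move=> tW Wx; have [H1 _] := tube_sub tW Wx. Qed.

Lemma tube_supn W M d x t : tube c W M d -> W x -> - h <= t -> supn x (- h) t <= M.
Proof. by move=> tW Wx ht; apply: supn_lub => // s _; apply: tube_bound tW Wx. Qed.

Lemma tube_lip W M d x y t a b : tube c W M d -> W x -> 0 <= t <= T -> Yi c t x y ->
  t <= a -> a <= b -> b <= T -> enorm (y b - y a) <= c * (1 + M) * (b - a).
Proof.
have hp := hpos.
move=> tW Wx tT xy ta ab bT; have Wy := tube_inv tW Wx tT xy.
case: xy => _ /(_ a b ta ab bT) H1; apply: le_trans H1 _.
rewrite ler_wpM2r ?subr_ge0// ler_wpM2l ?(ltW cpos)// lerD2l.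
by apply: (tube_supn tW Wy); move: tT ta ab; lra.
Qed.

(** Uniform continuity of [H] in time freezes the integrand along [y] at [t], and non-anticipation
    then replaces [y] by [x]. The step size [k] depends only on the tube, [S] and [e]. *)
Lemma Hintegral_frozen W M d S e : tube c W M d -> 0 < e ->
  exists2 k, 0 < k & forall t t' x y s, 0 <= t -> t <= t' -> t' <= T -> t' - t < k ->
    W x -> Yi c t x y -> enorm s <= S ->
    `|Hintegral H t t' y s - (t' - t) * H t x s| <= (t' - t) * e.
Proof.
move=> tW e0.
have [k k0 kP] := H_unif hpos Tpos B1H M S (tube_d tW) e0.
exists k => // t t' x y s t0 tt' t'T tk Wx xy sS.
have tT : 0 <= t <= T by rewrite t0 (le_trans tt').
have Wy := tube_sub tW (tube_inv tW Wx tT xy).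
have -> : H t x s = H t y s.
  by apply: (H_nonant hpos Tpos cpos B3H) => // r rt; case: xy => ->.
apply: Hintegral_approx => // xi /andP[txi xit'].
apply: ltW; apply: kP => //; first by rewrite (le_trans t0 txi) (le_trans xit').
rewrite cdist_xx// subrr enorm0 !addr0; apply: le_lt_trans tk.
by rewrite ger0_norm; lra.
Qed.

(** Close paths are handled by uniform continuity. For paths at distance at least [k] the gauge is
    at least [k ^ 4 / 2], and [A] is chosen so that [A * G] exceeds [2 * B'], a bound on any
    difference of values of [sigma]. *)
Lemma sigma_gauge W M d eta : tube c W M d -> 0 < eta ->
  exists2 A, 0 <= A & forall x y, W x -> W y ->
    sigma x - sigma y <= A * gauge h (fun t => x t - y t) T + eta.
Proof.
have hp := hpos; have Tp := Tpos.
move=> tW eta0.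
have Dc : seq_compact (@cdist R n h T) (Dset M d).
  exact: (Dset_compact hpos Tpos (tube_d tW)).
have dC := @cdistC R n h T hpos Tpos; have dt := @cdist_tri R n h T hpos Tpos.
have sc x : Dset M d x -> forall e, 0 < e -> exists2 k, 0 < k &
    forall y, Dset M d y -> cdist x y < k -> `|sigma x - sigma y| < e.
  by move=> _ e /(B1s x)[k k0 kP]; exists k => // y _; exact: kP.
have [B BP] := seq_compact_bounded dC Dc sc.
have [||k k0 kP] := seq_compact_unif dC dt Dc
    (D := fun x y => `|sigma x - sigma y|) _ _ sc eta0.
- by move=> x y; rewrite distrC.
- by move=> x y z; exact: ler_distD.
pose B' := `|B|; have B'ge0 : 0 <= B' by exact: normr_ge0.
exists (4 * B' / k ^+ 4).
  by rewrite divr_ge0 ?exprn_ge0 ?(ltW k0)// mulr_ge0// /B'.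
move=> x y /(tube_sub tW) xD /(tube_sub tW) yD.
set G := gauge _ _ _.
have G0 : 0 <= G by exact: gauge_ge0.
have k40 : 0 < k ^+ 4 by rewrite exprn_gt0.
have [xyk|kxy] := ltP (cdist x y) k.
  have := ltr_normlW (kP x y xD yD xyk).
  suff : 0 <= 4 * B' / k ^+ 4 * G by lra.
  by rewrite mulr_ge0// divr_ge0 ?(ltW k40)// mulr_ge0// /B'.
have G1 : k ^+ 4 <= 2 * G.
  apply: le_trans (gauge_lb _ _ _).
  by rewrite ler_pXn2r ?nnegrE ?(ltW k0)// (le_trans (ltW k0)).
have Bx := BP x xD; have By := BP y yD.
have BB : B <= B' by exact: ler_norm.
have : 2 * B' <= 4 * B' / k ^+ 4 * G.
  rewrite mulrAC ler_pdivlMr//.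
  have B'0 : 0 <= 2 * B' by rewrite mulr_ge0.
  by have := ler_wpM2l B'0 G1; lra.
have := ler_norm (sigma x); have := ler_norm (- sigma y); rewrite normrN.
lra.
Qed.

Lemma tube_supnB W M d x y t : tube c W M d -> W x -> W y -> - h <= t ->
  supn (fun q => x q - y q) (- h) t <= 2 * M.
Proof.
move=> tW Wx Wy ht; apply: supn_lub => // q _; have := enormB_tri 0 (x q) (y q).
rewrite subr0 sub0r enormN.
by have := tube_bound q tW Wx; have := tube_bound q tW Wy; lra.
Qed.

Lemma gauge_Yi W M d x y x' y' t t' : tube c W M d -> W x -> W y ->
  0 <= t -> t <= t' -> t' <= T -> Yi c t x x' -> Yi c t y y' ->
  gauge h (fun q => x' q - y' q) t' <= gauge h (fun q => x q - y q) t +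
    dotv (gauge_grad h (fun q => x q - y q) t) ((x' t' - y' t') - (x t - y t)) +
    26 * (2 * M) ^+ 2 * (2 * (c * (1 + M)) * (t' - t)) ^+ 2.
Proof.
have hp := hpos; move=> tW Wx Wy t0 tt' t'T xx' yy'.
have tT : 0 <= t <= T by rewrite t0 (le_trans tt').
have ht : - h <= t by rewrite (le_trans _ t0)// oppr_le0 ltW.
have Wx' := tube_inv tW Wx tT xx'; have Wy' := tube_inv tW Wy tT yy'.
have K0 : 0 <= c * (1 + M) by rewrite mulr_ge0 ?(ltW cpos)// addr_ge0// (tube_M tW).
set z := fun q => x q - y q; set z' := fun q => x' q - y' q.
have z'z q : - h <= q <= t -> z q = z' q.
  by move=> /andP[_ qt]; rewrite /z' /z; case: xx' => -> // _; case: yy' => ->.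
rewrite (eq_gauge ht z'z) (eq_gauge_grad ht z'z).
rewrite -[x t - y t]/(z t) (z'z t) ?ht ?lexx//.
apply: gauge_step => //; first exact: CfunB_econt.
- by rewrite mulr_ge0 ?subr_ge0// mulr_ge0.
- move=> q /andP[tq qt'].
  have H1 := tube_lip tW Wx tT xx' (lexx t) tq (le_trans qt' t'T).
  have H2 := tube_lip tW Wy tT yy' (lexx t) tq (le_trans qt' t'T).
  have -> : z' q - z' t = (x' q - x' t) - (y' q - y' t).
    by rewrite /z' !opprB addrACA [RHS]addrACA (addrC (- y' q)).
  have := enormD (x' q - x' t) (- (y' q - y' t)); rewrite enormN.
  have : c * (1 + M) * (q - t) <= c * (1 + M) * (t' - t) by rewrite ler_wpM2l// lerD2r.
  lra.
- move=> q /andP[hq qt']; apply: le_trans (tube_supnB tW Wx' Wy' hq).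
  by apply: supn_ub; [exact: CfunB_econt|rewrite hq lexx].
Qed.

(** The error budget of one step, per unit of time: [rho / 32] for each of the two step inequalities
    and each of the two frozen integrals, [rho / 4] from (B.3) and [rho / 8] from the gauge
    remainder, together [rho / 2]. *)
Lemma comparison_arith (ux vy ux' vy' dx dy I1 I2 Hx Hy A G G' p q B dl rho lam eta r
    : R) :
  ux - ux' + dx - I1 <= dl * (rho / 32) ->
  - (vy - vy' + dy - I2) <= dl * (rho / 32) ->
  ux' - vy' <= A * G' + (eta + r * (rho / 2)) ->
  I1 - dl * Hx <= dl * (rho / 32) -> - (I2 - dl * Hy) <= dl * (rho / 32) ->
  dl * (Hx - Hy) <= dl * (rho / 4 + 9 * lam * (A * G)) ->
  A * G' <= A * (G + p + q) -> dx - dy = A * p -> A * q <= dl * (rho / 8) ->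
  A * (1 + 9 * lam * dl) * G <= B ->
  ux - vy <= B + (eta + (r + dl) * (rho / 2)).
Proof. lra. Qed.

(** Both functionals use the same [s], the gradient of the weighted gauge, so their scalar products
    combine into the first-order change of the gauge and cancel it. All constants are fixed before
    the grid, [u] and [v]; the uniform estimates for the discrete values rest on this order of
    quantifiers. *)
Lemma comparison W M d eta : tube c W M d -> 0 < eta ->
  exists A S e0 k0, [/\ 0 <= A, 0 <= S, 0 < e0 & 0 < k0] /\
  forall p rk, chain p rk k0 -> forall u v,
    (forall t, 0 <= t < T -> char_step 1 u W t (p t) S e0) ->
    (forall t, 0 <= t < T -> char_step (- 1) v W t (p t) S e0) ->
    (forall x, W x -> u T x = sigma x) -> (forall x, W x -> v T x = sigma x) ->
    forall t x y, 0 <= t <= T -> W x -> W y ->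
      u t x - v t y <= A * gauge h (fun t => x t - y t) t + eta.
Proof.
have hp := hpos; have Tp := Tpos; have cp := cpos.
move=> tW eta0.
have M0 := tube_M tW.
have [lam lam0 lamP] := H_lipschitz hpos Tpos B3H M (tube_d tW).
(* Half of [eta] goes to the terminal inequality for [sigma]; the other half is spent evenly in
   time, at the rate [rho / 2]. *)
pose rho := eta / T.
have rho0 : 0 < rho by rewrite divr_gt0.
have rhoT : T * rho = eta by rewrite /rho mulrC divfK// gt_eqF.
pose eta2 := rho / (4 * lam).
have eta20 : 0 < eta2 by rewrite divr_gt0// mulr_gt0.
have lameta : lam * eta2 = rho / 4 by rewrite /eta2; field; rewrite gt_eqF.
have eta2h : 0 < eta / 2 by rewrite divr_gt0.
have [A0 A00 A0P] := sigma_gauge tW eta2h.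
(* [A0] serves the terminal inequality; [2 / eta2 ^+ 3] is the threshold of [lyapunov_absorb] for
   [e := eta2], where [lam * eta2] is the share [rho / 4]. *)
pose A1 := Num.max A0 (2 / eta2 ^+ 3).
have A10 : 0 <= A1 by rewrite le_max A00.
(* The rate [9 * lam] is the constant of [lyapunov_absorb]: since [1 + x <= expR x], one step back
   in time gains enough weight to pay for the term produced there. *)
pose Af t := A1 * expR (9 * lam * (T - t)).
pose A := Af 0.
have AfA t : 0 <= t -> Af t <= A.
  move=> t0; rewrite /A /Af ler_wpM2l// ler_expR ler_wpM2l//; last by lra.
  by rewrite mulr_ge0// ltW.
have Af0 t : 0 <= Af t by rewrite mulr_ge0// expR_ge0.
have A1Af t : t <= T -> A1 <= Af t.
  move=> tT; rewrite /Af ler_peMr//.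
  have -> : 1 = expR (0 : R) by rewrite expR0.
  by rewrite ler_expR !mulr_ge0 ?subr_ge0// ltW.
have Apos : 0 <= A by exact: Af0.
pose S := A * (4 * (2 * M) ^+ 3).
have S0 : 0 <= S by rewrite mulr_ge0// mulr_ge0// exprn_ge0// mulr_ge0.
pose e0 := rho / 32.
have e00 : 0 < e0 by rewrite divr_gt0.
have [k1 k10 k1P] := Hintegral_frozen S tW e00.
have K0 : 0 <= c * (1 + M) by rewrite mulr_ge0 ?addr_ge0// ltW.
pose Q := A * (26 * (2 * M) ^+ 2 * (2 * (c * (1 + M))) ^+ 2).
have Q0 : 0 <= Q by rewrite mulr_ge0// mulr_ge0 ?sqr_ge0// mulr_ge0 ?sqr_ge0.
pose k0 := Num.min (k1 / 2) (rho / 8 / (Q + 1)).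
have k00 : 0 < k0 by rewrite lt_min !divr_gt0// ltr_wpDl.
have k01 : k0 < k1.
  by apply: (@le_lt_trans _ _ (k1 / 2)); [rewrite ge_min lexx|lra].
have k0Q dl : 0 < dl -> dl <= k0 -> forall A', 0 <= A' -> A' <= A ->
    A' * (26 * (2 * M) ^+ 2 * (2 * (c * (1 + M)) * dl) ^+ 2) <= dl * (rho / 8).
  move=> dl0 dlk A' A'0 A'A.
  have -> : A' * (26 * (2 * M) ^+ 2 * (2 * (c * (1 + M)) * dl) ^+ 2) =
    dl * (A' * (26 * (2 * M) ^+ 2 * (2 * (c * (1 + M))) ^+ 2) * dl) by ring.
  rewrite ler_wpM2l ?(ltW dl0)//.
  apply: (@le_trans _ _ (Q * dl)).
    by rewrite ler_wpM2r ?(ltW dl0)// /Q ler_wpM2r// mulr_ge0 ?sqr_ge0// mulr_ge0 ?sqr_ge0.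
  have : dl <= rho / 8 / (Q + 1) by apply: le_trans dlk _; rewrite ge_min lexx orbT.
  rewrite ler_pdivlMr ?ltr_wpDl//; apply: le_trans.
  by rewrite mulrC ler_wpM2l ?(ltW dl0)// lerDl.
exists A, S, e0, k0; split=> // p rk pP u v uP vP uT vT.
suff main N t x y : 0 <= t <= T -> (rk t < N)%N -> W x -> W y ->
    u t x - v t y <= Af t * gauge h (fun t => x t - y t) t +
      (eta / 2 + (T - t) * (rho / 2)).
  move=> t x y tT Wx Wy; apply: le_trans (main _ t x y tT (ltnSn _) Wx Wy) _.
  apply: lerD; first by rewrite ler_wpM2r ?gauge_ge0// AfA//; case/andP: tT.
  have : 0 <= t * rho by rewrite mulr_ge0 ?(ltW rho0)//; case/andP: tT.
  by lra.
elim: N t x y => // N IH t x y /andP[t0 tT] rkt Wx Wy.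
have [Tt|tltT] := leP T t.
  have -> : t = T by apply/eqP; rewrite eq_le tT.
  rewrite uT// vT// subrr mul0r addr0.
  apply: le_trans (A0P _ _ Wx Wy) _; rewrite lerD2r ler_wpM2r ?gauge_ge0//.
  by apply: le_trans (A1Af T (lexx _)); rewrite le_max lexx.
have tT' : 0 <= t < T by rewrite t0.
have tTle : 0 <= t <= T by rewrite t0.
have [tp pT pk rkp] := pP t tT'.
move: (p t) (uP t tT') (vP t tT') tp pT pk rkp => t' ut vt tp pT pk rkp.
have dl0 : 0 < t' - t by rewrite subr_gt0.
have ht : - h <= t by rewrite (le_trans _ t0)// oppr_le0 ltW.
have t'0 : 0 <= t' := le_trans t0 (ltW tp).
have t'0T : 0 <= t' <= T by rewrite t'0.
set z := fun t => x t - y t.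
have zc : econt z by exact: CfunB_econt.
set m := supn z (- h) t.
have m0 : 0 <= m by exact: supn_ge0.
have m2M : m <= 2 * M by exact: tube_supnB tW Wx Wy ht.
set g := gauge_grad h z t.
set G := gauge h z t.
have g4 : enorm g <= 4 * m ^+ 3 by exact: gauge_grad_le.
have A'0 : 0 <= Af t' by exact: Af0.
have A'A : Af t' <= A by exact: AfA.
(* The weight is taken at [t'], where the induction hypothesis supplies it, and the gradient at [t],
   where both motions depart. *)
pose s := Af t' *: g.
have sE : enorm s = Af t' * enorm g by rewrite enormZ ger0_norm.
have sS : enorm s <= S.
  rewrite sE /S; apply: ler_pM => //; first exact: enorm_ge0.
  apply: le_trans g4 _; rewrite ler_wpM2l// ler_pXn2r ?nnegrE//.
  exact: le_trans m2M.
have [x' xx' F1] := ut x s Wx sS.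
have [y' yy' F2] := vt y s Wy sS.
have F3 := IH t' x' y' t'0T (leq_trans rkp rkt) (tube_inv tW Wx tTle xx')
  (tube_inv tW Wy tTle yy').
have dk1 : t' - t < k1 := le_lt_trans pk k01.
have F4x := k1P t t' x x' s t0 (ltW tp) pT dk1 Wx xx' sS.
have F4y := k1P t t' y y' s t0 (ltW tp) pT dk1 Wy yy' sS.
have F4 := lamP t x y s tTle (tube_sub tW Wx) (tube_sub tW Wy).
have F5 := gauge_Yi tW Wx Wy t0 (ltW tp) pT xx' yy'.
have -> : T - t = (T - t') + (t' - t) by rewrite addrA subrK.
apply: (comparison_arith (dx := dotv s (x' t' - x t)) (dy := dotv s (y' t' - y t))
  (lam := lam) (G := G) _ _ F3 (ler_normlW F4x) _ _ (ler_wpM2l A'0 F5) _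
  (k0Q _ dl0 pk _ A'0 A'A)).
- by rewrite -[leLHS]mul1r; exact: F1.
- by rewrite -[leLHS]mulN1r; exact: F2.
- by apply: ler_normlW; rewrite normrN; exact: F4y.
- rewrite ler_wpM2l ?(ltW dl0)//; apply: le_trans (ler_norm _) _.
  apply: le_trans F4 _; rewrite -lameta sE.
  apply: lyapunov_absorb => //; first exact: gauge_lb.
  by apply: le_trans (A1Af t' pT); rewrite le_max lexx orbT.
- rewrite -dotvBr /s dotvZl; congr (_ * dotv _ _).
  by rewrite !opprB addrACA [RHS]addrACA (addrC (- x t)).
- rewrite ler_wpM2r ?gauge_ge0//.
  have -> : Af t = Af t' * expR (9 * lam * (t' - t)).
    by rewrite /Af -[RHS]mulrA -expRD; congr (_ * expR _); ring.
  by rewrite ler_wpM2l// expR_ge1Dx.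
Qed.

End Comparison.

(** * Time grids and uniqueness *)

Section Grid.
Variables (R : realType) (T : R).
Hypothesis Tpos : 0 < T.

Definition grid_index (N : nat) (t : R) : nat := Num.truncn (t * N%:R / T).
Definition grid_point (N i : nat) : R := i%:R * T / N%:R.
(** Strictly after [t], and meaningful for [t] off the grid, so that a chain may start at any
    time. *)
Definition grid_next N t := grid_point N (grid_index N t).+1.
Definition grid_rank N t : nat := (N - grid_index N t)%N.

Variable N : nat.
Hypothesis N0 : (0 < N)%N.

Let NR : 0 < N%:R :> R. Proof. by rewrite ltr0n. Qed.

Lemma grid_indexP t : 0 <= t ->
  grid_point N (grid_index N t) <= t < grid_point N (grid_index N t).+1.
Proof.
move=> t0; rewrite /grid_point ler_pdivrMr// ltr_pdivlMr//.
have q0 : 0 <= t * N%:R / T by rewrite divr_ge0 ?mulr_ge0// ltW.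
have := truncn_itv q0; rewrite -/(grid_index N t).
by rewrite ler_pdivlMr// ltr_pdivrMr.
Qed.

Lemma grid_pointS i : grid_point N i.+1 = grid_point N i + T / N%:R.
Proof. by rewrite /grid_point -natr1 mulrDl mul1r mulrDl. Qed.

Lemma grid_pointN : grid_point N N = T.
Proof. by rewrite /grid_point mulrC mulKf// gt_eqF. Qed.

Lemma ler_grid_point i j : (grid_point N i <= grid_point N j) = (i <= j)%N.
Proof. by rewrite /grid_point ler_pM2r ?invr_gt0// ler_pM2r// ler_nat. Qed.

Lemma ltr_grid_point i j : (grid_point N i < grid_point N j) = (i < j)%N.
Proof. by rewrite ltNge ler_grid_point -ltnNge. Qed.

Lemma grid_point_ge0 i : 0 <= grid_point N i.
Proof. by rewrite /grid_point divr_ge0 ?mulr_ge0 ?ler0n// ltW. Qed.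

Lemma grid_index_point i : grid_index N (grid_point N i) = i.
Proof.
have /andP[] := grid_indexP (grid_point_ge0 i).
by rewrite ler_grid_point ltr_grid_point ltnS => H1 H2; apply/eqP; rewrite eqn_leq H1.
Qed.

Lemma grid_next_le t i : 0 <= t -> t < grid_point N i -> grid_next N t <= grid_point N i.
Proof.
move=> t0 ti; have /andP[H1 H2] := grid_indexP t0.
by rewrite /grid_next ler_grid_point -ltr_grid_point; exact: le_lt_trans ti.
Qed.

Lemma grid_chain k : T / N%:R <= k -> chain T (grid_next N) (grid_rank N) k.
Proof.
move=> Nk t /andP[t0 tT]; have /andP[H1 H2] := grid_indexP t0.
have iN : (grid_index N t < N)%N.
  by rewrite -ltr_grid_point grid_pointN; exact: le_lt_trans tT.
split => //.
- by rewrite -[X in _ <= X]grid_pointN ler_grid_point.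
- by rewrite /grid_next grid_pointS; lra.
- by rewrite /grid_rank /grid_next grid_index_point ltn_sub2l.
Qed.

Lemma grid_rank_next t : 0 <= t < T -> grid_rank N t = (grid_rank N (grid_next N t)).+1.
Proof.
move=> /andP[t0 tT]; have /andP[H1 H2] := grid_indexP t0.
rewrite /grid_rank /grid_next grid_index_point subnSK//.
by rewrite -ltr_grid_point grid_pointN; exact: le_lt_trans tT.
Qed.

Lemma grid_rankT : grid_rank N T = 0%N.
Proof. by rewrite /grid_rank -[X in grid_index N X]grid_pointN grid_index_point subnn. Qed.
End Grid.

Section Scheme.
Variables (R : realType) (n : nat) (h T c : R).
Hypotheses (hpos : 0 < h) (Tpos : 0 < T) (cpos : 0 < c).
Notation Cf := (Cfun n h T).
Implicit Types (x y z : Cf) (t a b : R) (s r f : 'rV[R]_n).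
Variable (H : R -> Cf -> 'rV[R]_n -> R).
Hypotheses (B1H : H_continuous H) (B2H : B2 H c) (B3H : B3 H).
Variable (sigma : Cf -> R).
Hypothesis (B1s : sigma_continuous sigma).

Notation step := (char_step c H).
Notation gnext := (grid_next T).
Notation gpoint := (grid_point T).

Lemma char_step_trans th u W M d t t' t'' S e : tube c W M d ->
  0 <= t -> t <= t' -> t' <= t'' -> t'' <= T ->
  step th u W t t' S e -> step th u W t' t'' S e -> step th u W t t'' S e.
Proof.
move=> tW t0 tt' t't'' t''T s1 s2 x s Wx sS.
have [y xy E1] := s1 x s Wx sS.
have tT : 0 <= t <= T by rewrite t0 (le_trans tt')// (le_trans t't'').
have [z yz E2] := s2 y s (tube_inv tW Wx tT xy) sS.
exists z; first by apply: Yi_trans xy yz => //; exact: le_trans t''T.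
have yzt' : forall q, q <= t' -> z q = y q by case: yz.
rewrite (@Hintegral_cat _ _ _ _ hpos Tpos H B1H z s t t' t'')//.
rewrite (@eq_Hintegral _ _ _ _ c hpos Tpos cpos H B3H z y)//; last first.
  exact: le_trans t''T.
have -> : z t'' - x t = (z t'' - y t') + (y t' - x t) by rewrite addrA subrK.
rewrite dotvDr.
have -> : (t'' - t) * e = (t' - t) * e + (t'' - t') * e by ring.
apply: le_trans (lerD E1 E2); rewrite -mulrDr le_eqVlt; apply/orP; left.
by apply/eqP; congr (_ * _); ring.
Qed.

(** The error stays proportional to the elapsed time when steps are concatenated. A scheme on a fine
    grid therefore satisfies the step inequalities of a coarser one, where two schemes can be
    compared. *)
Lemma char_step_grid th u W M d N t i S e : tube c W M d -> (0 < N)%N ->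
  (forall t, 0 <= t < T -> step th u W t (gnext N t) S e) ->
  0 <= t -> t < gpoint N i -> gpoint N i <= T ->
  step th u W t (gpoint N i) S e.
Proof.
move=> tW N0 us; have [k] := ubnP (i - grid_index T N t).
elim: k t => // k IH t; rewrite ltnS => kt t0 ti iT.
have tT : 0 <= t < T by rewrite t0 (lt_le_trans ti).
have [tp pT _ _] := grid_chain Tpos N0 (lexx _) tT.
have := grid_next_le Tpos N0 t0 ti; rewrite le_eqVlt => /predU1P[<-|pi].
  exact: us.
apply: (char_step_trans tW t0 (ltW tp) (ltW pi) iT); first exact: us.
apply: IH => //; last exact: le_trans (ltW tp).
rewrite /grid_next (grid_index_point Tpos N0) subnS.
have : (0 < i - grid_index T N t)%N.
  rewrite subn_gt0 -(ltr_grid_point Tpos N0).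
  by have /andP[H1 _] := grid_indexP Tpos N0 t0; exact: le_lt_trans ti.
by case: (i - _)%N kt.
Qed.

Lemma minimax_step phi th W S e t t' : minimax_solution H sigma c phi ->
  0 <= e -> 0 <= t -> t < t' -> t' <= T -> step th phi W t t' S e.
Proof.
case=> _ _ _ phiM e0 t0 tt' t'T x s Wx sS.
have [|y [yY yE]] := phiM t x s; first by rewrite in_itv/= t0 (lt_le_trans tt').
exists y; first by apply: Yset_Yi => //; rewrite t0 (le_trans (ltW tt')).
have := yE t'; rewrite in_itv/= (ltW tt') t'T => /(_ isT) E.
rewrite -/(Hintegral H t t' y s) in E.
have -> : phi t x - phi t' y + dotv s (y t' - x t) - Hintegral H t t' y s = 0.
  have -> : phi t x - phi t' y = - (phi t' y - phi t x) by rewrite opprB.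
  by rewrite E; ring.
by rewrite mulr0 mulr_ge0// subr_ge0 ltW.
Qed.

(** For one and the same path the gauge vanishes, so [comparison] leaves only an arbitrary [eta];
    then the two solutions exchange roles. *)
Lemma minimax_unique phi1 phi2 :
  minimax_solution H sigma c phi1 -> minimax_solution H sigma c phi2 ->
  forall t x, 0 <= t <= T -> phi1 t x = phi2 t x.
Proof.
have le12 p1 p2 : minimax_solution H sigma c p1 -> minimax_solution H sigma c p2 ->
    forall t x, 0 <= t <= T -> p1 t x <= p2 t x.
  move=> m1 m2 t x tT; rewrite -subr_le0; apply/ler_addgt0Pr => e e0.
  have [W [M [d [tW Wx _]]]] := tube_pair hpos Tpos cpos x x.
  have [A [S [e1 [k [[A0 S0 e10 k0]]]]]] :=
    comparison hpos Tpos cpos B1H B3H B1s tW e0.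
  pose N := (Num.bound (T / k)).+1.
  have Nk : T / N%:R <= k.
    rewrite ler_pdivrMr ?ltr0n// mulrC -ler_pdivrMr//.
    apply: ltW; apply: lt_trans (archi_boundP _) _; last by rewrite ltr_nat.
    by rewrite divr_ge0// ltW.
  have ch := grid_chain Tpos (ltn0Sn _) Nk.
  have st p th : minimax_solution H sigma c p -> forall t, 0 <= t < T ->
      step th p W t (gnext N t) S e1.
    move=> mp q qT; have [tp pT _ _] := ch q qT.
    apply: minimax_step => //; first exact: ltW.
    by case/andP: qT.
  move=> /(_ _ _ ch p1 p2 (st _ _ m1) (st _ _ m2)) P.
  have := P _ _ t x x tT Wx Wx.
  rewrite gauge0 ?mulr0 ?add0r; [|by have hp := hpos; lra|by move=> *; rewrite subrr].
  apply; first by case: m1.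
  by case: m2.
move=> m1 m2 t x tT; apply/eqP; rewrite eq_le.
by rewrite !le12.
Qed.



End Scheme.

(** * The discrete game *)

Section Maximin.
Variable R : realType.

(** The number is the supremum over [s] of the infimum over [f]. It is above each infimum, which
    gives the first half. For the second, a near-optimal [s'] is exchanged for the given [s] at a
    suitable [f], where the payoff of [s] is at least that of [s']; this replaces convexity in the
    usual minimax argument. *)
Lemma maximin_value (X Y : Type) (F : set Y) (A : X -> Y -> R) (x0 : X) (ub : R) :
  F !=set0 ->
  (forall s s', exists2 f, F f & A s f <= A s' f) ->
  (forall s, exists lb, forall f, F f -> lb <= A s f) ->
  (forall f, F f -> A x0 f <= ub) ->
  exists w, forall s e, 0 < e ->
    (exists2 f, F f & A s f <= w + e) /\ (exists2 f, F f & w - e <= A s f).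
Proof.
move=> F0 sw lb Aub.
pose V s := [set A s f | f in F].
have Vinf s : has_inf (V s).
  split; first by have [f Ff] := F0; exists (A s f), f.
  by have [l lP] := lb s; exists l => _ [f Ff <-]; exact: lP.
pose U := [set inf (V s) | s in [set: X]].
have Usup : has_sup U.
  split; first by exists (inf (V x0)), x0.
  exists ub => _ [s _ <-]; have [f Ff fA] := sw s x0.
  apply: (@le_trans _ _ (A s f)).
    by apply: ge_inf; [exact: (Vinf s).2|exists f].
  exact: le_trans fA (Aub f Ff).
exists (sup U) => s e e0; split.
  have [_ [f Ff <-] fA] := inf_adherent e0 (Vinf s).
  exists f => //; apply: le_trans (ltW fA) _; rewrite lerD2r.
  by apply: sup_ubound; [exact: Usup.2|exists s].
have [_ [s' _ <-] sA] := sup_adherent e0 Usup.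
have [f Ff fA] := sw s' s; exists f => //.
apply: le_trans (ltW sA) _; apply: le_trans fA.
by apply: ge_inf; [exact: (Vinf s').2|exists f].
Qed.
End Maximin.

Section Scheme.
Variables (R : realType) (n : nat) (h T c : R).
Hypotheses (hpos : 0 < h) (Tpos : 0 < T) (cpos : 0 < c).
Notation Cf := (Cfun n h T).
Implicit Types (x y z : Cf) (t a b : R) (s r f : 'rV[R]_n).
Variable (H : R -> Cf -> 'rV[R]_n -> R).
Hypotheses (B1H : H_continuous H) (B2H : B2 H c) (B3H : B3 H).
Variable (sigma : Cf -> R).
Hypothesis (B1s : sigma_continuous sigma).

Notation step := (char_step c H).
Notation gnext := (grid_next T).
Notation gpoint := (grid_point T).

Lemma le_maxl t t' : t <= Num.max t t'.
Proof. by rewrite le_max lexx. Qed.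

(** The maximum discharges the proof of [t <= t'] that [extend] asks for, so the payoff makes sense
    without side conditions. *)
Definition ext t t' x f : Cf := extend hpos Tpos x f (le_maxl t t').

Lemma ext_end t t' x f : 0 <= t -> t <= t' -> t' <= T ->
  ext t t' x f t' = x t + (t' - t) *: f.
Proof.
by move=> t0 tt' t'T; apply: extend_mid => //; rewrite max_r// tt' lexx.
Qed.

Lemma Yi_ext t t' x f : 0 <= t -> t <= t' -> t' <= T ->
  enorm f <= c * (1 + supn x (- h) t) -> Yi c t x (ext t t' x f).
Proof. by move=> t0 tt' t'T fL; apply: Yi_extend => //; rewrite max_r. Qed.

(** What the identity in property (M) predicts for the value at [(t, x)], with the Hamiltonian
    frozen there and a linear motion of velocity [f]. *)
Definition payoff t t' (psi : Cf -> R) x s f : R :=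
  psi (ext t t' x f) - (t' - t) * (dotv s f - H t x s).

(** Nothing makes [psi] continuous, so extrema over velocities may fail to be attained; hence the
    slack [e]. *)
Definition is_value t t' psi x (w : R) := forall s e, 0 < e ->
  (exists2 f, enorm f <= c * (1 + supn x (- h) t) & payoff t t' psi x s f <= w + e) /\
  (exists2 f, enorm f <= c * (1 + supn x (- h) t) & w - e <= payoff t t' psi x s f).

(** The property that the backward recursion preserves; it keeps the suprema and infima of the game
    finite. *)
Definition tube_bounded (psi : Cf -> R) := forall W M d, tube c W M d ->
  exists B, forall y, W y -> `|psi y| <= B.

(* Isaacs' condition: by (B.2) the slope [f = (H s - H r) (s - r) / |s - r|^2] is
   admissible. *)
Lemma admissible_slope t x s r : 0 <= t <= T ->
  exists2 f, enorm f <= c * (1 + supn x (- h) t) &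
    dotv s f - H t x s = dotv r f - H t x r.
Proof.
have hp := hpos; move=> tT; have [->|sr] := eqVneq s r.
  exists 0 => //; rewrite enorm0 mulr_ge0 ?(ltW cpos)// addr_ge0//.
  by apply: (supn_cf_ge0 hpos Tpos); move: tT; lra.
have nsr : 0 < enorm (s - r).
  rewrite lt_neqAle enorm_ge0 andbT eq_sym; apply: contra sr => /eqP.
  by move=> /enorm0_eq0/eqP; rewrite subr_eq0.
have n2 : dotv (s - r) (s - r) != 0 by rewrite -enorm_sqr expf_neq0// gt_eqF.
pose k := (H t x s - H t x r) / dotv (s - r) (s - r).
exists (k *: (s - r)).
  rewrite enormZ /k normrM normfV -enorm_sqr.
  rewrite (ger0_norm (exprn_ge0 2 (ltW nsr))).
  rewrite (_ : _ * _ = `|H t x s - H t x r| / enorm (s - r)); last first.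
    by field; rewrite gt_eqF.
  rewrite ler_pdivrMr//.
  by apply: B2H; rewrite in_itv.
have : dotv (s - r) (k *: (s - r)) = H t x s - H t x r by rewrite dotvZr divfK.
by rewrite dotvBl; lra.
Qed.

Lemma value_exists t t' psi x : 0 <= t -> t < t' -> t' <= T -> tube_bounded psi ->
  exists w, is_value t t' psi x w.
Proof.
have hp := hpos; move=> t0 tt' t'T psib.
have tT : 0 <= t <= T by lra.
have [W [M [d [tW Wx _]]]] := tube_pair hpos Tpos cpos x x.
have [B BP] := psib _ _ _ tW.
set L := c * (1 + supn x (- h) t).
have L0 : 0 <= L.
  rewrite mulr_ge0 ?(ltW cpos)// addr_ge0//.
  by apply: (supn_cf_ge0 hpos Tpos); move: tT; lra.
have psiB f : enorm f <= L -> `|psi (ext t t' x f)| <= B.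
  move=> fL; apply: BP; apply: (tube_inv tW Wx tT).
  by apply: Yi_ext => //; exact: ltW.
(* The choice [s = 0] supplies the upper bound: its payoff is [psi] plus a constant. *)
apply: (@maximin_value R _ _ [set f | enorm f <= L] (payoff t t' psi x) 0
  (B + (t' - t) * H t x 0)).
- by exists 0; rewrite /= enorm0.
- move=> s r; have [f fL fE] := admissible_slope x s r tT.
  by exists f => //; rewrite /payoff fE.
- move=> s; exists (- B - (t' - t) * (enorm s * L - H t x s)) => f /= fL.
  rewrite /payoff; have := psiB f fL; rewrite ler_norml => /andP[pB _].
  apply: lerB => //; rewrite ler_wpM2l ?subr_ge0 ?(ltW tt')// lerD2r.
  by apply: le_trans (dotv_le _ _) _; rewrite ler_wpM2l ?enorm_ge0.
- move=> f /= fL; rewrite /payoff dotvC dotv0 sub0r mulrN opprK lerD2r.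
  by apply: le_trans (ler_norm _) _; exact: psiB.
Qed.

(** At [s = 0] and slack [1] the two halves of [is_value] trap [w x] between values of [psi] shifted
    by [(t' - t) * H t x 0], which is bounded on a tube. *)
Lemma value_bounded t t' psi (w : Cf -> R) : 0 <= t -> t < t' -> t' <= T ->
  tube_bounded psi -> (forall x, is_value t t' psi x (w x)) -> tube_bounded w.
Proof.
move=> t0 tt' t'T psib wP W M d tW.
have tT : 0 <= t <= T by lra.
have [B BP] := psib _ _ _ tW.
have [E E0 EP] := H_bounded hpos Tpos B1H M 0 (tube_d tW).
exists (B + (t' - t) * E + 1) => x Wx.
have HE : `|(t' - t) * H t x 0| <= (t' - t) * E.
  rewrite normrM ger0_norm ?subr_ge0 ?(ltW tt')//.
  rewrite ler_wpM2l ?subr_ge0 ?(ltW tt')//.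
  by apply: EP; [|exact: (tube_sub tW Wx)|rewrite enorm0].
have key f : enorm f <= c * (1 + supn x (- h) t) ->
    `|payoff t t' psi x 0 f| <= B + (t' - t) * E.
  move=> fL; rewrite /payoff dotvC dotv0 sub0r mulrN opprK.
  apply: le_trans (ler_normD _ _) _; apply: lerD => //.
  apply: BP; apply: (tube_inv tW Wx tT).
  by apply: Yi_ext => //; exact: ltW.
have [[f1 /key f1L] + [f2 /key f2L]] := wP x 0 1 ltr01.
by move: f1L f2L; rewrite !ler_norml; lra.
Qed.

Lemma sigma_bounded : tube_bounded sigma.
Proof.
move=> W M d tW.
have Dc : seq_compact (@cdist R n h T) (Dset M d).
  exact: (Dset_compact hpos Tpos (tube_d tW)).
have [|B BP] := seq_compact_bounded (@cdistC R n h T hpos Tpos) Dc (g := sigma).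
  by move=> x _ e /(B1s x)[k k0 kP]; exists k => // y _; exact: kP.
by exists B => y /(tube_sub tW)/BP.
Qed.

(** Required at every time, not only on the grid: from a time off the grid the first move is the
    shorter one to the next grid point. *)
Definition is_scheme N (Phi : R -> Cf -> R) :=
  (forall x, Phi T x = sigma x) /\
  forall t x, 0 <= t < T -> is_value t (gnext N t) (Phi (gnext N t)) x (Phi t x).

Lemma scheme_exists N : (0 < N)%N -> exists Phi, is_scheme N Phi.
Proof.
move=> N0.
(* [xget] falls back to [0] where no value exists; the boundedness [Fb], proved by induction on the
   rank, excludes that case. *)
pose val t psi x : R := xget 0 [set w | is_value t (gnext N t) psi x w].
pose F := fix F j t x : R := if j is j'.+1 then val t (F j' (gnext N t)) x else sigma x.
have valP t psi x : 0 <= t < T -> tube_bounded psi ->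
    is_value t (gnext N t) psi x (val t psi x).
  move=> tT psib; have [tp pT _ _] := grid_chain Tpos N0 (lexx _) tT.
  apply: (xgetPex 0); apply: value_exists => //; by case/andP: tT.
have Fb j t : 0 <= t <= T -> grid_rank T N t = j -> tube_bounded (F j t).
  elim: j t => [|j IH] t tT rk /=; first exact: sigma_bounded.
  have [Tt|tltT] := leP T t.
    have tE : t = T by move: tT; lra.
    by move: rk; rewrite tE grid_rankT.
  have tT' : 0 <= t < T by rewrite tltT andbT; case/andP: tT.
  have [tp pT _ _] := grid_chain Tpos N0 (lexx _) tT'.
  have Fb' : tube_bounded (F j (gnext N t)).
    apply: IH; first by case/andP: tT => t0 _; rewrite (le_trans t0 (ltW tp)).
    by have := grid_rank_next Tpos N0 tT'; rewrite rk => -[].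
  apply: (value_bounded (t := t) _ tp pT Fb'); first by case/andP: tT.
  by move=> x; exact: valP.
exists (fun t x => F (grid_rank T N t) t x); split.
  by move=> x; rewrite grid_rankT.
move=> t x tT; have [tp pT _ _] := grid_chain Tpos N0 (lexx _) tT.
rewrite (grid_rank_next Tpos N0 tT) /=.
apply: valP => //; apply: Fb => //.
by case/andP: tT => t0 _; rewrite (le_trans t0 (ltW tp)).
Qed.

(** Half of the error is the slack in [is_value], half comes from freezing the integral. The [f] of
    each half of [is_value] gives the motion for one sign of [th]. *)
Lemma scheme_step N Phi W M d S e : (0 < N)%N -> is_scheme N Phi -> tube c W M d ->
  0 < e ->
  (forall t t' x y s, 0 <= t -> t <= t' -> t' <= T -> t' - t <= T / N%:R ->
    W x -> Yi c t x y -> enorm s <= S ->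
    `|Hintegral H t t' y s - (t' - t) * H t x s| <= (t' - t) * (e / 2)) ->
  forall t, 0 <= t < T -> step 1 Phi W t (gnext N t) S e /\
    step (- 1) Phi W t (gnext N t) S e.
Proof.
move=> N0 [_ PhiV] tW e0 HF t tT.
have [tp pT pk _] := grid_chain Tpos N0 (lexx _) tT.
set t' := gnext N t in tp pT pk *.
have t0 : 0 <= t by case/andP: tT.
have dl0 : 0 < (t' - t) * (e / 2) by rewrite mulr_gt0 ?subr_gt0// divr_gt0.
split=> x s Wx sS; have [[f1 f1L f1P] [f2 f2L f2P]] := PhiV t x tT s _ dl0;
  rewrite -/t' in f1P f2P.
- have xy := Yi_ext t0 (ltW tp) pT f2L; exists (ext t t' x f2) => //.
  have := HF t t' x _ s t0 (ltW tp) pT pk Wx xy sS.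
  have -> : ext t t' x f2 t' - x t = (t' - t) *: f2.
    by rewrite (ext_end _ _ t0 (ltW tp) pT) addrAC subrr add0r.
  rewrite dotvZr mul1r.
  by move: f2P; rewrite /payoff ler_norml; lra.
- have xy := Yi_ext t0 (ltW tp) pT f1L; exists (ext t t' x f1) => //.
  have := HF t t' x _ s t0 (ltW tp) pT pk Wx xy sS.
  have -> : ext t t' x f1 t' - x t = (t' - t) *: f1.
    by rewrite (ext_end _ _ t0 (ltW tp) pT) addrAC subrr add0r.
  rewrite dotvZr mulN1r.
  by move: f1P; rewrite /payoff ler_norml; lra.
Qed.

Lemma mesh_small k : 0 < k -> exists K, forall l, (K <= l)%N -> T / (2 ^ l)%:R < k.
Proof.
move=> k0; have Tk : 0 < k / T by rewrite divr_gt0.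
have [K KP] := invS_small Tk; exists K => l /KP Hl.
rewrite ltr_pdivrMr ?ltr0n ?expn_gt0// -ltr_pdivrMl//.
have l2 : (l.+1%:R : R) <= (2 ^ l)%:R by rewrite ler_nat ltn_expl.
rewrite invf_plt ?posrE ?ltr0n// in Hl.
apply: lt_le_trans l2; rewrite mulrC -invf_div; exact: Hl.
Qed.

(** Powers of two make the grids nested, so every point of a grid belongs to all later ones. *)
Lemma scheme_seq : exists Phi : nat -> R -> Cf -> R,
  (forall k x, Phi k T x = sigma x) /\
  forall W M d S e, tube c W M d -> 0 < e -> exists K, forall k, (K <= k)%N ->
    forall t, 0 <= t < T -> step 1 (Phi k) W t (gnext (2 ^ k) t) S e /\
      step (- 1) (Phi k) W t (gnext (2 ^ k) t) S e.
Proof.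
have /choice[Phi PhiP] : forall k, exists Phi, is_scheme (2 ^ k) Phi.
  by move=> k; apply: scheme_exists; rewrite expn_gt0.
exists Phi; split; first by move=> k; case: (PhiP k).
move=> W M d S e tW e0; have e2 : 0 < e / 2 by rewrite divr_gt0.
have [k k0 kP] := Hintegral_frozen hpos Tpos cpos B1H B3H S tW e2.
have [K KP] := mesh_small k0; exists K => l /KP lk.
apply: (scheme_step _ (PhiP l) tW e0); first by rewrite expn_gt0.
by move=> t t' x y s t0 tt' t'T tl; apply: kP => //; exact: le_lt_trans lk.
Qed.

End Scheme.

(** * Passage to the limit *)

(** The limit obeys every Cauchy estimate of the sequence with the same [e] and [K]. Thus limits
    chosen pointwise keep the uniformity of the estimates. *)
Lemma cauchy_limit (R : realType) (a : nat -> R) :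
  (forall e, 0 < e -> exists K, forall k l, (K <= k)%N -> (k <= l)%N ->
     `|a k - a l| <= e) ->
  exists L, forall e K, (forall k l, (K <= k)%N -> (k <= l)%N -> `|a k - a l| <= e) ->
    forall k, (K <= k)%N -> `|a k - L| <= e.
Proof.
move=> aC; have [K1 K1P] := aC 1 ltr01.
have [|phi [L [_ [phiI phiL]]]] := @seq_compact_segment R (a K1 - 1) (a K1 + 1)
    (fun k => a (K1 + k)%N).
  by move=> k /=; have := K1P K1 (K1 + k)%N (leqnn _) (leq_addr _ _); rewrite ler_norml; lra.
exists L => e K KP k Kk; apply/ler_addgt0Pr => e' e'0.
have [N NP] := phiL e' e'0.
pose j := maxn N k.
have kj : (k <= K1 + phi j)%N.
  rewrite (leq_trans (leq_maxr N k))//.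
  exact: leq_trans (increasing_nat_ge phiI j) (leq_addl _ _).
have H1 := KP k (K1 + phi j)%N Kk kj; have H2 := NP j (leq_maxl _ _).
have := ler_distD (a (K1 + phi j)%N) (a k) L; lra.
Qed.

Section GridRefinement.
Variables (R : realType) (T : R).
Hypothesis Tpos : 0 < T.

Lemma grid_point_refine k l i : (k <= l)%N ->
  grid_point T (2 ^ k) i = grid_point T (2 ^ l) (i * 2 ^ (l - k)).
Proof.
move=> kl; rewrite /grid_point -{2}(subnK kl) expnD !natrM.
have H1 : (2 ^ k)%:R != 0 :> R by rewrite pnatr_eq0 -lt0n expn_gt0.
have H2 : (2 ^ (l - k))%:R != 0 :> R by rewrite pnatr_eq0 -lt0n expn_gt0.
by field; rewrite H1 H2.
Qed.

Lemma grid_ceil N t : (0 < N)%N -> 0 <= t <= T -> exists i,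
  [/\ t <= grid_point T N i, grid_point T N i <= T & grid_point T N i - t <= T / N%:R].
Proof.
move=> N0 /andP[t0 tT]; have [Tt|tlt] := leP T t.
  exists N; rewrite grid_pointN//; split=> //.
  have : 0 <= T / N%:R by rewrite divr_ge0// ltW.
  lra.
have tT' : 0 <= t < T by rewrite t0.
have [tp pT pk _] := grid_chain Tpos N0 (lexx _) tT'.
by exists (grid_index T N t).+1; split => //; exact: ltW.
Qed.
End GridRefinement.

Section Limit.
Variables (R : realType) (n : nat) (h T c : R).
Hypotheses (hpos : 0 < h) (Tpos : 0 < T) (cpos : 0 < c).
Notation Cf := (Cfun n h T).
Implicit Types (x y z : Cf) (t a b : R) (s r f : 'rV[R]_n).
Variable (H : R -> Cf -> 'rV[R]_n -> R).
Hypotheses (B1H : H_continuous H) (B2H : B2 H c) (B3H : B3 H).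
Variable (sigma : Cf -> R).
Hypothesis (B1s : sigma_continuous sigma).

Notation step := (char_step c H).
Notation gnext := (grid_next T).
Notation gpoint := (grid_point T).

Variable Phi : nat -> R -> Cf -> R.
Hypothesis PhiT : forall k x, Phi k T x = sigma x.
Hypothesis PhiS : forall W M d S e, tube c W M d -> 0 < e -> exists K,
  forall k, (K <= k)%N ->
    forall t, 0 <= t < T -> step 1 (Phi k) W t (gnext (2 ^ k) t) S e /\
      step (- 1) (Phi k) W t (gnext (2 ^ k) t) S e.

Lemma Phi_step W M d S e : tube c W M d -> 0 < e -> exists K, forall l, (K <= l)%N ->
  forall t i, 0 <= t -> t < gpoint (2 ^ l) i -> gpoint (2 ^ l) i <= T ->
  step 1 (Phi l) W t (gpoint (2 ^ l) i) S e /\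
  step (- 1) (Phi l) W t (gpoint (2 ^ l) i) S e.
Proof.
move=> tW e0; have [K KP] := PhiS S tW e0; exists K => l Kl t i t0 ti iT.
have l0 : (0 < 2 ^ l)%N by rewrite expn_gt0.
by split; apply: (char_step_grid hpos Tpos cpos B1H B3H tW l0) => // q qT;
  have [] := KP l Kl q qT.
Qed.

(** Both schemes are run on the coarser grid. The case [k = l] is included: a scheme compared with
    itself gives equicontinuity in the path. *)
Lemma Phi_compare W M d eta : tube c W M d -> 0 < eta ->
  exists A K, 0 <= A /\ forall k l, (K <= k)%N -> (k <= l)%N ->
    forall t x y, 0 <= t <= T -> W x -> W y ->
    Phi k t x - Phi l t y <= A * gauge h (fun t => x t - y t) t + eta /\
    Phi l t x - Phi k t y <= A * gauge h (fun t => x t - y t) t + eta.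
Proof.
move=> tW eta0.
have [A [S [e0 [k0 [[A0 S0 e00 k00] cmp]]]]] :=
  comparison hpos Tpos cpos B1H B3H B1s tW eta0.
have [K1 K1P] := Phi_step S tW e00.
have [K2 K2P] := mesh_small Tpos k00.
exists A, (maxn K1 K2); split => // k l Kk kl t x y tT Wx Wy.
have N0 : (0 < 2 ^ k)%N by rewrite expn_gt0.
have ch := grid_chain Tpos N0 (ltW (K2P k (leq_trans (leq_maxr _ _) Kk))).
have st l' : (k <= l')%N -> forall t, 0 <= t < T ->
    step 1 (Phi l') W t (gnext (2 ^ k) t) S e0 /\
    step (- 1) (Phi l') W t (gnext (2 ^ k) t) S e0.
  move=> kl' q qT; have [tp pT _ _] := ch q qT.
  move: tp pT; rewrite /grid_next (grid_point_refine _ _ kl') => tp pT.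
  apply: K1P => //; last by case/andP: qT.
  by rewrite (leq_trans _ kl')// (leq_trans (leq_maxl _ _) Kk).
have stk := st k (leqnn k); have stl := st l kl.
by split; apply: (cmp _ _ ch) => // q qT; [have [] := stk q qT | have [] := stl q qT
  | have [] := stl q qT | have [] := stk q qT].
Qed.

Lemma gauge_xx x t : - h <= t -> gauge h (fun t => x t - x t) t = 0.
Proof. by move=> ht; apply: gauge0 => // q _; rewrite subrr. Qed.

Lemma Phi_cauchy W M d eta : tube c W M d -> 0 < eta -> exists K, forall k l,
  (K <= k)%N -> (k <= l)%N -> forall t x, 0 <= t <= T -> W x ->
  `|Phi k t x - Phi l t x| <= eta.
Proof.
have hp := hpos; move=> tW eta0; have [A [K [A0 KP]]] := Phi_compare tW eta0.
exists K => k l Kk kl t x tT Wx.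
have [] := KP k l Kk kl t x x tT Wx Wx.
rewrite gauge_xx; last by move: tT; lra.
by rewrite mulr0 add0r ler_norml; lra.
Qed.

Lemma Phi_limit : exists phi : R -> Cf -> R, forall W M d eta, tube c W M d -> 0 < eta ->
  exists K, forall k, (K <= k)%N -> forall t x, 0 <= t <= T -> W x ->
  `|Phi k t x - phi t x| <= eta.
Proof.
have /choice[phi phiP] : forall p : R * Cf, exists L, 0 <= p.1 <= T ->
    forall e K, (forall k l, (K <= k)%N -> (k <= l)%N ->
      `|Phi k p.1 p.2 - Phi l p.1 p.2| <= e) ->
    forall k, (K <= k)%N -> `|Phi k p.1 p.2 - L| <= e.
  move=> [t x] /=; have [tT|] := boolP (0 <= t <= T); last by exists 0.
  have [|L LP] := @cauchy_limit R (fun k => Phi k t x); last by exists L.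
  move=> e e0; have [W [M [d [tW Wx _]]]] := tube_pair hpos Tpos cpos x x.
  by have [K KP] := Phi_cauchy tW e0; exists K => k l Kk kl; exact: KP.
exists (fun t x => phi (t, x)) => W M d eta tW eta0.
have [K KP] := Phi_cauchy tW eta0; exists K => k Kk t x tT Wx.
by apply: (phiP (t, x) tT eta K) => // i j Ki ij; exact: KP.
Qed.

Variable phi : R -> Cf -> R.
Hypothesis phiP : forall W M d eta, tube c W M d -> 0 < eta ->
  exists K, forall k, (K <= k)%N -> forall t x, 0 <= t <= T -> W x ->
  `|Phi k t x - phi t x| <= eta.

Lemma phi_T x : phi T x = sigma x.
Proof.
have [W [M [d [tW Wx _]]]] := tube_pair hpos Tpos cpos x x.
have TT : 0 <= T <= T by rewrite lexx ltW.
apply/eqP; rewrite -subr_eq0 -normr_le0; apply/ler_addgt0Pr => e e0.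
have [K KP] := phiP tW e0.
by have := KP K (leqnn _) T x TT Wx; rewrite PhiT distrC add0r.
Qed.

Lemma phi_gauge W M d eta : tube c W M d -> 0 < eta ->
  exists2 A, 0 <= A & forall t x y, 0 <= t <= T -> W x -> W y ->
    `|phi t x - phi t y| <= A * gauge h (fun t => x t - y t) t + eta.
Proof.
move=> tW eta0; have e3 : 0 < eta / 3 by rewrite divr_gt0.
have [A [K1 [A0 K1P]]] := Phi_compare tW e3.
have [K2 K2P] := phiP tW e3.
exists A => // t x y tT Wx Wy.
pose k := maxn K1 K2.
have [H1 _] := K1P k k (leq_maxl _ _) (leqnn _) t x y tT Wx Wy.
have [H2 _] := K1P k k (leq_maxl _ _) (leqnn _) t y x tT Wy Wx.
have Gs : gauge h (fun t => y t - x t) t = gauge h (fun t => x t - y t) t.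
  rewrite -gaugeN; congr (gauge h _ t); apply/funext => q; exact: opprB.
have := K2P k (leq_maxr _ _) t x tT Wx; have := K2P k (leq_maxr _ _) t y tT Wy.
rewrite Gs in H2.
by rewrite !ler_norml; lra.
Qed.

Lemma phi_nonant t x y : 0 <= t <= T -> (forall q, - h <= q <= t -> x q = y q) ->
  phi t x = phi t y.
Proof.
have hp := hpos; move=> tT xy.
have [W [M [d [tW Wx Wy]]]] := tube_pair hpos Tpos cpos x y.
apply/eqP; rewrite -subr_eq0 -normr_le0; apply/ler_addgt0Pr => e e0.
have [A A0 AP] := phi_gauge tW e0.
have := AP t x y tT Wx Wy; rewrite gauge0 ?mulr0//; first by move: tT; lra.
by move=> q qt; rewrite xy// subrr.
Qed.

Lemma small_power A e : 0 <= A -> 0 < e ->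
  exists2 k : R, 0 < k & forall m, 0 <= m -> m <= k -> A * m ^+ 4 <= e.
Proof.
move=> A0 e0; exists (Num.min 1 (e / (A + 1))).
  by rewrite lt_min ltr01 divr_gt0// ltr_wpDl.
move=> m m0; rewrite le_min => /andP[m1 me].
apply: (@le_trans _ _ (A * m)).
  by rewrite ler_wpM2l// -[leRHS]expr1 ler_wiXn2l.
rewrite ler_pdivlMr ?ltr_wpDl// in me; apply: le_trans me.
by rewrite mulrC ler_wpM2l// lerDl.
Qed.

(** At [s = 0] the step inequalities relate [Phi l t x] to [Phi l] at the grid point along some
    admissible [y]. On a short interval [y] stays close to [x], and equicontinuity in the path
    replaces [y] by [x]. *)
Lemma Phi_time W M d eta : tube c W M d -> 0 < eta ->
  exists k K, 0 < k /\ forall l, (K <= l)%N -> forall t i x, 0 <= t ->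
    t <= gpoint (2 ^ l) i -> gpoint (2 ^ l) i <= T -> gpoint (2 ^ l) i - t < k -> W x ->
    `|Phi l t x - Phi l (gpoint (2 ^ l) i) x| <= eta.
Proof.
have hp := hpos; have cp := cpos; move=> tW eta0.
have e3 : 0 < eta / 3 by rewrite divr_gt0.
have [A [K1 [A0 K1P]]] := Phi_compare tW e3.
have [K2 K2P] := Phi_step 0 tW ltr01.
have [m m0 mP] := small_power A0 e3.
have [E E0 EP] := H_bounded hpos Tpos B1H M 0 (tube_d tW).
have m2 : 0 < m / 2 by rewrite divr_gt0.
have M0 := tube_M tW.
have L0 : 0 < c * (1 + M) by rewrite mulr_gt0// ltr_wpDr.
(* The three bounds limit the oscillation of [x], the displacement of [y], and the integral together
   with the step error; the [1] in [E + 1] is the error rate passed to [Phi_step]. *)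
pose k := Num.min (d (m / 2)) (Num.min (m / 2 / (c * (1 + M))) (eta / 3 / (E + 1))).
have k0 : 0 < k.
  rewrite !lt_min (tube_d tW)//= divr_gt0//=.
  by rewrite divr_gt0// ltr_wpDl.
exists k, (maxn K1 K2); split => // l Kl t i x t0 ti iT ik Wx.
have [->|tni] := eqVneq t (gpoint (2 ^ l) i); first by rewrite subrr normr0 ltW.
set g := gpoint (2 ^ l) i in ti iT ik tni *.
have {}ti : t < g by rewrite lt_neqAle tni.
have tT : 0 <= t <= T by lra.
have gT : 0 <= g <= T by lra.
move: ik; rewrite /k !lt_min => /andP[gd /andP[gc gE]].
have gtl : t < gpoint (2 ^ l) i by [].
have [s1 s2] := K2P l (leq_trans (leq_maxr _ _) Kl) t i t0 gtl iT.
rewrite -/g in s1 s2.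
have z0 : enorm (0 : 'rV[R]_n) <= 0 by rewrite enorm0.
have key y : Yi c t x y ->
    `|Phi l g y - Phi l g x| <= eta / 3 + eta / 3 /\ `|Hintegral H t g y 0| <= (g - t) * E.
  move=> xy; have Wy := tube_inv tW Wx tT xy; split; last first.
    rewrite -[X in `|X|]subr0 -(mulr0 (g - t)).
    apply: Hintegral_approx => //; [exact: ltW|move=> q /andP[tq qg]].
    rewrite subr0; apply: EP => //; last exact: (tube_sub tW Wy).
    by rewrite (le_trans t0 tq) (le_trans qg).
  have Ksym k1 k2 : Phi l g k1 - Phi l g k2 <= eta / 3 + eta / 3 ->
     Phi l g k2 - Phi l g k1 <= eta / 3 + eta / 3 ->
    `|Phi l g k1 - Phi l g k2| <= eta / 3 + eta / 3 by rewrite ler_norml; lra.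
  have yx q : q <= g -> enorm (y q - x q) <= m.
    move=> qg; have [qt|tq] := leP q t.
      by case: xy => -> // _; rewrite subrr enorm0 ltW.
    have qT : q <= T by move: gT; lra.
    have H1 := tube_lip hpos cpos tW Wx tT xy (lexx t) (ltW tq) qT.
    have [_ xd] := tube_sub tW Wx.
    have H2 : enorm (x t - x q) <= m / 2.
      apply: xd => //; apply: le_lt_trans gd.
      by rewrite distrC ger0_norm; lra.
    have H3 : c * (1 + M) * (q - t) <= m / 2.
      rewrite ltr_pdivlMr// mulrC in gc; apply: le_trans (ltW gc).
      by rewrite ler_wpM2l ?(ltW L0)//; lra.
    have xyt : y t = x t by case: xy => -> .
    by have := enormB_tri (y t) (y q) (x q); rewrite {2}xyt; lra.
  have gau (k1 k2 : Cf) : (forall q, q <= g -> enorm (k1 q - k2 q) <= m) ->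
      A * gauge h (fun q => k1 q - k2 q) g <= eta / 3.
    move=> kk; have hg : - h <= g by lra.
    have kc : econt (fun q => k1 q - k2 q) by exact: CfunB_econt.
    apply: (@le_trans _ _ (A * supn (fun q => k1 q - k2 q) (- h) g ^+ 4)).
      by rewrite ler_wpM2l// gauge_ub.
    apply: mP; first exact: supn_ge0.
    by apply: supn_lub => // q /andP[_ qg]; exact: kk.
  have lK1 : (K1 <= l)%N := leq_trans (leq_maxl _ _) Kl.
  have [G1 _] := K1P l l lK1 (leqnn _) g y x gT Wy Wx.
  have [G2 _] := K1P l l lK1 (leqnn _) g x y gT Wx Wy.
  apply: Ksym.
    by apply: le_trans G1 _; rewrite lerD2r; apply: gau => q /yx.
  by apply: le_trans G2 _; rewrite lerD2r; apply: gau => q /yx; rewrite enormBC.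
have gE' : (g - t) * (E + 1) <= eta / 3.
  by rewrite ltr_pdivlMr ?ltr_wpDl// in gE; exact: ltW.
have [y1 /key[P1 Q1] S1] := s1 x 0 Wx z0.
have [y2 /key[P2 Q2] S2] := s2 x 0 Wx z0.
move: S1 S2; rewrite !(dotvC 0) !dotv0 mul1r mulN1r !addr0.
by move: P1 P2 Q1 Q2; rewrite !ler_norml; lra.
Qed.

(** The schemes are controlled in time only against a later grid point, so both times are compared
    with a grid point at or after the later one. *)
Lemma phi_time W M d eta : tube c W M d -> 0 < eta -> exists2 k, 0 < k &
  forall t t' x, 0 <= t <= T -> 0 <= t' <= T -> `|t - t'| < k -> W x ->
  `|phi t x - phi t' x| <= eta.
Proof.
move=> tW eta0; have e4 : 0 < eta / 4 by rewrite divr_gt0.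
have [k [K1 [k0 K1P]]] := Phi_time tW e4.
have [K2 K2P] := phiP tW e4.
have k2 : 0 < k / 2 by rewrite divr_gt0.
have [K3 K3P] := mesh_small Tpos k2.
exists (k / 2) => // t t' x tT t'T tt' Wx.
wlog lett' : t t' tT t'T tt' / t <= t'.
  move=> th; have [|/ltW] := leP t t'; first exact: th.
  by move=> le; rewrite distrC; apply: th => //; rewrite distrC.
pose l := maxn K1 (maxn K2 K3).
have lK1 : (K1 <= l)%N by rewrite leq_maxl.
have lK2 : (K2 <= l)%N by rewrite /l !leq_max leqnn orbT.
have lK3 : (K3 <= l)%N by rewrite /l !leq_max leqnn !orbT.
have [|i [ti iT ig]] := grid_ceil Tpos (N := 2 ^ l) _ t'T; first by rewrite expn_gt0.
have := K3P l lK3; set g := gpoint (2 ^ l) i in ti iT ig * => gl.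
rewrite ler0_norm ?subr_le0// opprB in tt'.
have H1 : `|Phi l t x - Phi l g x| <= eta / 4.
  by apply: K1P => //; [case/andP: tT|exact: le_trans ti|rewrite -/g; lra].
have H2 : `|Phi l t' x - Phi l g x| <= eta / 4.
  by apply: K1P => //; [case/andP: t'T|rewrite -/g; lra].
have := K2P l lK2 t x tT Wx; have := K2P l lK2 t' x t'T Wx.
by move: H1 H2; rewrite !ler_norml; lra.
Qed.

(** All estimates live on compact tubes, whereas continuity concerns arbitrary nearby paths; a
    convergent sequence together with its limit fits into one tube. Finitely many early terms get
    their own modulus, the later ones borrow that of [x]. *)
Lemma tube_seq x (y : nat -> Cf) : (forall j, cdist x (y j) < j.+1%:R^-1) ->
  exists W M d, [/\ tube c W M d, W x & forall j, W (y j)].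
Proof.
move=> xy; have [M [d [M0 d0 xD]]] := Cfun_Dset hpos Tpos x.
have /choice[dy dyP] : forall e : R, exists r : R, 0 < e -> 0 < r /\
    forall j a b, `|a - b| < r -> enorm (y j a - y j b) <= e.
  move=> e; have [e0|] := ltP 0 e; last by exists 0; lra.
  have e3 : 0 < e / 3 by rewrite divr_gt0.
  have [J JP] := invS_small e3.
  have [r r0 rP] : exists2 r : R, 0 < r & forall j, (j < J)%N -> forall a b,
      `|a - b| < r -> enorm (y j a - y j b) <= e.
    elim: {JP}J => [|J [r r0 rP]]; first by exists 1.
    have [r' r'0 r'P] := Cfun_unif hpos Tpos (y J) e0.
    exists (Num.min r r'); first by rewrite lt_min r0.
    move=> j; rewrite ltnS leq_eqVlt => /predU1P[->|jJ] a b; rewrite lt_min => /andP[abr abr'].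
      exact/ltW/r'P.
    exact: rP.
  exists (Num.min r (d (e / 3))) => _; split; first by rewrite lt_min r0 d0.
  move=> j a b; rewrite lt_min => /andP[abr abd].
  have [jJ|Jj] := ltnP j J; first exact: rP.
  have [_ /(_ _ e3 a b abd) H1] := xD.
  have H2 := lt_trans (xy j) (JP j Jj).
  have H3 := cdist_ub hpos Tpos x (y j) a; have H4 := cdist_ub hpos Tpos x (y j) b.
  have H5 := enormB_tri (x a) (y j a) (y j b).
  have H6 := enormB_tri (x b) (x a) (y j b).
  rewrite (enormBC (y j a) (x a)) in H5; lra.
pose K : set Cf := [set z | z = x \/ exists j, z = y j].
have [|||W [M' [d' [tW KW]]]] := @tube_exists R n h T c hpos Tpos cpos K (M + 1)
  (fun e => Num.min (d e) (dy e)).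
- by rewrite addr_ge0.
- by move=> e e0; rewrite lt_min d0//; have [] := dyP e e0.
- move=> z [->|[j ->]].
    by apply: Dset_mono xD => [|e]; rewrite ?lerDl// ge_min lexx.
  split; last first.
    move=> e e0 a b; rewrite lt_min => /andP[_]; have [_] := dyP e e0; exact.
  move=> q; have [xM _] := xD; have := xM q.
  have := cdist_ub hpos Tpos x (y j) q; have := enormB_tri (x q) (y j q) 0.
  have : j.+1%:R^-1 <= 1 :> R by rewrite invf_le1 ?ltr0n// ler1n.
  have := xy j; rewrite !subr0 (enormBC (y j q) (x q)).
  by move: (j.+1%:R^-1) => w; lra.
exists W, M', d'; split => //; first by apply: KW; left.
by move=> j; apply: KW; right; exists j.
Qed.

Lemma phi_cont : phi_continuous phi.
Proof.
have hp := hpos.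
move=> t x; rewrite in_itv/= => tT e e0; apply: contrapT => /forall2NP nex.
have /choice[p pP] : forall j : nat, exists p : R * Cf,
    [/\ 0 <= p.1 <= T, tdist t x p.1 p.2 < j.+1%:R^-1 & e <= `|phi t x - phi p.1 p.2|].
  move=> j; have [] := nex j.+1%:R^-1; first by rewrite invr_gt0 ltr0n.
  move=> /existsNP[q] /existsNP[y] /not_implyP[qT] /not_implyP[qy].
  move=> /negP; rewrite -leNgt => ?; exists (q, y); split => //.
have [|W [M [d [tW Wx Wy]]]] := @tube_seq x (fun j => (p j).2).
  by move=> j; have [_ + _] := pP j; apply: le_lt_trans; rewrite lerDr.
have e4 : 0 < e / 4 by rewrite divr_gt0.
have [A A0 AP] := phi_gauge tW e4.
have [k k0 kP] := phi_time tW e4.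
have [m m0 mP] := small_power A0 e4.
have km0 : 0 < Num.min k m by rewrite lt_min k0.
have [N NP] := invS_small km0.
have [qT xq eq_] := pP N.
have := lt_trans xq (NP N (leqnn _)); rewrite lt_min /tdist => /andP[xqk xqm].
have cd0 := cdist_ge0 hpos Tpos x (p N).2.
have H1 : `|phi t x - phi (p N).1 x| <= e / 4.
  by apply: kP => //; apply: le_lt_trans xqk; rewrite lerDl.
have H2 := AP _ x (p N).2 qT Wx (Wy N).
have hq : - h <= (p N).1 by move: qT; lra.
have H3 : A * gauge h (fun q => x q - (p N).2 q) (p N).1 <= e / 4.
  have zc : econt (fun q => x q - (p N).2 q) by exact: CfunB_econt.
  apply: (@le_trans _ _ (A * supn (fun q => x q - (p N).2 q) (- h) (p N).1 ^+ 4)).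
    by rewrite ler_wpM2l// gauge_ub.
  apply: mP; first exact: supn_ge0.
  apply: supn_lub => // q _; apply: le_trans (cdist_ub hpos Tpos x (p N).2 q) _.
  by apply/ltW/(le_lt_trans _ xqm); rewrite lerDr.
have := ler_distD (phi (p N).1 x) (phi t x) (phi (p N).1 (p N).2).
lra.
Qed.

(** The inequalities of a scheme end at a grid point [g] at or after [t']. Six errors of size
    [e / 6] arise: the step error, [Phi l] against [phi] at [t] and at [g], and three contributions
    of the overhang from [t'] to [g]. *)
Lemma phi_step x s t t' e : 0 <= t -> t < t' -> t' <= T -> 0 < e ->
  (exists2 y, Yi c t x y &
    phi t x - phi t' y + dotv s (y t' - x t) - Hintegral H t t' y s <= e) /\
  (exists2 y, Yi c t x y &
    - e <= phi t x - phi t' y + dotv s (y t' - x t) - Hintegral H t t' y s).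
Proof.
have hp := hpos; have cp := cpos; have Tp := Tpos; move=> t0 tt' t'T e0.
have [W [M [d [tW Wx _]]]] := tube_pair hpos Tpos cpos x x.
have e6 : 0 < e / 6 by rewrite divr_gt0.
have e6T : 0 < e / 6 / T by rewrite divr_gt0.
pose S := enorm s.
have [E E0 EP] := H_bounded hpos Tpos B1H M S (tube_d tW).
have [k k0 kP] := phi_time tW e6.
have [K1 K1P] := phiP tW e6.
have [K2 K2P] := Phi_step S tW e6T.
have M0 := tube_M tW; have S0 : 0 <= S by exact: enorm_ge0.
pose Q := S * (c * (1 + M)).
have Q0 : 0 <= Q by rewrite mulr_ge0// mulr_ge0 ?(ltW cp)// addr_ge0.
pose k' := Num.min k (Num.min (e / 6 / (E + 1)) (e / 6 / (Q + 1))).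
have k'0 : 0 < k'.
  rewrite !lt_min k0/=; apply/andP; split; rewrite divr_gt0// ltr_wpDl//.
have [K3 K3P] := mesh_small Tpos k'0.
pose l := maxn K1 (maxn K2 K3).
have lK1 : (K1 <= l)%N by rewrite leq_maxl.
have lK2 : (K2 <= l)%N by rewrite /l !leq_max leqnn orbT.
have lK3 : (K3 <= l)%N by rewrite /l !leq_max leqnn !orbT.
have t'T' : 0 <= t' <= T by lra.
have tT : 0 <= t <= T by lra.
have [|i [ti iT ig]] := grid_ceil Tpos (N := 2 ^ l) _ t'T'; first by rewrite expn_gt0.
have tg := lt_le_trans tt' ti.
have [s1 s2] := K2P l lK2 t i t0 tg iT.
set g := gpoint (2 ^ l) i in ti iT ig tg s1 s2 *.
have gT : 0 <= g <= T by lra.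
have := le_lt_trans ig (K3P l lK3); rewrite !lt_min => /andP[gk /andP[gE gQ]].
have st : (g - t) * (e / 6 / T) <= e / 6.
  have -> : (g - t) * (e / 6 / T) = e / 6 * ((g - t) / T) by ring.
  by rewrite ler_piMr ?(ltW e6)// ler_pdivrMr//; lra.
have key y : Yi c t x y -> `|(Phi l t x - Phi l g y + dotv s (y g - x t) - Hintegral H t g y s) -
    (phi t x - phi t' y + dotv s (y t' - x t) - Hintegral H t t' y s)| <= 5 * (e / 6).
  move=> xy; have Wy := tube_inv tW Wx tT xy.
  rewrite (@Hintegral_cat _ _ _ _ hpos Tpos H B1H y s t t' g)//; last exact: ltW.
  have -> : y g - x t = (y g - y t') + (y t' - x t) by rewrite addrA subrK.
  rewrite dotvDr.
  have H1 := K1P l lK1 t x tT Wx.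
  have H2 := K1P l lK1 g y gT Wy.
  have H3 : `|phi g y - phi t' y| <= e / 6.
    by apply: kP => //; rewrite ger0_norm ?subr_ge0.
  have H4 : `|dotv s (y g - y t')| <= e / 6.
    apply: le_trans (cauchy_schwarz _ _) _.
    apply: (@le_trans _ _ (S * (c * (1 + M) * (g - t')))).
      rewrite ler_wpM2l//; apply: (tube_lip hpos cpos tW Wx tT xy) => //; exact: ltW.
    rewrite ltr_pdivlMr ?ltr_wpDl// in gQ; apply: le_trans (ltW gQ).
    by rewrite mulrA mulrC ler_wpM2l ?subr_ge0// lerDl.
  have H5 : `|Hintegral H t' g y s| <= e / 6.
    rewrite -[X in `|X|]subr0 -(mulr0 (g - t')).
    apply: (@le_trans _ _ ((g - t') * E)).
      apply: Hintegral_approx => //; first by case/andP: t'T'.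
      move=> q /andP[tq qg]; rewrite subr0; apply: EP => //.
        by case/andP: t'T' => H0 _; rewrite (le_trans H0 tq) (le_trans qg).
      exact: (tube_sub tW Wy).
    rewrite ltr_pdivlMr ?ltr_wpDl// in gE; apply: le_trans (ltW gE).
    by rewrite ler_wpM2l ?subr_ge0// lerDl.
  by move: H1 H2 H3 H4 H5; rewrite !ler_norml; lra.
split.
  have [y xy yP] := s1 x s Wx (lexx _); exists y => //.
  by have := key y xy; move: yP; rewrite mul1r ler_norml; lra.
have [y xy yP] := s2 x s Wx (lexx _); exists y => //.
by have := key y xy; move: yP; rewrite mulN1r ler_norml; lra.
Qed.

End Limit.

(** * Characteristics *)

Section Characteristics.
Variables (R : realType) (n : nat) (h T c : R).
Hypotheses (hpos : 0 < h) (Tpos : 0 < T) (cpos : 0 < c).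
Notation Cf := (Cfun n h T).
Implicit Types (x y z : Cf) (t a b : R) (s f : 'rV[R]_n).
Variable (H : R -> Cf -> 'rV[R]_n -> R).
Hypotheses (B1H : H_continuous H) (B3H : B3 H).
Variable phi : R -> Cf -> R.
Hypothesis phi_na : forall t x y, 0 <= t <= T ->
  (forall q, - h <= q <= t -> x q = y q) -> phi t x = phi t y.
Hypothesis phic : phi_continuous phi.

(* Property (M) asks for [y] with zero defect at all times [t']. *)
Definition defect t t' x y s : R :=
  phi t x - phi t' y + dotv s (y t' - x t) - Hintegral H t t' y s.

Hypothesis phi_step : forall x s t t' e, 0 <= t -> t < t' -> t' <= T -> 0 < e ->
  (exists2 y, Yi c t x y & defect t t' x y s <= e) /\
  (exists2 y, Yi c t x y & - e <= defect t t' x y s).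

Lemma defect_close M (d : R -> R) s e : (forall e, 0 < e -> 0 < d e) -> 0 < e ->
  exists2 k, 0 < k & forall t t' x y z, 0 <= t -> t <= t' -> t' <= T ->
    Dset M d y -> Dset M d z -> cdist y z < k ->
    `|defect t t' x y s - defect t t' x z s| <= e.
Proof.
move=> d0 e0; have e3 : 0 < e / 3 by rewrite divr_gt0.
have e3T : 0 < e / 3 / T by rewrite divr_gt0.
have [k1 k10 k1P] := phi_unif hpos Tpos M phic d0 e3.
have [k2 k20 k2P] := H_unif hpos Tpos B1H M (enorm s) d0 e3T.
pose k3 := e / 3 / (enorm s + 1).
have k30 : 0 < k3 by rewrite divr_gt0// ltr_wpDl ?enorm_ge0.
exists (Num.min k1 (Num.min k2 k3)); first by rewrite !lt_min k10 k20.
move=> t t' x y z t0 tt' t'T yD zD; rewrite !lt_min => /andP[yz1 /andP[yz2 yz3]].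
have t'T' : 0 <= t' <= T by rewrite (le_trans t0 tt').
have H1 : `|phi t' y - phi t' z| <= e / 3.
  by apply: ltW; apply: k1P => //; rewrite subrr normr0 add0r.
have H2 : `|dotv s (y t' - z t')| <= e / 3.
  apply: le_trans (cauchy_schwarz _ _) _.
  apply: (@le_trans _ _ (enorm s * cdist y z)).
    by rewrite ler_wpM2l ?enorm_ge0// cdist_ub.
  rewrite /k3 ltr_pdivlMr ?ltr_wpDl ?enorm_ge0// in yz3; apply: le_trans (ltW yz3).
  by rewrite mulrC ler_wpM2l ?cdist_ge0// lerDl.
have H3 : `|Hintegral H t t' y s - Hintegral H t t' z s| <= e / 3.
  apply: (@le_trans _ _ ((t' - t) * (e / 3 / T))).
    apply: Hintegral_close => // q /andP[tq qt']; apply: ltW; apply: k2P => //.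
    - by rewrite (le_trans t0 tq) (le_trans qt').
    - by rewrite (le_trans t0 tq) (le_trans qt').
    - by rewrite !subrr normr0 add0r enorm0 addr0.
  have -> : (t' - t) * (e / 3 / T) = e / 3 * ((t' - t) / T) by ring.
  have Tp := Tpos.
  by rewrite ler_piMr ?(ltW e3)// ler_pdivrMr//; lra.
rewrite /defect; have -> : y t' - x t = (y t' - z t') + (z t' - x t).
  by rewrite addrA subrK.
rewrite dotvDr; move: H1 H2 H3; rewrite !ler_norml; lra.
Qed.

Lemma eq_defect t t' x y z s : 0 <= t -> t <= t' -> t' <= T ->
  (forall q, q <= t' -> y q = z q) -> defect t t' x y s = defect t t' x z s.
Proof.
move=> t0 tt' t'T yz; rewrite /defect yz// (phi_na (x := y) (y := z)); last first.
- by move=> q /andP[_]; exact: yz.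
- by rewrite (le_trans t0 tt').
by rewrite (@eq_Hintegral _ _ _ _ c hpos Tpos cpos H B3H y z).
Qed.

Lemma defect_cat t t' t'' x y z s : 0 <= t -> t <= t' -> t' <= t'' -> t'' <= T ->
  Yi c t' y z -> defect t t'' x z s = defect t t' x y s + defect t' t'' y z s.
Proof.
move=> t0 tt' t't'' t''T [zy _].
rewrite /defect (@Hintegral_cat _ _ _ _ hpos Tpos H B1H z s t t' t'')//.
rewrite (@eq_Hintegral _ _ _ _ c hpos Tpos cpos H B3H z y)//; last exact: le_trans t''T.
have -> : z t'' - x t = (z t'' - y t') + (y t' - x t) by rewrite addrA subrK.
by rewrite dotvDr; ring.
Qed.

(* The stopped paths join [y] to the path that stays at [x t]; along this arc the
   defect is continuous, so it takes all intermediate values. *)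
Lemma defect_ivt t t' x y s v : 0 <= t -> t <= t' -> t' <= T -> Yi c t x y ->
  Num.min (defect t t' x (stop hpos Tpos t x) s) (defect t t' x y s) <= v <=
  Num.max (defect t t' x (stop hpos Tpos t x) s) (defect t t' x y s) ->
  exists2 z, Yi c t x z & defect t t' x z s = v.
Proof.
have hp := hpos; move=> t0 tt' t'T xy.
pose f q := defect t t' x (stop hpos Tpos q y) s.
have ft : f t = defect t t' x (stop hpos Tpos t x) s.
  apply: eq_defect => // q qt'; have tT : - h <= t <= T by lra.
  have [yx _] := xy.
  have [qt|tq] := leP q t; first by rewrite !stop_le// yx.
  by rewrite !stop_ge ?(ltW tq)// yx.
have ft' : f t' = defect t t' x y s.
  by apply: eq_defect => // q qt'; rewrite stop_le//; lra.
have [W [M [d [tW Wx _]]]] := tube_pair hpos Tpos cpos x x.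
have tT : 0 <= t <= T by lra.
have fD q : t <= q <= t' -> Yi c t x (stop hpos Tpos q y).
  by move=> /andP[tq qt']; apply: Yi_stop => //; exact: le_trans t'T.
have fc : {within `[t, t'], continuous f}.
  apply/subspace_continuousP => q; rewrite /= in_itv/= => qt.
  apply/cvgrPdist_le => e e0.
  have [k k0 kP] := defect_close M s (tube_d tW) e0.
  have k2 : 0 < k / 2 by rewrite divr_gt0.
  have [r r0 rP] := Cfun_unif hpos Tpos y k2.
  rewrite near_withinE; apply/nbhs_ballP; exists r => //= q' qq'.
  rewrite /= in_itv/= => q't; rewrite /f; apply: kP => //.
  - exact: (tube_sub tW (tube_inv tW Wx tT (fD q qt))).
  - exact: (tube_sub tW (tube_inv tW Wx tT (fD q' q't))).
  - apply: (@le_lt_trans _ _ (k / 2)); last by lra.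
    apply: cdist_lub => // w _; rewrite !stopE; [|lra..].
    apply/ltW/rP; apply: le_lt_trans qq'.
    rewrite !(minC _ w) -[leRHS]mul1r; exact: stop_lip.
move=> vP; have [|q qI fq] := @IVT R f t t' v tt' fc; first by rewrite ft ft'.
by exists (stop hpos Tpos q y) => //; apply: fD; rewrite in_itv in qI.
Qed.

(** If the resting path has nonnegative defect, the path with defect at most [e] either has small
    defect itself or the opposite sign, and then an intermediate path has defect zero. A negative
    defect of the resting path is treated symmetrically. *)
Lemma defect_small t t' x s e : 0 <= t -> t < t' -> t' <= T -> 0 < e ->
  exists2 y, Yi c t x y & `|defect t t' x y s| <= e.
Proof.
move=> t0 tt' t'T e0.
have [[y1 xy1 D1] [y2 xy2 D2]] := phi_step x s t0 tt' t'T e0.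
pose v := defect t t' x (stop hpos Tpos t x) s.
have ivt y : Yi c t x y -> Num.min v (defect t t' x y s) <= 0 <=
    Num.max v (defect t t' x y s) -> exists2 z, Yi c t x z & `|defect t t' x z s| <= e.
  move=> xy /(defect_ivt t0 (ltW tt') t'T xy)[z xz zE].
  by exists z => //; rewrite zE normr0 ltW.
have [v0|v0] := leP 0 v.
  have [D0|D0] := leP 0 (defect t t' x y1 s).
    by exists y1 => //; rewrite ger0_norm.
  by apply: (ivt _ xy1); rewrite ge_min le_max v0 (ltW D0) orbT.
have [D0|D0] := leP (defect t t' x y2 s) 0.
  by exists y2 => //; rewrite ler_norml D2 (le_trans D0 (ltW e0)).
by apply: (ivt _ xy2); rewrite ge_min le_max (ltW v0) (ltW D0) orbT.
Qed.

(** Each step restarts from the path built so far. Defects add up along concatenations, and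
    non-anticipation keeps the earlier ones unchanged. *)
Lemma defect_chain t x s (r e : R) (i : nat) : 0 <= t -> 0 < r -> 0 < e ->
  t + i%:R * r <= T ->
  exists2 y, Yi c t x y & forall j, (j <= i)%N ->
    `|defect t (t + j%:R * r) x y s| <= j%:R * e.
Proof.
have hp := hpos; move=> t0 r0 e0; elim: i => [|i IH] iT.
  have tT : t <= T by move: iT; rewrite mul0r addr0.
  (* The path [x] itself need not be Lipschitz after [t]; its stopped version is admissible. *)
  exists (stop hpos Tpos t x).
    split; first by move=> q qt; rewrite stop_le//; lra.
    move=> a b ta ab bT; rewrite !stop_ge ?(le_trans ta)//; [|lra..].
    rewrite subrr enorm0 mulr_ge0 ?subr_ge0// mulr_ge0 ?(ltW cpos)// addr_ge0//.
    by apply: (supn_cf_ge0 hpos Tpos); lra.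
  move=> j; rewrite leqn0 => /eqP ->; rewrite !mul0r addr0 /defect.
  rewrite stop_le ?lexx//; last by lra.
  rewrite subrr dotv0 addr0 (phi_na (y := stop hpos Tpos t x)); last first.
  - by move=> q /andP[_ qt]; rewrite stop_le//; lra.
  - by rewrite t0.
  by rewrite subrr sub0r /Hintegral set_itv1 Rintegral_set1 oppr0 normr0.
have ir : i.+1%:R * r = i%:R * r + r by rewrite -natr1 mulrDl mul1r.
rewrite ir in iT.
have ir0 : 0 <= i%:R * r by rewrite mulr_ge0// ltW.
have [|y xy yP] := IH; first by lra.
set a := t + i%:R * r in yP; set b := t + (i.+1%:R * r).
have ab : b = a + r by rewrite /a /b ir addrA.
have a0 : 0 <= a by rewrite addr_ge0.
have bT : b <= T by rewrite /b ir.
have [|z yz zP] := @defect_small a b y s e a0 _ bT e0; first by rewrite ab; lra.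
have ta : t <= a by rewrite lerDl.
have leab : a <= b by rewrite ab; lra.
exists z; first by apply: (Yi_trans hpos Tpos cpos t0 ta (le_trans leab bT) xy yz).
move=> j; rewrite leq_eqVlt => /predU1P[->|].
  rewrite -/b (defect_cat x s t0 ta leab bT yz).
  apply: le_trans (ler_normD _ _) _; rewrite -natr1 mulrDl mul1r lerD//.
  exact: yP.
rewrite ltnS => ji; have jr : t + j%:R * r <= a by rewrite lerD2l ler_pM2r// ler_nat.
have jr0 : t <= t + j%:R * r by rewrite lerDl mulr_ge0// ltW.
rewrite (@eq_defect _ _ x z y s) ?yP//; first by lra.
by move=> q qj; case: yz => -> //; exact: le_trans jr.
Qed.

(** The [N] steps accumulate at most [e / 2] at grid times. Between them the functional, the scalar
    product and the integral each move by at most [e / 6], by estimates uniform on the tube. *)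
Lemma defect_small_all t x s e : 0 <= t -> t < T -> 0 < e ->
  exists2 y, Yi c t x y & forall q, t <= q <= T -> `|defect t q x y s| <= e.
Proof.
have hp := hpos; have cp := cpos; move=> t0 tT e0.
have [W [M [d [tW Wx _]]]] := tube_pair hpos Tpos cpos x x.
have tT' : 0 <= t <= T by rewrite t0 ltW.
have e2 : 0 < e / 2 by rewrite divr_gt0.
have e6 : 0 < e / 6 by rewrite divr_gt0.
have [k1 k10 k1P] := phi_unif hpos Tpos M phic (tube_d tW) e6.
have M0 := tube_M tW.
have [E E0 EP] := H_bounded hpos Tpos B1H M (enorm s) (tube_d tW).
pose Q := enorm s * (c * (1 + M)).
have Q0 : 0 <= Q by rewrite mulr_ge0 ?enorm_ge0// mulr_ge0 ?(ltW cp)// addr_ge0.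
pose k := Num.min k1 (Num.min (e / 6 / (E + 1)) (e / 6 / (Q + 1))).
have k0 : 0 < k.
  by rewrite !lt_min k10/=; apply/andP; split; rewrite divr_gt0// ltr_wpDl.
pose N := (Num.bound ((T - t) / k)).+1.
have N0 : 0 < N%:R :> R by rewrite ltr0n.
pose r := (T - t) / N%:R.
have r0 : 0 < r by rewrite divr_gt0// subr_gt0.
have rk : r < k.
  rewrite ltr_pdivrMr// mulrC -ltr_pdivrMr//.
  apply: lt_trans (archi_boundP _) _; last by rewrite ltr_nat.
  by rewrite divr_ge0 ?(ltW k0)// subr_ge0 ltW.
have NT : t + N%:R * r = T by rewrite /r mulrC divfK ?gt_eqF// addrC subrK.
have eN0 : 0 < e / 2 / N%:R by rewrite divr_gt0.
have [|y xy yP] := @defect_chain t x s r (e / 2 / N%:R) N t0 r0 eN0.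
  by rewrite NT.
have Wy := tube_inv tW Wx tT' xy; have Dy := tube_sub tW Wy.
exists y => // q /andP[tq qT].
have qr0 : 0 <= (q - t) / r by rewrite divr_ge0 ?(ltW r0)// subr_ge0.
pose i := Num.truncn ((q - t) / r).
have /andP[i1 i2] : i%:R <= (q - t) / r < i.+1%:R by exact: truncn_itv.
rewrite ler_pdivlMr// in i1; rewrite ltr_pdivrMr// -natr1 mulrDl mul1r in i2.
have iN : (i <= N)%N.
  have : i%:R * r <= N%:R * r by move: NT; lra.
  by rewrite ler_pM2r// ler_nat.
set p := t + i%:R * r.
have tp : t <= p by rewrite lerDl mulr_ge0// ltW.
have pq : p <= q by rewrite /p; lra.
have qp : q - p < k by rewrite /p; lra.
have pT : 0 <= p <= T by lra.
have qT' : 0 <= q <= T by lra.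
have D1 : `|defect t p x y s| <= e / 2.
  apply: le_trans (yP i iN) _; apply: (@le_trans _ _ (N%:R * (e / 2 / N%:R))).
    by rewrite ler_pM2r// ler_nat.
  by rewrite mulrC divfK ?gt_eqF.
move: qp; rewrite !lt_min => /andP[qk1 /andP[qE qQ]].
have H1 : `|phi q y - phi p y| <= e / 6.
  by apply: ltW; apply: k1P => //; rewrite cdist_xx// addr0 ger0_norm// subr_ge0.
have H2 : `|dotv s (y q - y p)| <= e / 6.
  apply: le_trans (cauchy_schwarz _ _) _.
  apply: (@le_trans _ _ (enorm s * (c * (1 + M) * (q - p)))).
    by rewrite ler_wpM2l ?enorm_ge0//; exact: (tube_lip hpos cpos tW Wx tT' xy).
  rewrite ltr_pdivlMr ?ltr_wpDl// in qQ; apply: le_trans (ltW qQ).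
  by rewrite mulrA mulrC ler_wpM2l ?subr_ge0// lerDl.
have H3 : `|Hintegral H p q y s| <= e / 6.
  rewrite -[X in `|X|]subr0 -(mulr0 (q - p)).
  apply: (@le_trans _ _ ((q - p) * E)).
    apply: Hintegral_approx => //; first by case/andP: pT.
    move=> w /andP[pw wq]; rewrite subr0; apply: EP => //; lra.
  rewrite ltr_pdivlMr ?ltr_wpDl// in qE; apply: le_trans (ltW qE).
  by rewrite ler_wpM2l ?subr_ge0// lerDl.
move: D1 H1 H2 H3; rewrite /defect.
rewrite (@Hintegral_cat _ _ _ _ hpos Tpos H B1H y s t p q)//.
have -> : y q - x t = (y q - y p) + (y p - x t) by rewrite addrA subrK.
by rewrite (dotvDr (y q - y p)) !ler_norml; lra.
Qed.

Lemma Yi_closed t x (y : nat -> Cf) z : 0 <= t <= T -> (forall k, Yi c t x (y k)) ->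
  (forall e, 0 < e -> exists k, cdist (y k) z < e) -> Yi c t x z.
Proof.
have hp := hpos; have cp := cpos; move=> tT xy yz; split.
  move=> q qt; apply/eqP; rewrite -subr_eq0; apply/eqP/enorm0_eq0.
  apply/eqP; rewrite eq_le enorm_ge0 andbT; apply/ler_addgt0Pr => e e0.
  have [k kP] := yz e e0; have [yx _] := xy k.
  rewrite add0r -(yx q qt) enormBC.
  exact: le_trans (cdist_ub hpos Tpos _ _ _) (ltW kP).
move=> a b ta ab bT; apply/ler_addgt0Pr => e e0.
(* The factor in front of [cdist (y k) z]: one for each endpoint of the increment, and [c * (b - a)]
   for the running maximum. *)
pose w := 2 + c * (b - a).
have w0 : 0 < w by rewrite ltr_pwDl// mulr_ge0 ?subr_ge0// ltW.
have [k kP] := yz (e / w) (divr_gt0 e0 w0); have [_ /(_ a b ta ab bT) yL] := xy k.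
have hb : - h <= b by move: tT; lra.
have H1 := cdist_ub hpos Tpos (y k) z a; have H2 := cdist_ub hpos Tpos (y k) z b.
have H3 : supn (y k) (- h) b <= supn z (- h) b + cdist (y k) z.
  apply: supn_lub => // q /andP[_ qb].
  have := enormB_tri (z q) (y k q) 0; rewrite !subr0.
  have := cdist_ub hpos Tpos (y k) z q; have := supn_cf_ub hpos Tpos z hb qb.
  lra.
have H4 := enormB_tri (y k b) (z b) (z a).
have H5 := enormB_tri (y k a) (y k b) (z a).
rewrite (enormBC (z b) (y k b)) in H4.
rewrite ltr_pdivlMr// in kP.
have H6 : c * (1 + supn (y k) (- h) b) * (b - a) <=
    c * (1 + supn z (- h) b) * (b - a) + cdist (y k) z * (c * (b - a)).
  have -> : c * (1 + supn z (- h) b) * (b - a) + cdist (y k) z * (c * (b - a)) =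
    c * (1 + (supn z (- h) b + cdist (y k) z)) * (b - a) by ring.
  by rewrite ler_wpM2r ?subr_ge0// ler_wpM2l ?(ltW cp)// lerD2l.
by move: kP; rewrite /w; lra.
Qed.

(** Paths with defect at most [1 / (k + 1)] at all times lie in one compact set. Admissibility
    passes to a limit by [Yi_closed], vanishing of the defect by [defect_close]. *)
Lemma characteristic_exists t x s : 0 <= t < T ->
  exists2 y, Yi c t x y & forall q, t <= q <= T -> defect t q x y s = 0.
Proof.
move=> /andP[t0 tT]; have tT' : 0 <= t <= T by rewrite t0 ltW.
have /choice[y yP] : forall k : nat, exists y, Yi c t x y /\
    forall q, t <= q <= T -> `|defect t q x y s| <= k.+1%:R^-1.
  move=> k; have k0 : 0 < k.+1%:R^-1 :> R by rewrite invr_gt0.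
  by have [y xy yP] := defect_small_all x s t0 tT k0; exists y.
have [W [M [d [tW Wx _]]]] := tube_pair hpos Tpos cpos x x.
have yD k : Dset M d (y k).
  by have [xy _] := yP k; exact: (tube_sub tW (tube_inv tW Wx tT' xy)).
have [p [z [zD [pI pz]]]] := Dset_compact hpos Tpos (tube_d tW) yD.
exists z.
  apply: (Yi_closed (y := y \o p)) => //; first by move=> k; have [] := yP (p k).
  by move=> e /pz[N NP]; exists N; exact: NP.
move=> q /andP[tq qT]; apply/eqP; rewrite -normr_le0; apply/ler_addgt0Pr => e e0.
have e2 : 0 < e / 2 by rewrite divr_gt0.
have [k k0 kP] := defect_close M s (tube_d tW) e2.
have [N1 N1P] := pz k k0; have [N2 N2P] := invS_small e2.
pose N := maxn N1 N2.
have H1 := kP t q x _ z t0 tq qT (yD (p N)) zD (N1P N (leq_maxl _ _)).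
have [_ /(_ q)] := yP (p N); rewrite tq qT => /(_ isT) H2.
have H3 := N2P (p N) (leq_trans (leq_maxr N1 N2) (increasing_nat_ge pI N)).
have {H3}H2 := le_lt_trans H2 H3.
by move: H1 H2; rewrite add0r ler_norml ltr_norml; rewrite ler_norml; lra.
Qed.

Lemma property_M_of_defect : property_M H c phi.
Proof.
move=> t x s; rewrite in_itv/= => tT.
have [y xy yP] := characteristic_exists x s tT.
exists y; split.
  by apply: Yi_Yset => //; case/andP: tT => -> /ltW.
move=> q; rewrite in_itv/= => /yP; rewrite /defect /Hintegral; lra.
Qed.

End Characteristics.

Unset Implicit Arguments.

Theorem theorem1 (R : realType) (n : nat) (h T : R) (hpos : 0 < h) (Tpos : 0 < T)
    (H : R -> Cfun n h T -> 'rV[R]_n -> R) (sigma : Cfun n h T -> R) (c : R)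
    (cpos : 0 < c)
    (B1H : H_continuous H) (B1s : sigma_continuous sigma)
    (B2H : B2 H c) (B3H : B3 H) :
  (exists phi : R -> Cfun n h T -> R, minimax_solution H sigma c phi) /\
  (forall phi1 phi2 : R -> Cfun n h T -> R,
      minimax_solution H sigma c phi1 -> minimax_solution H sigma c phi2 ->
      forall t (x : Cfun n h T), t \in `[0, T] -> phi1 t x = phi2 t x).
Proof.
split; last first.
  move=> phi1 phi2 m1 m2 t x; rewrite in_itv/=.
  exact: (minimax_unique hpos Tpos cpos B1H B3H B1s m1 m2).
have [Phi [PhiT PhiS]] := scheme_seq hpos Tpos cpos B1H B2H B3H B1s.
have [phi phiP] := Phi_limit hpos Tpos cpos B1H B3H B1s PhiT PhiS.
have na (t : R) (x y : Cfun n h T) : 0 <= t <= T -> (forall q, - h <= q <= t -> x q = y q) ->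
    phi t x = phi t y.
  exact: (phi_nonant hpos Tpos cpos B1H B3H B1s PhiT PhiS phiP).
have phic : phi_continuous phi.
  exact: (phi_cont hpos Tpos cpos B1H B3H B1s PhiT PhiS phiP).
exists phi; split => //.
- move=> t x y; rewrite in_itv/= => /andP[t0 tT] xy.
  apply: na; first by rewrite t0 ltW.
  by move=> q qt; apply: xy; rewrite in_itv.
- exact: (phi_T hpos Tpos cpos PhiT phiP).
- apply: (property_M_of_defect hpos Tpos cpos B1H B3H na phic).
  exact: (phi_step hpos Tpos cpos B1H B3H B1s PhiT PhiS phiP).
Qed.
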